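(* Let $N\ge1$, $L_k,C_k>0$ for $1\le k\le N$, and $1\le p\le\infty$. Let $\mathbf{A}:[0,\infty)\to\mathbb{R}^{2N\times 2N}$ be measurable and essentially bounded, and assume there is $\alpha>0$, independent of $t$, with $\mathbf{A}(t)+\mathbf{A}^*(t)\ge\alpha\,Id$ for a.e. $t\ge0$. I) If $i_k^0,v_k^0\in L^p([0,1])$ for $1\le k\le N$, there is a unique map $(t,x)\mapsto(v_1(t,x),\dots,v_N(t,x),i_1(t,x),\dots,i_N(t,x))$ from $\Omega=\{(t,x)\in\mathbb{R}^2:0<x<1,\ t>0\}$ into $\mathbb{R}^{2N}$ such that: (a) $t\mapsto(v_1(t,\cdot),\dots,v_N(t,\cdot),i_1(t,\cdot),\dots,i_N(t,\cdot))$ belongs to $L^1_{loc}([0,\infty),(L^p([0,1]))^{2N})$, and $v_k,i_k$ have a strict extension to $\partial\Omega$ satisfying the initial conditions $\widehat v_k(0,x)=v_k^0(x)$, $\widehat\imath_k(0,x)=i_k^0(x)$ for $k=1,\dots,N$; (b) for $1\le k\le N$ and all $C^\infty$ functions $\varphi:\Omega\to\mathbb{R}$ with compact support, $$\iint_\Omega\Bigl(L_k i_k\frac{\partial\varphi}{\partial t}+v_k\frac{\partial\varphi}{\partial x}\Bigr)dt\,dx=0,\qquad \iint_\Omega\Bigl(C_k v_k\frac{\partial\varphi}{\partial t}+i_k\frac{\partial\varphi}{\partial x}\Bigr)dt\,dx=0,$$ and $$\begin{pmatrix}\widehat v(t,0)\\ \widehat v(t,1)\end{pmatrix}=\mathbf{A}(t)\begin{pmatrix}-\widehat\imath(t,0)\\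 \widehat\imath(t,1)\end{pmatrix}\quad\text{for a.e. }t\in(0,\infty),$$ where $\widehat v=(\widehat v_1,\dots,\widehat v_N)^*$, $\widehat\imath=(\widehat\imath_1,\dots,\widehat\imath_N)^*$. II) If, in addition, $t\mapsto\mathbf{A}(t)$ is continuous and $v_1^0,\dots,v_N^0,i_1^0,\dots,i_N^0$ are elements of $C^0([0,1])$ satisfying $$\begin{pmatrix}v^0(0)\\ v^0(1)\end{pmatrix}=\mathbf{A}(0)\begin{pmatrix}-i^0(0)\\ i^0(1)\end{pmatrix},\qquad v^0=(v^0_1,\dots,v^0_N)^*,\ i^0=(i^0_1,\dots,i^0_N)^*,$$ then the map $(t,x)\mapsto(v_1(t,x),\dots,v_N(t,x),i_1(t,x),\dots,i_N(t,x))$ from part I is continuous $\overline\Omega\to\mathbb{R}^{2N}$ (equivalently, $t\mapsto(v_1(t,\cdot),\dots,i_N(t,\cdot))$ is continuous $[0,\infty)\to C^0([0,1])^{2N}$) and satisfies the initial conditions in the strong sense: $v_k(0,x)=v_k^0(x)$, $i_k(0,x)=i_k^0(x)$ for all $x\in[0,1]$ and $k=1,\dots,N$.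
   Context: $^*$ denotes transpose; the matrix inequality is between symmetric matrices. $\overline\Omega=[0,\infty)\times[0,1]$ is the closure of $\Omega$. Functions in Lebesgue spaces are identified when equal a.e. For a Banach space $F$, $L^1_{loc}([0,\infty),F)$ is the space of $F$-valued measurable functions $f$ on $[0,\infty)$ such that $\|f\|_F$ is locally integrable on $[0,\infty)$; elements of $L^1_{loc}([0,\infty),L^p([0,1]))$ are identified with elements of $L^1_{loc}(\overline\Omega)$ (functions integrable on every compact subset of $\overline\Omega$). Strict extension. For $h\in L^1_{loc}(\overline\Omega)$ set, whenever the limits exist (as $\varepsilon\to0^+$), $\widehat h(t,0)=\lim\frac1\varepsilon\int_0^\varepsilon h(t,s)\,ds$, $\widehat h(t,1)=\lim\frac1\varepsilon\int_{1-\varepsilon}^1 h(t,s)\,ds$, $\widehat h(0,x)=\lim\frac1\varepsilon\int_0^\varepsilon h(s,x)\,ds$. The function $h$ has a strict extension to $\partial\Omega$ if these limits exist for almost all $x\in(0,1)$ and almost all $t\in(0,\infty)$; the strict extension is then given (a.e. with respect to arc length on $\partial\Omega$) by $\widehat h(0,\cdot)$, $\widehat h(\cdot,0)$, $\widehat h(\cdot,1)$. The initial conditions in part I are equalities for a.e. $x\in(0,1)$. The equations in (b) are the distributional form of the telegrapher's equations $C_k\partial_t v_k=-\partial_x i_k$, $L_k\partial_t i_k=-\partial_x v_k$ with time-varying linear boundary coupling. *)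

(* Defs.v *)
From mathcomp Require Export all_boot all_order all_algebra.
From mathcomp Require Export all_classical all_reals all_analysis.
Export Order.TTheory GRing.Theory Num.Theory.
Export numFieldNormedType.Exports.

Set Implicit Arguments.
Unset Strict Implicit.
Unset Printing Implicit Defensive.

Global Open Scope classical_set_scope.
Global Open Scope ring_scope.

(* Points of the plane are pairs (t, x). Functions are total on [R] or [R * R];
   only their restriction to the domain at hand matters. *)
Definition Omega {R : realType} : set (R * R) :=
  [set t : R | 0 < t] `*` [set x : R | 0 < x < 1].

Definition Omega_bar {R : realType} : set (R * R) :=
  [set t : R | 0 <= t] `*` [set x : R | 0 <= x <= 1].

Definition lebesgue2 {R : realType} :
    {measure set (measurableTypeR R * measurableTypeR R)%type -> \bar R} :=
  (@lebesgue_measure R \x @lebesgue_measure R)%E.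

(* The library's Lebesgue measure lives on the Borel sigma-algebra, hence
   [measurable_fun] is Borel measurability; Lebesgue measurability, i.e.
   measurability for the completed measure, is the following. *)
Definition ae_measurable {d} {T : measurableType d} {R : realType}
    (mu : {measure set T -> \bar R}) (D : set T) (f : T -> R) : Prop :=
  exists2 g : T -> R, measurable_fun D g & ae_eq mu D f g.

Definition Lp_norm01 {R : realType} (p : \bar R) (f : R -> R) : \bar R :=
  Lnorm lebesgue_measure p (EFin \o (f \_ `[0, 1])).

Definition Lp01 {R : realType} (p : \bar R) (f : R -> R) : Prop :=
  ae_measurable lebesgue_measure `[0, 1] f /\ (Lp_norm01 p f < +oo)%E.

(* Measurability in time with values in L^p is taken in the sense of the
   identification with functions of (t, x), i.e. as joint measurability: strong
   measurability would be too restrictive for p = +oo, where already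
   translations of a bounded function are not strongly measurable. *)
Definition L1loc_Lp {R : realType} (p : \bar R) (h : R * R -> R) : Prop :=
  ae_measurable lebesgue2 Omega h /\
  forall T : R, 0 < T ->
    (\int[lebesgue_measure]_(t in `[0%R, T]) Lp_norm01 p (fun x => h (t, x))
       < +oo)%E.

Definition avg_x0 {R : realType} (h : R * R -> R) (t e : R) : R :=
  e^-1 * \int[lebesgue_measure]_(s in `[0, e]) h (t, s).
Definition avg_x1 {R : realType} (h : R * R -> R) (t e : R) : R :=
  e^-1 * \int[lebesgue_measure]_(s in `[1 - e, 1]) h (t, s).
Definition avg_t0 {R : realType} (h : R * R -> R) (x e : R) : R :=
  e^-1 * \int[lebesgue_measure]_(s in `[0, e]) h (s, x).

(* [lim] is a default value where the limit does not exist: these traces are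
   meaningful only together with [strict_extension]. *)
Definition hat_x0 {R : realType} (h : R * R -> R) (t : R) : R :=
  lim (avg_x0 h t e @[e --> 0^'+]).
Definition hat_x1 {R : realType} (h : R * R -> R) (t : R) : R :=
  lim (avg_x1 h t e @[e --> 0^'+]).
Definition hat_t0 {R : realType} (h : R * R -> R) (x : R) : R :=
  lim (avg_t0 h x e @[e --> 0^'+]).

Definition strict_extension {R : realType} (h : R * R -> R) : Prop :=
  [/\ {ae @lebesgue_measure R, forall t, 0 < t ->
         cvg (avg_x0 h t e @[e --> 0^'+])},
      {ae @lebesgue_measure R, forall t, 0 < t ->
         cvg (avg_x1 h t e @[e --> 0^'+])} &
      {ae @lebesgue_measure R, forall x, 0 < x < 1 ->
         cvg (avg_t0 h x e @[e --> 0^'+])}].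

Definition dt {R : realType} (phi : R * R -> R) (z : R * R) : R :=
  'D_((1, 0) : R * R) phi z.
Definition dx {R : realType} (phi : R * R -> R) (z : R * R) : R :=
  'D_((0, 1) : R * R) phi z.

Fixpoint class_C {R : realType} (D : set (R * R)) (n : nat)
    (phi : R * R -> R) : Prop :=
  (forall z, D z -> {for z, continuous phi}) /\
  if n is m.+1 then
    [/\ forall z, D z -> derivable phi z ((1, 0) : R * R),
        forall z, D z -> derivable phi z ((0, 1) : R * R),
        class_C D m (dt phi) & class_C D m (dx phi)]
  else True.

(* The support is the closure relative to [Omega]. *)
Definition test_function {R : realType} (phi : R * R -> R) : Prop :=
  (forall n, class_C Omega n phi) /\
  compact (Omega `&` closure [set z | Omega z /\ phi z != 0]).

Definition loewner_le {R : realType} {n : nat} (B C : 'M[R]_n) : Prop :=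
  forall y : 'cV[R]_n, 0 <= (y^T *m (C - B) *m y) 0 0.

Record telegrapher_solution {R : realType} {N : nat} (L C : 'I_N -> R)
    (p : \bar R) (A : R -> 'M[R]_(N + N)) (v0 i0 : 'I_N -> R -> R)
    (v i : 'I_N -> R * R -> R) : Prop := TelegrapherSolution {
  sol_Lp : forall k, L1loc_Lp p (v k) /\ L1loc_Lp p (i k) ;
  sol_strict : forall k, strict_extension (v k) /\ strict_extension (i k) ;
  sol_init : forall k, {ae @lebesgue_measure R, forall x, 0 < x < 1 ->
      hat_t0 (v k) x = v0 k x /\ hat_t0 (i k) x = i0 k x} ;
  sol_eqn_i : forall k phi, test_function phi ->
    (\int[lebesgue2]_(z in Omega)
       (L k * i k z * dt phi z + v k z * dx phi z)%:E = 0)%E ;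
  sol_eqn_v : forall k phi, test_function phi ->
    (\int[lebesgue2]_(z in Omega)
       (C k * v k z * dt phi z + i k z * dx phi z)%:E = 0)%E ;
  sol_bdry : {ae @lebesgue_measure R, forall t, 0 < t ->
    col_mx (\col_k hat_x0 (v k) t) (\col_k hat_x1 (v k) t) =
    A t *m col_mx (\col_k - hat_x0 (i k) t) (\col_k hat_x1 (i k) t)} }.

(* Main.v *)
Require Import Defs.
From mathcomp Require Import measurable_realfun ess_sup_inf ring lra.
Set Implicit Arguments.
Unset Strict Implicit.
Unset Printing Implicit Defensive.

(** Put [tau_k = sqrt (L_k * C_k)] and [Z_k = sqrt (L_k / C_k)]. The equations of
line [k] decouple in the combinations [(v_k + Z_k i_k) / 2] and
[(v_k - Z_k i_k) / 2], which are transported at the speeds [1 / tau_k] and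
[- 1 / tau_k]: they are waves [F_k (t - tau_k x)] and [G_k (t + tau_k x)], and
conversely any two such waves superpose to a solution of the equations. Only
the boundary condition couples the [2 N] functions of one variable [F_k], [G_k].

At each of the [2 N] ends of lines one wave arrives and one leaves. Let [W (t)]
and [U (t)] be the vectors of arriving and leaving waves, [D] the diagonal
matrix of the impedances [Z_k] and [y] the vector [(- i (t, 0), i (t, 1))]. Then
the voltages at the ends are [U + W], [D y = W - U], and the boundary condition
[U + W = A y] reads [(D + A) y = 2 W]. Coercivity of [A] makes [D + A]
invertible and bounds the entries of its inverse by [2 / alpha]
([invmx_load_bound]), so that it amounts to [U = (1 - 2 D (D + A)^-1) W]
([scattering_boundary]). Since the wave arriving at an end left the opposite
end [tau_k] earlier, this is a linear delay system with bounded coefficients,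
solved by steps of length [min tau_k] from the initial data, which give the
outgoing waves at negative times.

Existence. The solution [delay_sol] of the delay system stays locally in [L^p]
([delay_sol_Lp_loc]). Travelling waves satisfy the weak equation
by integrating the derivative of a test function along each characteristic
([weak_transport_wave]), and have their values as traces at Lebesgue points
([avg_cvg]).

Uniqueness. The difference of two solutions solves the weak equations with zero
initial trace. Testing with products of a function of the characteristic label
and a derivative along the characteristics shows that a weak solution of the
transport equation is almost everywhere a function of the label
([box_constancy]); its value on the characteristics issued from the initial
segment is the initial trace, hence zero ([transport_representation]). The
boundary condition then kills the waves interval by interval: when nothing
arrives, [D y = - A y], so [y = 0] by coercivity ([coercive_dissipation]).

Continuity. If [A] is continuous, so are the coefficients of the delay system,
and the compatibility condition says that the initial waves and those emitted
at time [0] match; the steps then glue to continuous functions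
([delay_sol_continuous]), and by uniqueness the solution of the first part is
almost everywhere the continuous one. *)

(** * Integrals of functions known only almost everywhere *)

Section ae_integral.
Context d (T : measurableType d) (R : realType).
Variable m : {measure set T -> \bar R}.
Local Open Scope ereal_scope.
Import HBNNSimple.

(** Traces and weak equations are statements on integrals of functions that merely
agree almost everywhere with Borel ones, and such a function need not be Borel.
The integral of a nonnegative function is a supremum over simple functions
below it; cutting each of them off on the exceptional null set preserves its
integral. *)
Lemma ae_ge0_le_integral_nomeas (D : set T) (f g : T -> \bar R) :
  (forall x, D x -> 0 <= f x) -> (forall x, D x -> 0 <= g x) ->
  {ae m, forall x, D x -> f x <= g x} ->
  \int[m]_(x in D) f x <= \int[m]_(x in D) g x.
Proof.
move=> f0 g0 [N [mN N0 sub]].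
rewrite ge0_integralE// [leRHS]ge0_integralE// ge_ereal_sup// => _ [h/= hf] <-.
apply: ereal_sup_ubound => /=.
have mNC := measurableC mN.
exists (proj_nnsfun h mNC).
  move=> x /=; rewrite mindicE.
  have [xN|xN] := boolP (x \in ~` N); last first.
    by rewrite mulr0 patchE; case: ifPn => // /set_mem; exact: g0.
  rewrite mulr1; apply: (le_trans (hf x)); rewrite !patchE.
  case: ifPn => // /set_mem Dx; apply: contrapT => fg.
  by move: xN => /set_mem; apply; apply: sub => /= /(_ Dx).
rewrite -!integralT_nnsfun; apply: ge0_ae_eq_integral => //.
- by apply/measurable_EFinP.
- by apply/measurable_EFinP.
- by move=> x _; rewrite lee_fin.
- by move=> x _; rewrite lee_fin.
exists N; split => // x /= h1; apply: contrapT => xN; apply: h1 => _.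
by rewrite mindicE mem_set// mulr1.
Qed.

Lemma ae_eq_integral_nomeas (D : set T) (f g : T -> \bar R) :
  ae_eq m D f g -> \int[m]_(x in D) f x = \int[m]_(x in D) g x.
Proof.
move=> fg; rewrite integralE [RHS]integralE.
have [p n] := (ae_eq_funeposneg _ _ _ _).1 fg.
congr (_ - _); apply/eqP; rewrite eq_le; apply/andP; split;
  apply: ae_ge0_le_integral_nomeas => //.
- by apply: filterS p => x /[apply] ->.
- by apply: filterS p => x /[apply] ->.
- by apply: filterS n => x /[apply] ->.
- by apply: filterS n => x /[apply] ->.
Qed.

End ae_integral.

(** * Affine changes of variable on the line *)

Section affine.
Context {R : realType}.
Local Notation mu := (@lebesgue_measure R).
Implicit Types (a c : R).

Lemma measurable_affine a c :
  measurable_fun setT ((fun x => a * x + c) : measurableTypeR R -> measurableTypeR R).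
Proof. by apply: measurable_funD => //; exact: mulrl_measurable. Qed.

Lemma preimage_affine_gt0 a c x y : 0 < a ->
  (fun t => a * t + c) @^-1` `]x, y]%classic =
  `](x - c) / a, (y - c) / a]%classic.
Proof.
move=> a0; apply/seteqP; split => t /=; rewrite !in_itv/=;
  by rewrite ltr_pdivrMr// ler_pdivlMr// ltrBlDr lerBrDr ![t * a]mulrC.
Qed.

Lemma preimage_affine_lt0 a c x y : a < 0 ->
  (fun t => a * t + c) @^-1` `]x, y]%classic =
  `[(y - c) / a, (x - c) / a[%classic.
Proof.
move=> a0; apply/seteqP; split => t /=; rewrite !in_itv/=;
  by rewrite ltr_ndivlMr// ler_ndivrMr// ltrBlDr lerBrDr ![t * a]mulrC andbC.
Qed.

(** Both sides are measures that agree on half-open intervals. *)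
Lemma lebesgue_measure_affine a c (A : set (measurableTypeR R)) :
  a != 0 -> measurable A ->
  mu A = (`|a|%:E * mu ((fun x => a * x + c)%R @^-1` A))%E.
Proof.
move=> a0 mA.
pose m' : {measure set (measurableTypeR R) -> \bar R} :=
  mscale (NngNum (normr_ge0 a))
   (measure_function_pushforward__canonical__measure_function_Measure mu (measurable_affine a c)).
have -> : (`|a|%:E * mu ((fun x => a * x + c)%R @^-1` A))%E = m' A by [].
apply: lebesgue_measure_unique => //= _ [[x y]] _ <-.
rewrite /m' /mscale /= /pushforward.
have [alt|agt] := ltP a 0.
  rewrite preimage_affine_lt0// !lebesgue_measure_itv/= !lte_fin.
  rewrite ltr_nM2r ?invr_lt0// ltrD2r ltr0_norm//; case: ifPn => _; last by rewrite mule0.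
  by rewrite -!EFinB -EFinM; congr EFin; field.
have {}agt : 0 < a by rewrite lt_neqAle eq_sym a0.
rewrite preimage_affine_gt0// !lebesgue_measure_itv/= !lte_fin.
rewrite ltr_pM2r ?invr_gt0// ltrD2r gtr0_norm//; case: ifPn => _; last by rewrite mule0.
by rewrite -!EFinB -EFinM; congr EFin; field.
Qed.

Lemma negligible_affine a c (A : set R) : a != 0 ->
  mu.-negligible A -> mu.-negligible ((fun x => a * x + c) @^-1` A).
Proof.
move=> a0 [N [mN N0 sub]].
exists ((fun x => a * x + c) @^-1` N); split; last exact: preimage_subset.
  by rewrite -[X in measurable X]setTI; exact: measurable_affine.
have /eqP := lebesgue_measure_affine c a0 mN.
by rewrite N0 eq_sym mule_eq0 eqe normr_eq0 (negbTE a0)/= => /eqP.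
Qed.

Lemma ae_affine a c (P : R -> Prop) : a != 0 ->
  {ae mu, forall x, P x} -> {ae mu, forall x, P (a * x + c)}.
Proof. by move=> a0 /(negligible_affine c a0). Qed.

Lemma ge0_integral_affine a c (f : R -> \bar R) : a != 0 ->
  measurable_fun setT f -> (forall x, 0 <= f x)%E ->
  (\int[mu]_x f x = `|a|%:E * \int[mu]_x f (a * x + c)%R)%E.
Proof.
move=> a0 mf f0.
pose pm : {measure set (measurableTypeR R) -> \bar R} :=
   measure_function_pushforward__canonical__measure_function_Measure mu (measurable_affine a c).
have a_nn : 0 <= `|a| by [].
transitivity (\int[mscale (NngNum (normr_ge0 a)) pm]_x f x)%E.
  apply: eq_measure_integral => A mA _; exact: lebesgue_measure_affine.
rewrite ge0_integral_mscale//=; congr (_ * _)%E.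
by rewrite (ge0_integral_pushforward (measurable_affine a c)).
Qed.

Let gt0_muleBr (r : R) (p n : \bar R) : 0 < r ->
  (r%:E * (p - n) = r%:E * p - r%:E * n)%E.
Proof.
move=> r0; case: p => [p| |]; case: n => [n| |];
  rewrite ?(gt0_muley, gt0_muleNy) ?lte_fin//=.
by rewrite -EFinB -!EFinM -EFinB mulrBr.
Qed.

Lemma integral_affine a c (f : R -> \bar R) : a != 0 ->
  measurable_fun setT f ->
  (\int[mu]_x f x = `|a|%:E * \int[mu]_x f (a * x + c)%R)%E.
Proof.
move=> a0 mf.
rewrite integralE [in RHS]integralE.
rewrite (ge0_integral_affine c a0 (measurable_funepos mf))//.
rewrite (ge0_integral_affine c a0 (measurable_funeneg mf))//.
rewrite [RHS]gt0_muleBr ?normr_gt0 //.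
by congr (_ * _ - _ * _)%E; apply: eq_integral => x _; rewrite ?funeposE ?funenegE.
Qed.

End affine.

(** * Null sets and measure-preserving maps of the plane *)

Section almost_everywhere.
Context d (X : measurableType d) (R : realType) (m : {measure set X -> \bar R}).
Implicit Types P Q : X -> Prop.

Lemma ae_imply P Q : (forall x, P x -> Q x) ->
  {ae m, forall x, P x} -> {ae m, forall x, Q x}.
Proof. by move=> PQ; apply: (@filterS _ _ (ae_filter_ringOfSetsType m)). Qed.

Lemma ae_imply2 P1 P2 Q : (forall x, P1 x -> P2 x -> Q x) ->
  {ae m, forall x, P1 x} -> {ae m, forall x, P2 x} -> {ae m, forall x, Q x}.
Proof. by move=> PQ; apply: (@filterS2 _ _ (ae_filter_ringOfSetsType m)). Qed.

Lemma ae_imply3 P1 P2 P3 Q : (forall x, P1 x -> P2 x -> P3 x -> Q x) ->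
  {ae m, forall x, P1 x} -> {ae m, forall x, P2 x} -> {ae m, forall x, P3 x} ->
  {ae m, forall x, Q x}.
Proof. by move=> PQ; apply: (@filterS3 _ _ (ae_filter_ringOfSetsType m)). Qed.

Lemma ae_imply4 P1 P2 P3 P4 Q : (forall x, P1 x -> P2 x -> P3 x -> P4 x -> Q x) ->
  {ae m, forall x, P1 x} -> {ae m, forall x, P2 x} -> {ae m, forall x, P3 x} ->
  {ae m, forall x, P4 x} -> {ae m, forall x, Q x}.
Proof.
move=> PQ h1 h2 h3; apply: ae_imply2 _ (ae_imply3 PQ h1 h2 h3) => x.
exact.
Qed.

End almost_everywhere.

Section plane.
Context {R : realType}.
Local Notation mu := (@lebesgue_measure R).
Local Notation mu2 := (@lebesgue2 R).
Local Notation T := (measurableTypeR R).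
Local Notation T2 := (T * T)%type.
Implicit Types (A : set T2).

Lemma lebesgue2_xsection A : measurable A ->
  mu2 A = (\int[mu]_t mu (xsection A t))%E.
Proof. by []. Qed.

(** Uniqueness of the product measure: slicing in either order gives the same
measure. *)
Lemma lebesgue2_ysection A : measurable A ->
  mu2 A = (\int[mu]_x mu (ysection A x))%E.
Proof.
move=> mA; rewrite (_ : (\int[mu]_x mu (ysection A x))%E = (mu \x^ mu)%E A)//.
by apply: product_measure_unique => //= B C mB mC; rewrite product_measure2E.
Qed.

Lemma lebesgue2_null_xsection A : measurable A ->
  mu2 A = 0%E <-> {ae mu, forall t, mu (xsection A t) = 0%E}.
Proof.
move=> mA; have mf : measurable_fun [set: T] (fun t => mu (xsection A t)).
  exact: (measurable_fun_xsection mu mA).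
rewrite lebesgue2_xsection//.
rewrite (eq_integral (fun t => `|mu (xsection A t)|%E)); last first.
  by move=> t _; rewrite gee0_abs.
split=> [/(ae_eq_integral_abs mu measurableT mf)|h].
  by apply: filterS => t; apply.
by apply/(ae_eq_integral_abs mu measurableT mf); apply: filterS h => t ->.
Qed.

Lemma lebesgue2_null_ysection A : measurable A ->
  mu2 A = 0%E <-> {ae mu, forall x, mu (ysection A x) = 0%E}.
Proof.
move=> mA; have mf : measurable_fun [set: T] (fun t => mu (ysection A t)).
  exact: (measurable_fun_ysection mu mA).
rewrite lebesgue2_ysection//.
rewrite (eq_integral (fun t => `|mu (ysection A t)|%E)); last first.
  by move=> t _; rewrite gee0_abs.
split=> [/(ae_eq_integral_abs mu measurableT mf)|h].
  by apply: filterS => t; apply.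
by apply/(ae_eq_integral_abs mu measurableT mf); apply: filterS h => t ->.
Qed.

Lemma ae_slice_t (P : R * R -> Prop) : {ae mu2, forall z, P z} ->
  {ae mu, forall t, {ae mu, forall x, P (t, x)}}.
Proof.
move=> [N [mN N0 sub]]; have /lebesgue2_null_xsection := mN.
move=> /iffLR /(_ N0); apply: filterS => t tN.
exists (xsection N t); split => //; first exact: measurable_xsection.
by move=> x /= nP; rewrite /xsection/= inE; exact: sub.
Qed.

Lemma ae_slice_x (P : R * R -> Prop) : {ae mu2, forall z, P z} ->
  {ae mu, forall x, {ae mu, forall t, P (t, x)}}.
Proof.
move=> [N [mN N0 sub]]; have /lebesgue2_null_ysection := mN.
move=> /iffLR /(_ N0); apply: filterS => t tN.
exists (ysection N t); split => //; first exact: measurable_ysection.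
by move=> x /= nP; rewrite /ysection/= inE; exact: sub.
Qed.

Definition shear (k : R) (z : R * R) : R * R := (z.1 + k * z.2, z.2).

Lemma measurable_shear k : measurable_fun setT (shear k : T2 -> T2).
Proof.
apply: measurable_fun_pair => /=.
  apply: measurable_funD; first exact: measurable_fst.
  apply: measurable_funM; first exact: measurable_cst.
  exact: measurable_snd.
exact: measurable_snd.
Qed.

(** Maps that preserve [lebesgue2]; only shears and the exchange of coordinates
occur, which is why determinants never enter. *)
Definition preserving (M : R * R -> R * R) :=
  measurable_fun (setT : set T2) (M : T2 -> T2) /\
  forall A, measurable A -> mu2 (M @^-1` A) = mu2 A.

Lemma preserving_comp M M' : preserving M -> preserving M' -> preserving (M \o M').
Proof.
move=> [mM pM] [mM' pM']; split=> [|A mA]; first exact: measurableT_comp.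
rewrite comp_preimage pM' ?pM//.
by rewrite -[X in measurable X]setTI; exact: mM.
Qed.

(** A shear translates each horizontal slice. *)
Lemma preserving_shear k : preserving (shear k).
Proof.
split=> [|A mA]; first exact: measurable_shear.
have mS : measurable (shear k @^-1` A).
  by rewrite -[X in measurable X]setTI; exact: measurable_shear.
rewrite !lebesgue2_ysection//; apply: eq_integral => x _.
have -> : ysection (shear k @^-1` A) x =
    (fun t => 1 * t + k * x) @^-1` (ysection A x).
  by apply/seteqP; split => t; rewrite /ysection/= !inE/= /shear/= mul1r.
have := lebesgue_measure_affine (k * x) (oner_neq0 R) (measurable_ysection x mA).
by rewrite normr1 mul1e => <-.
Qed.

Lemma preserving_swap : preserving (fun z => (z.2, z.1)).
Proof.
have mS : measurable_fun (setT : set T2) ((fun z => (z.2, z.1)) : T2 -> T2).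
  by apply: measurable_fun_pair; [exact: measurable_snd|exact: measurable_fst].
split=> // A mA.
have mA' : measurable (((fun z => (z.2, z.1)) : T2 -> T2) @^-1` A).
  by rewrite -[X in measurable X]setTI; exact: mS.
rewrite lebesgue2_xsection// lebesgue2_ysection//; apply: eq_integral => x _.
Qed.

Lemma ae_preserving M (P : R * R -> Prop) : preserving M ->
  {ae mu2, forall z, P z} -> {ae mu2, forall z, P (M z)}.
Proof.
move=> [mM pM] [N [mN N0 sub]]; exists (M @^-1` N); split.
- by rewrite -[X in measurable X]setTI; exact: mM.
- by rewrite -N0; exact: pM.
- by move=> z /= ?; exact: sub.
Qed.

(** Image measure formula. *)
Lemma ge0_integral_preserving M (f : R * R -> \bar R) : preserving M ->
  measurable_fun (setT : set T2) f -> (forall z, 0 <= f z)%E ->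
  (\int[mu2]_z f z = \int[mu2]_z f (M z))%E.
Proof.
move=> [mM pM] mf f0.
pose pm : {measure set T2 -> \bar R} :=
   measure_function_pushforward__canonical__measure_function_Measure mu2 mM.
transitivity (\int[pm]_z f z)%E.
  by apply: eq_measure_integral => A mA _; rewrite -(pM _ mA).
by rewrite (ge0_integral_pushforward mM).
Qed.

Lemma integral_preserving M (f : R * R -> \bar R) : preserving M ->
  measurable_fun (setT : set T2) f ->
  (\int[mu2]_z f z = \int[mu2]_z f (M z))%E.
Proof.
move=> pM mf; rewrite integralE [in RHS]integralE.
rewrite (ge0_integral_preserving pM (measurable_funepos mf))//.
rewrite (ge0_integral_preserving pM (measurable_funeneg mf))//.
by congr (_ - _)%E; apply: eq_integral => x _; rewrite ?funeposE ?funenegE.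
Qed.

Lemma integrable_preserving M (f : R * R -> \bar R) : preserving M ->
  mu2.-integrable setT f -> mu2.-integrable setT (f \o M).
Proof.
move=> pM /integrableP[mf If]; apply/integrableP; split.
  by apply: measurableT_comp mf _; case: pM.
by move: If; rewrite (ge0_integral_preserving pM)//; exact: measurableT_comp.
Qed.

(** An open set is a countable union of rational rectangles; hence it is in the
product of the Borel algebras. *)
Lemma open_measurable2 (U : set (R * R)) : open U -> measurable (U : set T2).
Proof.
move=> oU.
pose B (q : (rat * rat) * (rat * rat)) : set (R * R) :=
  `]ratr q.1.1, ratr q.1.2[%classic `*` `]ratr q.2.1, ratr q.2.2[%classic.
have -> : U = \bigcup_(q in [set q | B q `<=` U]) B q.
  apply/seteqP; split => [[t x] Utx|z [q /= BU]]; last exact: BU.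
  have /nbhs_ballP[e /= e0 he] : nbhs (t, x) U by apply: oU.
  have rt (y : R) : exists q : rat * rat,
      [/\ y - e < ratr q.1, ratr q.1 < y, y < ratr q.2 & ratr q.2 < y + e].
    have [|p1 /itvP p1P] := @rat_in_itvoo R (y - e) y; first by rewrite ltrBlDr ltrDl.
    have [|p2 /itvP p2P] := @rat_in_itvoo R y (y + e); first by rewrite ltrDl.
    by exists (p1, p2); rewrite !p1P !p2P.
  have [q1 [? ? ? ?]] := rt t; have [q2 [? ? ? ?]] := rt x.
  exists (q1, q2); last by rewrite /B/= !in_itv/=; split; apply/andP.
  move=> [s y] [/=]; rewrite !in_itv/= => /andP[? ?] /andP[? ?].
  by apply: he; split => /=; rewrite /ball/= ltr_distlC; apply/andP; split; lra.
rewrite bigcup_mkcond; apply: countable_bigcupT_measurable.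
  exact: countableP.
move=> q; case: ifPn => // _; apply: measurableX; exact: measurable_itv.
Qed.

Lemma continuous_measurable2 (f : R * R -> R) : continuous f ->
  measurable_fun (setT : set T2) f.
Proof.
move=> /continuousP cf; apply: (measurability _ (RGenOpens.measurableE R)).
move=> _ [_ [a [b ->]] <-]; rewrite setTI; apply: open_measurable2.
by apply: cf; exact: interval_open.
Qed.

End plane.

(** * One-sided averages at Lebesgue points *)

Section averages.
Context {R : realType}.
Local Notation mu := (@lebesgue_measure R).
Implicit Types (F : R -> R) (k s e : R).

(** Borel on the whole line, so that compositions with affine maps stay
measurable. *)
Definition loc_int F := measurable_fun setT F /\
  forall T, mu.-integrable `[- T, T] (EFin \o F).

Lemma loc_intS F (a b : R) : loc_int F -> mu.-integrable `[a, b] (EFin \o F).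
Proof.
move=> [_ /(_ (Num.max `|a| `|b|))]; apply: integrableS => // x /=.
rewrite !in_itv/= => /andP[ax xb]; rewrite lerNl !le_max.
have := ler_normr `|a| (- a); have := ler_norm b; have := ler_norm (- a).
rewrite normrN => ? ? _.
apply/andP; split; apply/orP; [left|right]; lra.
Qed.

Lemma loc_int_locally F : loc_int F -> locally_integrable setT F.
Proof.
move=> iF; split; [by case: iF|exact: openT|move=> K _ cK].
have [M [_ /(_ (M + 1))]] := compact_bounded cK.
rewrite ltrDl => /(_ ltr01) KM.
have /integrableP[_] := loc_intS (- (M + 1)) (M + 1) iF.
apply: le_lt_trans; apply: ge0_subset_integral => //.
- exact: compact_measurable.
- apply/measurable_EFinP; apply: measurableT_comp => //.
  by case: iF => mF _; exact: measurable_funS mF.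
- by move=> x Kx /=; rewrite in_itv/= -ler_norml; exact: KM.
Qed.

Lemma measurable_line F k s : measurable_fun setT F ->
  measurable_fun setT (fun r => F (k * r + s)).
Proof. by move=> mF; exact: (measurableT_comp mF (measurable_affine k s)). Qed.

Lemma le_integral_affine k s (f g : R -> \bar R) : k != 0 ->
  measurable_fun setT g -> (forall x, 0 <= f x)%E -> (forall x, 0 <= g x)%E ->
  (forall r, f r <= g (k * r + s)%R)%E ->
  (`|k|%:E * \int[mu]_r f r <= \int[mu]_r g r)%E.
Proof.
move=> k0 mg f0 g0 fg; rewrite (ge0_integral_affine s k0 mg g0).
rewrite lee_pmul2l ?lte_fin ?normr_gt0//.
by apply: ae_ge0_le_integral_nomeas => //; exact: aeW.
Qed.

Lemma loc_int_affine F k s : k != 0 -> loc_int F ->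
  loc_int (fun r => F (k * r + s)).
Proof.
move=> k0 [mF iF]; split => [|T]; first exact: measurable_line.
apply/integrableP; split.
  by apply/measurable_EFinP; apply: measurable_funTS; exact: measurable_line.
have /integrableP[_] := iF (`|k| * `|T| + `|s|).
set S := `|k| * `|T| + `|s|.
rewrite integral_mkcond => h; rewrite integral_mkcond.
have k1 : 0 < `|k| by rewrite normr_gt0.
rewrite -(mul1e (integral _ _ _)) -(mulVf (lt0r_neq0 k1)) EFinM -muleA.
rewrite lte_pdivrMl// gt0_muley ?lte_fin//
  (@le_lt_trans _ _ (\int[mu]_y ((fun y => `|(EFin \o F) y|%E) \_ `[(- S)%R, S]) y)%E)//.
apply: (le_integral_affine (s := s)) => //.
- apply/(measurable_restrictT _ _).1 => //; apply: measurableT_comp => //.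
  by apply/measurable_EFinP; exact: measurable_funTS.
- by move=> x; apply: erestrict_ge0 => y _; exact: abse_ge0.
- by move=> x; apply: erestrict_ge0 => y _; exact: abse_ge0.
- move=> r; rewrite !patchE.
  case: ifPn => [/set_mem/=|_]; last by case: ifPn => // _; apply: abse_ge0.
  rewrite in_itv/= -ler_norml => rT; rewrite mem_set//= in_itv/= -ler_norml.
  rewrite /S (le_trans (ler_normD _ _))// lerD2r normrM ler_wpM2l//.
  by rewrite (le_trans rT)// ler_norm.
Qed.

(** The segment from [s] to [s + k e] has a quarter of the measure of the ball of
radius [2 |k| e] about [s], which contains it; whence the factor [4] against the centred
mean oscillation [davg]. *)
Lemma avg_dist F s k e : loc_int F -> k != 0 -> 0 < e ->
  (`|e^-1 * (\int[mu]_(r in `[0, e]) F (k * r + s)) - F s|%:E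
   <= 4%:E * davg F s (2 * `|k| * e))%E.
Proof.
move=> lF k0 e0; have k1 : 0 < `|k| by rewrite normr_gt0.
have [mF' iF'] := loc_int_affine s k0 lF.
have iF := loc_intS 0 e (loc_int_affine s k0 lF).
have muI : mu `[0, e] = e%:E by rewrite lebesgue_measure_itv/= lte_fin e0 sube0.
have ic : mu.-integrable `[0, e] (EFin \o cst (F s)).
  apply: continuous_compact_integrable; first exact: segment_compact.
  by apply: continuous_subspaceT => x; exact: cvg_cst.
pose G r := F (k * r + s) - F s.
have iG : mu.-integrable `[0, e] (EFin \o G).
  by have := @integrableB _ _ _ mu _ (measurable_itv _) _ _ iF ic; apply: eq_integrable.
have -> : e^-1 * (\int[mu]_(r in `[0, e]) F (k * r + s)) - F s =
    e^-1 * \int[mu]_(r in `[0, e]) G r.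
  rewrite (@RintegralB _ _ _ mu _ _ _ (measurable_itv _) iF ic) Rintegral_cst//.
  have -> : fine (mu `[0, e]) = e by rewrite muI.
  by rewrite mulrBr mulrCA mulVf ?gt_eqF// mulr1.
rewrite normrM gtr0_norm ?invr_gt0// EFinM.
rewrite lee_pdivrMl//.
rewrite EFin_normr_Rintegral// (le_trans (le_abse_integral _ _ _))//.
  by case/integrableP: iG.
pose B := ball s (2 * `|k| * e).
have rB0 : 0 < 2 * `|k| * e by rewrite !mulr_gt0.
have -> : (e%:E * (4%:E * davg F s (2 * `|k| * e)) =
    `|k|^-1%:E * \int[mu]_(y in B) `|(F y - F s)%:E|)%E.
  rewrite /davg /iavg -/B (lebesgue_measure_ball _ (ltW rB0)) inver.
  rewrite mulrn_eq0/= gt_eqF// !muleA -!EFinM; congr (_ * _)%E.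
  congr EFin; rewrite -mulr_natr; field; rewrite normr_eq0 k0/=; lra.
rewrite lee_pdivlMl// integral_mkcond [leRHS]integral_mkcond.
apply: (le_integral_affine (s := s)) => //.
- apply/(measurable_restrictT _ _).1; first exact: measurable_ball.
  apply: measurableT_comp => //; apply/measurable_EFinP.
  by apply: measurable_funB => //; apply: measurable_funTS; case: lF.
- by move=> x; apply: erestrict_ge0 => y _; exact: abse_ge0.
- by move=> x; apply: erestrict_ge0 => y _; exact: abse_ge0.
- move=> r; rewrite !patchE.
  case: ifPn => [/set_mem/=|_]; last by case: ifPn => // _; apply: abse_ge0.
  rewrite in_itv/= => /andP[r0 re]; rewrite mem_set//= /B /ball/=.
  rewrite opprD addrCA subrr addr0 normrN normrM (ger0_norm r0).
  by rewrite -mulrA [ltRHS]mulrCA ltr_pM2l//; lra.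
Qed.

Lemma near_right_scale (c : R) (P : R -> Prop) : 0 < c ->
  (\forall r \near 0^'+, P r) -> \forall e \near 0^'+, P (c * e).
Proof.
move=> c0 [d /= d0 dP]; exists (d / c) => /=; first by rewrite divr_gt0.
move=> e /=; rewrite sub0r normrN => ed e0; apply: dP; last by rewrite mulr_gt0.
by rewrite /= sub0r normrN normrM (gtr0_norm c0) mulrC -ltr_pdivlMr.
Qed.

(** One-sided averages converge at Lebesgue points. For [k = - tau] this is the
trace at [x = 0] of a wave, for [k = 1] the initial one. *)
Lemma avg_cvg F s k : loc_int F -> lebesgue_pt F s ->
  e^-1 * (\int[mu]_(r in `[0, e]) F (k * r + s)) @[e --> 0^'+] --> F s.
Proof.
move=> lF Fs; have [->|k0] := eqVneq k 0.
  apply: cvg_near_cst; near=> e.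
  have e0 : 0 < e by near: e; exact: nbhs_right_gt.
  under eq_Rintegral do rewrite mul0r add0r.
  rewrite Rintegral_cst//=.
  rewrite lebesgue_measure_itv/= lte_fin e0 sube0/= mulrCA mulVf ?gt_eqF//.
  by rewrite mulr1.
have k1 : 0 < 2 * `|k| by rewrite mulr_gt0 ?normr_gt0.
move/fine_cvgP : Fs => [/(near_right_scale k1) Ffin /cvgrPdist_lt Flim].
apply/cvgrPdist_lt => /= eps eps0.
have /(near_right_scale k1) := Flim (eps / 4) (divr_gt0 eps0 (ltr0Sn _ _)).
move=> Flt; near=> e.
have e0 : 0 < e by near: e; exact: nbhs_right_gt.
have := avg_dist s lF k0 e0; rewrite distrC.
have -> : davg F s (2 * `|k| * e) = (fine (davg F s (2 * `|k| * e)))%:E.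
  by rewrite fineK//; near: e.
rewrite -EFinM lee_fin => /le_lt_trans; apply.
have : `|0 - fine (davg F s (2 * `|k| * e))| < eps / 4 by near: e.
rewrite sub0r normrN => /(le_lt_trans (ler_norm _)); lra.
Unshelve. all: by end_near. Qed.

End averages.

(** * Smooth functions of one variable, flat at the origin *)

Section smooth.
Context {R : realType}.
Implicit Types (a b : R -> R) (p : {poly R}).

(** Derivatives are given rather than computed: the class is then closed under
sums, products and affine substitutions by direct construction. *)
Fixpoint smooth_upto n a : Prop :=
  if n is m.+1 then
    exists2 a' : R -> R, (forall x : R, is_derive x 1 a (a' x)) & smooth_upto m a'
  else continuous a.

Lemma is_derive_continuous a a' :
  (forall x : R, is_derive x 1 a (a' x)) -> continuous a.
Proof.
move=> h x; apply: differentiable_continuous.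
by apply/derivable1_diffP; have [] := h x.
Qed.

Lemma smooth_upto_continuous n a : smooth_upto n a -> continuous a.
Proof. by case: n => [//|n [a' h _]]; exact: is_derive_continuous h. Qed.

Lemma smooth_uptoW n a : smooth_upto n.+1 a -> smooth_upto n a.
Proof.
elim: n a => [a [a' h _]|n IH a [a' h s]]; first exact: is_derive_continuous h.
by exists a' => //; exact: IH.
Qed.

Lemma smooth_upto_add n a b : smooth_upto n a -> smooth_upto n b ->
  smooth_upto n (fun x => a x + b x).
Proof.
elim: n a b => [a b sa sb x|n IH a b [a' ha sa] [b' hb sb]].
  by apply: cvgD; [exact: sa|exact: sb].
exists (fun x => a' x + b' x); last exact: IH.
by move=> x; exact: is_deriveD.
Qed.

Lemma smooth_upto_mul n a b : smooth_upto n a -> smooth_upto n b ->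
  smooth_upto n (fun x => a x * b x).
Proof.
elim: n a b => [a b sa sb x|n IH a b sa sb].
  by apply: cvgM; [exact: sa|exact: sb].
have [a' ha sa'] := sa; have [b' hb sb'] := sb.
exists (fun x => a x * b' x + b x * a' x).
  by move=> x; exact: is_deriveM.
by apply: smooth_upto_add; apply: IH => //; exact: smooth_uptoW.
Qed.

Lemma smooth_upto_cst n (c : R) : smooth_upto n (fun=> c).
Proof.
elim: n c => [c x|n IH c]; first exact: cvg_cst.
by exists (fun=> 0); [move=> x; exact: is_derive_cst|exact: IH].
Qed.

Lemma smooth_upto_scale n (c : R) a : smooth_upto n a ->
  smooth_upto n (fun x => c * a x).
Proof. by move=> sa; apply: smooth_upto_mul => //; exact: smooth_upto_cst. Qed.

Lemma is_derive_affine (c d x : R) : is_derive x 1 (fun x => c * x + d) c.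
Proof.
have h := is_deriveZ c (is_derive_id x (1 : R)).
rewrite (_ : c *: 1 = c) in h; last by rewrite -[_ *: _]/(c * 1) mulr1.
by have := is_deriveD h (is_derive_cst d x (1 : R)); rewrite addr0.
Qed.

Lemma smooth_upto_affine n (c d : R) a : smooth_upto n a ->
  smooth_upto n (fun x => a (c * x + d)).
Proof.
elim: n a => [a sa x|n IH a [a' ha sa]].
  apply: (@continuous_comp _ _ _ (fun x => c * x + d) a); last exact: sa.
  exact: (is_derive_continuous (is_derive_affine c d)).
exists (fun x => a' (c * x + d) * c).
  move=> x; apply: (@is_derive1_comp _ a (fun x => c * x + d)).
  exact: is_derive_affine.
by apply: smooth_upto_mul; [exact: IH|exact: smooth_upto_cst].
Qed.

Lemma expR_dominates_monomial n :
  exists C : R, forall u, 0 <= u -> u ^+ n <= C * expR u.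
Proof.
case: n => [|n].
  exists 1 => u u0; rewrite mul1r expr0; apply: le_trans (expR_ge1Dx u).
  by rewrite lerDl.
exists (n.+1)`!%:R => u u0; rewrite mulrC -ler_pdivrMr ?ltr0n ?fact_gt0//.
by apply: le_trans (expR_ge1Dxn n u0); rewrite lerDr.
Qed.

Lemma expR_dominates_poly p :
  exists C : R, forall u, 0 <= u -> `|p.[u]| <= C * expR u.
Proof.
have /choice [C hC] := expR_dominates_monomial.
exists (\sum_(i < size p) `|p`_i| * C i) => u u0.
rewrite horner_coef (le_trans (ler_norm_sum _ _ _))// mulr_suml.
apply: ler_sum => i _; rewrite normrM -mulrA ler_wpM2l//.
by rewrite ger0_norm ?exprn_ge0//; exact: hC.
Qed.

(** For [p = 1] the classical smooth function that vanishes exactly on the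
nonpositive half-line. The polynomial factor makes the family closed under
derivation. *)
Definition flat p (y : R) : R :=
  if 0 < y then p.[y^-1] * expR (- y^-1) else 0.

(** With [u = 1 / y], the derivative of [p (u) exp (- u)] in [y] is
[u^2 (p - p') (u) exp (- u)]. At [0] the exponential beats every polynomial. *)
Lemma is_derive_flat p (y : R) : is_derive y 1 (flat p) (flat ('X^2 * (p - p^`())) y).
Proof.
have [y0|y0|->] := ltgtP y 0.
- rewrite /flat [in X in is_derive _ _ _ X]ltNge (ltW y0)/=.
  apply: (@near_eq_is_derive _ _ _ (cst 0)).
  + by near=> z; rewrite ltNge (ltW _)//; near: z; exact: lt_nbhsl.
- rewrite /flat [in X in is_derive _ _ _ X]y0.
  have yN0 : y != 0 by rewrite gt_eqF.
  have dV : is_derive y 1 (fun z : R => z^-1) (- y ^- 2).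
    have := @is_deriveV R id y 1 1 yN0 (is_derive_id y (1 : R)).
    by rewrite -[_ *: _]/(_ * _) mulr1.
  have dp : is_derive y 1 (fun z => p.[z^-1]) (p^`().[y^-1] * - y ^- 2).
    have := derivableP (@derivable_horner _ p y^-1).
    rewrite -derive1E -derivE => h.
    exact: (@is_derive1_comp _ (horner p) (fun z => z^-1) _ _ _ h dV).
  have de : is_derive y 1 (fun z => expR (- z^-1)) (expR (- y^-1) * y ^- 2).
    have := is_deriveN dV; rewrite opprK => h.
    exact: (@is_derive1_comp _ expR (fun z => - z^-1) _ _ _ _ h).
  have := is_deriveM dp de.
  rewrite -![_ *: _]/(_ * _) => h.
  apply: is_derive_eq.
    apply: near_eq_is_derive h; near=> z; rewrite ifT//; near: z.
    exact: lt_nbhsr.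
  by rewrite hornerM hornerXn hornerD hornerN; field.
- rewrite /flat [in X in is_derive _ _ _ X]ltxx.
  suff h : h^-1 *: (flat p (h *: 1 + 0) - flat p 0) @[h --> 0^'] --> (0 : R).
    by split; [apply/cvg_ex; exists 0|exact/cvg_lim].
  have [C hC] := expR_dominates_poly ('X^2 * p).
  have n0 : `|h| @[h --> (0 : R)^'] --> (0 : R).
    have : `|h| @[h --> (0 : R)^'] --> `|0 : R|.
      by apply: cvg_norm; exact: cvg_within.
    by rewrite normr0.
  apply: (@squeeze_cvgr _ _ _ _ (fun h => - (C * `|h|)) (fun h => C * `|h|)).
  + near=> h; rewrite -ler_norml /flat ltxx subr0 addr0.
    rewrite -![_ *: _]/(_ * _) mulr1; case: ifPn => [h0|_]; last first.
      rewrite mulr0 normr0 mulr_ge0//.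
      have := hC 0 (lexx _); rewrite expR0 mulr1; exact: le_trans.
    have hV : 0 <= h^-1 by rewrite invr_ge0 ltW.
    rewrite !normrM (ger0_norm hV) (gtr0_norm h0) (ger0_norm (expR_ge0 _)).
    have := hC _ hV; rewrite hornerM hornerXn normrM ger0_norm ?exprn_ge0//.
    rewrite -ler_pdivrMr ?expR_gt0// -expRN => hh.
    apply: (@le_trans _ _ (h * (h^-1 ^+ 2 * `|p.[h^-1]| * expR (- h^-1)))).
      by rewrite le_eqVlt; apply/orP; left; apply/eqP; field; rewrite gt_eqF.
    by rewrite mulrC ler_pM2r.
  + rewrite -[X in _ --> X]oppr0; apply: cvgN.
    by rewrite -[X in _ --> X](mulr0 C); apply: cvgM; [exact: cvg_cst|exact: n0].
  + by rewrite -[X in _ --> X](mulr0 C); apply: cvgM; [exact: cvg_cst|exact: n0].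
Unshelve. all: by end_near.
Qed.

Lemma smooth_upto_flat n p : smooth_upto n (flat p).
Proof.
elim: n p => [p|n IH p]; first exact: (is_derive_continuous (is_derive_flat p)).
by exists (flat ('X^2 * (p - p^`()))); [exact: is_derive_flat|exact: IH].
Qed.

End smooth.

(** * Plateau functions and their primitives *)

Section plateau.
Context {R : realType}.
Local Notation mu := (@lebesgue_measure R).

(** Smooth, compactly supported in the open interval [(l, r)], and increasing to
its indicator as [n] grows. *)
Definition plateau (l r : R) (n : nat) (x : R) : R :=
  flat 1 (n.+1%:R * (x - l) - 1) * flat 1 (n.+1%:R * (r - x) - 1).

Let flat1 (y : R) : flat 1 y = if 0 < y then expR (- y^-1) else 0.
Proof. by rewrite /flat hornerE mul1r. Qed.

Let flat1_ge0 (y : R) : 0 <= flat 1 y.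
Proof. by rewrite flat1; case: ifPn => // _; exact: expR_ge0. Qed.

Let flat1_le1 (y : R) : flat 1 y <= 1.
Proof.
rewrite flat1; case: ifPn => // y0.
by rewrite -expR0 ler_expR oppr_le0 invr_ge0 ltW.
Qed.

Lemma plateau_ge0 l r n x : 0 <= plateau l r n x.
Proof. exact: mulr_ge0. Qed.

Lemma plateau_le1 l r n x : plateau l r n x <= 1.
Proof. by rewrite -[leRHS]mulr1 ler_pM. Qed.

Lemma smooth_upto_plateau m l r n : smooth_upto m (plateau l r n).
Proof.
have -> : plateau l r n = fun x => flat 1 (n.+1%:R * x + (- (n.+1%:R * l) - 1)) *
   flat 1 (- n.+1%:R * x + (n.+1%:R * r - 1)).
  by apply/funext => x; rewrite /plateau; congr (flat 1 _ * flat 1 _); ring.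
by apply: smooth_upto_mul; apply: smooth_upto_affine; exact: smooth_upto_flat.
Qed.

Lemma plateau_support l r n x : plateau l r n x != 0 ->
  l + n.+1%:R^-1 < x < r - n.+1%:R^-1.
Proof.
have n0 : 0 < n.+1%:R :> R by [].
rewrite /plateau !flat1; case: ifPn => [h1|]; last by rewrite mul0r eqxx.
case: ifPn => [h2 _|]; last by rewrite mulr0 eqxx.
move: h1 h2; rewrite !subr_gt0 -!ltr_pdivrMl// !mulr1.
set d := _^-1 => h1 h2.
by apply/andP; split; lra.
Qed.

Let flat1_cvg (d : R) : 0 < d -> flat 1 (n.+1%:R * d - 1) @[n --> \oo] --> (1 : R).
Proof.
move=> d0; apply: (@squeeze_cvgr _ _ _ _ (fun n => 1 - (n.+1%:R * d - 1)^-1) (fun=> 1)).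
- near=> n; rewrite flat1_le1 andbT flat1.
  have -> : 0 < n.+1%:R * d - 1.
    rewrite subr_gt0 -ltr_pdivrMr// mul1r; near: n.
    have := nbhs_infty_gtr (d^-1); apply: filterS => n h.
    by apply: lt_trans h _; rewrite ltr_nat.
  by apply: le_trans (expR_ge1Dx _).
- rewrite -[X in _ --> X]subr0; apply: cvgB; first exact: cvg_cst.
  apply/gtr0_cvgV0.
    near=> n.
    rewrite subr_gt0 -ltr_pdivrMr// mul1r; near: n.
    have := nbhs_infty_gtr (d^-1); apply: filterS => n h.
    by apply: lt_trans h _; rewrite ltr_nat.
  apply/cvgryPge => M; near=> n.
  rewrite lerBrDl -ler_pdivrMr//; near: n.
  have := nbhs_infty_gtr ((1 + M) / d); apply: filterS => n h.
  by apply: ltW; apply: lt_trans h _; rewrite ltr_nat.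
- exact: cvg_cst.
Unshelve. all: by end_near. Qed.

Lemma plateau_le_indic l r n x : plateau l r n x <= \1_(`]l, r[%classic) x.
Proof.
rewrite indicE; have [_|lxr] := boolP (x \in `]l, r[%classic).
  exact: plateau_le1.
rewrite le_eqVlt; apply/orP; left; apply/negPn/negP => /plateau_support.
have : 0 < n.+1%:R^-1 :> R by rewrite invr_gt0.
set d := _^-1 => n0 /andP[h1 h2]; move: lxr.
rewrite notin_setE/= in_itv/= => /negP.
by apply/negP; rewrite negbK; apply/andP; split; lra.
Qed.

Lemma plateau_cvg l r x : plateau l r n x @[n --> \oo] --> (\1_(`]l, r[%classic) x : R).
Proof.
have := plateau_le_indic l r ^~ x.
rewrite indicE; have [lxr _|_ h] := boolP (x \in `]l, r[%classic).
  move: (lxr); rewrite inE/= in_itv/= => /andP[lx xr].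
  rewrite -[X in _ --> X](mulr1 1); apply: cvgM; apply: flat1_cvg.
    by rewrite subr_gt0.
  by rewrite subr_gt0.
by apply: cvg_near_cst; apply: nearW => n; apply/eqP; rewrite eq_le h plateau_ge0.
Qed.

(** The base point [- 1] only has to lie to the left of the supports considered,
which are contained in the positive half-line. *)
Definition primit (h : R -> R) (u : R) : R := \int[mu]_(x in `[-1, u]) h x.

Lemma primit_left (h : R -> R) lo hi u : (forall x, h x != 0 -> lo < x < hi) ->
  u <= lo -> primit h u = 0.
Proof.
move=> sh ulo; rewrite /primit Rintegral_mkcond.
rewrite (@eq_Rintegral _ _ _ _ _ (cst 0)) ?Rintegral_cst ?mul0r// => x _.
rewrite patchE; case: ifPn => // /set_mem/=; rewrite in_itv/= => /andP[_ xu].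
by apply/eqP/negPn/negP => /sh/andP[+ _]; rewrite ltNge (le_trans xu).
Qed.

Lemma primit_right (h : R -> R) lo hi u : (forall x, h x != 0 -> lo < x < hi) ->
  0 <= lo -> hi <= u -> primit h u = \int[mu]_x h x.
Proof.
move=> sh lo0 ulo; rewrite /primit Rintegral_mkcond.
apply: eq_Rintegral => x _; rewrite patchE; case: ifPn => //.
rewrite notin_setE/= in_itv/= => /negP xu; apply/esym/eqP/negPn/negP.
move=> /sh/andP[h1 h2]; move/negP: xu; apply; apply/andP; split; lra.
Qed.

Lemma is_derive_primit (h : R -> R) lo hi (u : R) :
  (forall x, h x != 0 -> lo < x < hi) -> 0 <= lo -> continuous h ->
  is_derive u 1 (primit h) (h u).
Proof.
move=> sh lo0 ch; have [u0|u0] := ltP u 0.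
  have -> : h u = 0.
    by apply/eqP/negPn/negP => /sh/andP[lu _]; lra.
  apply: (@near_eq_is_derive _ _ _ (cst 0)).
  near=> z; apply/esym; apply: (primit_left sh); apply: le_trans lo0.
  by apply: ltW; near: z; exact: lt_nbhsl.
have [] := @continuous_FTC1_closed R h (-1) u (u + 1) _ _ _ (ch u).
- by rewrite ltrDl.
- apply: continuous_compact_integrable; first exact: segment_compact.
  exact: continuous_subspaceT.
- lra.
by move=> dF F'; rewrite -F' derive1E; exact: derivableP.
Unshelve. all: by end_near. Qed.

End plateau.

(** * Test functions in product form *)

Section separated.
Context {R : realType}.
Implicit Types (a b : R -> R) (f : R * R -> R).

(** A directional derivative is the derivative at [0] of the restriction to a
line. *)
Lemma is_derive_line f (z v : R * R) (l : R) :
  is_derive (0 : R) 1 (fun h : R => f (h *: v + z)) l -> is_derive z v f l.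
Proof.
move=> [df Df].
have E : (fun h : R => h^-1 *: ((f \o shift z) (h *: v) - f z)) =
    (fun h : R => h^-1 *: (((fun h : R => f (h *: v + z)) \o shift 0) (h *: (1 : R))
      - f (0 *: v + z))).
  apply/funext => h; congr (_ *: (_ - _)); rewrite /=.
    by rewrite addr0 -[h *: 1]/(h * 1) mulr1.
  by rewrite scale0r add0r.
by split; [rewrite /derivable E|rewrite /derive E].
Qed.

Lemma continuous_form (p q : R) : continuous (fun z : R * R => p * z.1 + q * z.2).
Proof.
move=> z; apply: cvgD; apply: cvgM; try exact: cvg_cst.
  exact: cvg_fst.
exact: cvg_snd.
Qed.

Lemma is_derive_comp_affine a (c d x l : R) : is_derive (c * x + d) 1 a l ->
  is_derive x 1 (fun h => a (c * h + d)) (l * c).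
Proof.
move=> h.
exact: (@is_derive1_comp _ a (fun h => c * h + d) _ _ _ h (is_derive_affine c d x)).
Qed.

Variables p q r w : R.

Let form1 (z : R * R) := p * z.1 + q * z.2.
Let form2 (z : R * R) := r * z.1 + w * z.2.

Lemma is_derive_separated (v : R * R) a b (a' b' : R -> R) z :
  (forall x : R, is_derive x 1 a (a' x)) -> (forall x : R, is_derive x 1 b (b' x)) ->
  is_derive z v (fun z => a (form1 z) * b (form2 z))
    (form1 v * a' (form1 z) * b (form2 z) +
     (form2 v * a (form1 z)) * b' (form2 z)).
Proof.
move=> ha hb; apply: is_derive_line.
have -> : (fun h : R => a (form1 (h *: v + z)) * b (form2 (h *: v + z))) =
    (fun h : R => a (form1 v * h + form1 z) * b (form2 v * h + form2 z)).
  apply/funext => h; rewrite /form1 /form2 /= -![_ *: _]/(_ * _).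
  by congr (a _ * b _); ring.
have /is_derive_comp_affine ha0 : is_derive (form1 v * 0 + form1 z) 1 a (a' (form1 z)).
  by have := ha (form1 z); rewrite mulr0 add0r.
have /is_derive_comp_affine hb0 : is_derive (form2 v * 0 + form2 z) 1 b (b' (form2 z)).
  by have := hb (form2 z); rewrite mulr0 add0r.
have := is_deriveM ha0 hb0 => /is_derive_eq; apply.
by rewrite -![_ *: _]/(_ * _) !mulr0 !add0r; ring.
Qed.

(** Finite sums of products of a function of [form1] and one of [form2]: the
smallest class containing the products and stable under partial derivatives,
which is what an induction on the order of differentiability requires. *)
Inductive separated (n : nat) : (R * R -> R) -> Prop :=
| separated0 : separated n (fun=> 0)
| separatedD a b f : smooth_upto n a -> smooth_upto n b -> separated n f ->
    separated n (fun z => a (form1 z) * b (form2 z) + f z).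

Lemma separated_continuous n f : separated n f -> continuous f.
Proof.
elim=> [z|a b g sa sb _ IH z]; first exact: cvg_cst.
apply: cvgD; last exact: IH.
apply: cvgM.
  apply: (@continuous_comp _ _ _ form1 a); first exact: continuous_form.
  exact: (smooth_upto_continuous sa).
apply: (@continuous_comp _ _ _ form2 b); first exact: continuous_form.
exact: (smooth_upto_continuous sb).
Qed.

Lemma separated_derive (v : R * R) n f : separated n.+1 f ->
  exists2 f' : R * R -> R, (forall z, is_derive z v f (f' z)) & separated n f'.
Proof.
elim=> [|a b g sa sb _ [g' hg sg]].
  by exists (fun=> 0); [move=> z; exact: is_derive_cst|exact: separated0].
have [a' ha sa'] := sa; have [b' hb sb'] := sb.
exists (fun z => (form1 v * a' (form1 z)) * b (form2 z) +
     ((form2 v * a (form1 z)) * b' (form2 z) + g' z)).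
  by move=> z; rewrite addrA; apply: is_deriveD => //; exact: is_derive_separated.
apply: (@separatedD _ (fun y => form1 v * a' y) b).
- exact: smooth_upto_scale.
- exact: smooth_uptoW.
- apply: (@separatedD _ (fun y => form2 v * a y) b' g') => //.
  by apply: smooth_upto_scale; exact: smooth_uptoW.
Qed.

Lemma separated_class_C (D : set (R * R)) n f : separated n f -> class_C D n f.
Proof.
elim: n f => [f sf|n IH f sf] /=; first by split=> // z _; exact: (separated_continuous sf).
split; first by move=> z _; exact: (separated_continuous sf).
have [ft hft sft] := separated_derive (1, 0) sf.
have [fx hfx sfx] := separated_derive (0, 1) sf.
have dtE : dt f = ft by apply/funext => z; rewrite /dt; have [] := hft z.
have dxE : dx f = fx by apply/funext => z; rewrite /dx; have [] := hfx z.
split; [| |by rewrite dtE; exact: IH|by rewrite dxE; exact: IH].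
  by move=> z _; have [] := hft z.
by move=> z _; have [] := hfx z.
Qed.

Lemma test_function_separated a b (K : set (R * R)) :
  (forall n, smooth_upto n a) -> (forall n, smooth_upto n b) ->
  compact K -> K `<=` Omega ->
  (forall z, a (form1 z) != 0 -> b (form2 z) != 0 -> K z) ->
  test_function (fun z => a (form1 z) * b (form2 z)).
Proof.
move=> sa sb cK KO abK; split=> [n|].
  apply: separated_class_C.
  have -> : (fun z => a (form1 z) * b (form2 z)) =
     (fun z => a (form1 z) * b (form2 z) + 0) by apply/funext => z; rewrite addr0.
  by apply: separatedD => //; exact: separated0.
set S := closure _.
have SK : S `<=` K.
  have <- : closure K = K.
    apply/esym/closure_id; apply: compact_closed cK.
    exact: (@norm_hausdorff R (R * R)%type).
  apply: closureS => z [_]; rewrite mulf_eq0 negb_or => /andP[]; exact: abK.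
have -> : Omega `&` S = S by apply: setIidr; exact: subset_trans KO.
by apply: (subclosed_compact _ cK SK); exact: closed_closure.
Qed.

(** If [form1] is constant along the direction [(k, 1)], the transport operator
only sees the second factor. *)
Lemma dt_dx_separated (k : R) a b (a' b' : R -> R) z :
  (forall x : R, is_derive x 1 a (a' x)) -> (forall x : R, is_derive x 1 b (b' x)) ->
  p * k + q = 0 ->
  k * dt (fun z => a (form1 z) * b (form2 z)) z +
    dx (fun z => a (form1 z) * b (form2 z)) z =
  (r * k + w) * (a (form1 z) * b' (form2 z)).
Proof.
move=> ha hb pkq.
have [_ +] := is_derive_separated (1, 0) z ha hb; rewrite -/(dt _ z) => ->.
have [_ +] := is_derive_separated (0, 1) z ha hb; rewrite -/(dx _ z) => ->.
rewrite /form1 /form2 /= !(mulr1, mulr0, addr0, add0r) -/(form1 z) -/(form2 z).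
transitivity ((p * k + q) * (a' (form1 z) * b (form2 z)) +
  (r * k + w) * (a (form1 z) * b' (form2 z))); last by rewrite pkq mul0r add0r.
by ring.
Qed.

End separated.

(** * Functions with vanishing integrals, integrals of plateaus *)

Section line.
Context {R : realType}.
Local Notation mu := (@lebesgue_measure R).

(** The primitive is continuous and vanishes at rational points, hence
everywhere; its derivative is the function at Lebesgue points. *)
Lemma ae0_of_rat_integrals (g : R -> R) (c d : R) :
  mu.-integrable `[c, d] (EFin \o g) ->
  (forall q : rat, c < ratr q < d -> \int[mu]_(x in `[c, ratr q]) g x = 0) ->
  {ae mu, forall x, c < x < d -> g x = 0}.
Proof.
move=> ig hq; have [cd|dc] := ltP c d; last by apply: aeW => x; lra.
pose Phi x := \int[mu]_(y in `[c, x]) g y.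
have Phi0 x : c < x < d -> Phi x = 0.
  move=> /andP[cx xd]; apply/eqP/negPn/negP => Px.
  have cPx : {for x, continuous Phi}.
    have [h _ _] := (continuous_within_itvP _ cd).1
       (@parameterized_integral_continuous R c d g (ltW cd) ig).
    by apply: h; rewrite in_itv/= cx xd.
  have : \forall y \near x, Phi y != 0 by exact: (@cvgr_neq0 R R _ _ _ _ _ cPx Px).
  move=> /nbhs_ballP[e /= e0 he].
  pose hi := Num.min d (x + e).
  have [q qP] : exists q : rat, ratr q \in `]x, hi[.
    by apply: rat_in_itvoo; rewrite lt_min xd ltrDl.
  move: qP; rewrite in_itv/= lt_min => /and3P[xq qd qe].
  have : Phi (ratr q) != 0.
    by apply: he; rewrite /ball/= ltr_distlC; apply/andP; split; lra.
  by rewrite /Phi hq ?eqxx// (lt_trans cx xq).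
pose g0 := g \_ `[c, d].
have mg : measurable_fun `[c, d] g.
  by case/integrableP : ig => /measurable_EFinP.
have lg : locally_integrable setT g0 by exact: integrable_locally.
move: (lebesgue_differentiation lg).
apply: ae_imply => x xl /andP[cx xd].
have i0 : mu.-integrable [set` Interval (BLeft c) (BRight d)] (EFin \o g0).
  by rewrite -restrict_EFin; apply/integrable_restrict => //=; rewrite setIid.
have := @FTC1_lebesgue_pt R g0 (BLeft c) x d xd i0 _ xl.
have cx' : (BLeft c < BRight x)%E by rewrite lte_fin.
move=> /(_ cx')[_].
rewrite {2}/g0 patchE mem_set/= ?in_itv/= ?(ltW cx) ?(ltW xd)// => <-.
rewrite derive1E (@near_eq_derive _ _ _ _ (cst 0)) ?derive_cst//.
near=> y; rewrite /cst -[RHS](Phi0 y); last first.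
  apply/andP; split; near: y; [exact: lt_nbhsr|exact: lt_nbhsl].
apply: eq_Rintegral => z.
rewrite inE/= in_itv/= => /andP[cz zy]; rewrite /g0 patchE mem_set//=.
rewrite in_itv/= cz (le_trans zy)// ltW//; near: y; exact: lt_nbhsl.
Unshelve. all: by end_near. Qed.

Lemma continuous_plateau (l r : R) n : continuous (plateau l r n).
Proof. exact: (smooth_upto_continuous (smooth_upto_plateau 0 l r n)). Qed.

Lemma measurable_plateau (l r : R) n : measurable_fun setT (plateau l r n).
Proof. by apply: continuous_measurable_fun; exact: continuous_plateau. Qed.

Lemma integrable_plateau (l r : R) n :
  mu.-integrable setT (EFin \o plateau l r n).
Proof.
apply: (le_integrable measurableT _ _ (integrable_indic_itv l r false true)).
  by apply/measurable_EFinP; exact: measurable_plateau.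
move=> x _ /=; rewrite lee_fin (ger0_norm (plateau_ge0 _ _ _ _)).
by rewrite (le_trans (plateau_le_indic _ _ _ _))// ler_norm.
Qed.

Lemma integral_plateau_ge0 (l r : R) n : 0 <= \int[mu]_x plateau l r n x.
Proof. by apply: Rintegral_ge0 => x _; exact: plateau_ge0. Qed.

Lemma integral_plateau_le (l r : R) n : l < r ->
  \int[mu]_x plateau l r n x <= r - l.
Proof.
move=> lr.
have -> : r - l = \int[mu]_x (\1_(`]l, r[%classic) x).
  rewrite /Rintegral integral_indic// setIT.
  have h : mu `]l, r[%classic = (r - l)%:E.
    by rewrite lebesgue_measure_itv/= lte_fin lr -EFinB.
  by move: h => /(congr1 fine) /= ->.
apply: le_Rintegral => //; [exact: integrable_plateau|exact: integrable_indic_itv|].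
by move=> x _; exact: plateau_le_indic.
Qed.

Lemma integral_plateau_cvg (l r : R) : l < r ->
  (\int[mu]_x plateau l r n x) @[n --> \oo] --> r - l.
Proof.
move=> lr; apply/fine_cvg => /=.
have mI : measurable_fun setT (EFin \o (\1_(`]l, r[%classic) : R -> R)).
  by apply/measurable_EFinP; exact: measurable_indic.
have [] := @dominated_convergence _ _ _ mu setT measurableT
  (fun n x => (plateau l r n x)%:E) (EFin \o \1_(`]l, r[%classic))
  (EFin \o \1_(`]l, r[%classic)).
- by move=> n; apply/measurable_EFinP; exact: measurable_plateau.
- exact: mI.
- by apply: aeW => x _; apply: cvg_EFin; [exact: nearW|exact: plateau_cvg].
- exact: integrable_indic_itv.
- apply: aeW => x n _; rewrite lee_fin ger0_norm ?plateau_ge0//.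
  exact: plateau_le_indic.
have -> : (\int[mu]_x (EFin \o \1_(`]l, r[%classic)) x = (r - l)%:E)%E.
  rewrite integral_indic// setIT.
  have h : mu `]l, r[%classic = (r - l)%:E.
    by rewrite lebesgue_measure_itv/= lte_fin lr -EFinB.
  exact: h.
by move=> _ _; apply.
Qed.

End line.

(** * Weakly constant functions on a box *)

Section slices.
Context {R : realType}.
Local Notation mu := (@lebesgue_measure R).
Local Notation mu2 := (@lebesgue2 R).
Local Notation T := (measurableTypeR R).
Local Notation T2 := (T * T)%type.

Definition slice_integral (w : R * R -> R) (s : R) : R :=
  \int[mu]_y w (s, y).

Lemma measurable_slice_integral w : measurable_fun (setT : set T2) w ->
  measurable_fun setT (slice_integral w).
Proof.
move=> mw; rewrite /slice_integral /Rintegral.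
apply: measurableT_comp; first exact: fine_measurable.
have mw' : measurable_fun (setT : set T2) (EFin \o w) by apply/measurable_EFinP.
rewrite (_ : (fun s => _) = (fun s : R =>
  \int[mu]_y ((EFin \o w)^\+ (s, y)) - \int[mu]_y ((EFin \o w)^\- (s, y)))%E); last first.
  apply/funext => s; rewrite integralE; congr (_ - _)%E;
  by apply: eq_integral => y _; rewrite ?funeposE ?funenegE.
apply: emeasurable_funB.
  apply: (measurable_fun_fubini_tonelli_F (m2 := mu)) => //.
  exact: measurable_funepos.
apply: (measurable_fun_fubini_tonelli_F (m2 := mu)) => //.
exact: measurable_funeneg.
Qed.

Lemma slice_integral_ae w : mu2.-integrable setT (EFin \o w) ->
  {ae mu, forall s, (\int[mu]_y (w (s, y))%:E = (slice_integral w s)%:E)%E}.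
Proof.
move=> iw; have iF := @integrable_fubini_F _ _ _ _ _ mu mu _ iw.
apply: filterS (integrable_ae measurableT iF) => s /(_ I) h.
by rewrite /slice_integral /Rintegral fineK.
Qed.

Lemma integrable_slice_integral w : measurable_fun (setT : set T2) w ->
  mu2.-integrable setT (EFin \o w) ->
  mu.-integrable setT (EFin \o slice_integral w).
Proof.
move=> mw iw; have iF := @integrable_fubini_F _ _ _ _ _ mu mu _ iw.
apply: le_integrable iF => //.
  by apply/measurable_EFinP; exact: measurable_slice_integral.
move=> s _; rewrite /slice_integral /Rintegral /= /fubini_F.
by case: (\int[mu]_y _)%E => [r||] /=; rewrite ?normr0 ?lee_fin ?leey.
Qed.

Lemma integral_slice_integral w : mu2.-integrable setT (EFin \o w) ->
  (\int[mu]_s (slice_integral w s)%:E = \int[mu2]_z (w z)%:E)%E.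
Proof.
move=> iw; rewrite -(@integral12_prod_meas1 _ _ _ _ _ mu mu _ iw).
apply: ae_eq_integral_nomeas; apply: filterS (slice_integral_ae iw) => s + _.
by move=> <-.
Qed.

End slices.

Section box.
Context {R : realType}.
Local Notation mu := (@lebesgue_measure R).
Local Notation mu2 := (@lebesgue2 R).
Local Notation T := (measurableTypeR R).
Local Notation T2 := (T * T)%type.

(** The equation says that the derivative of [u] in the second variable vanishes,
tested on products supported inside the box of sides [(s1, s2)] and [(0, d)]. *)
Definition box_weak (u : R * R -> R) (s1 s2 d : R) :=
  forall (a b b' : R -> R) (e : R), 0 < e ->
    (forall n, smooth_upto n a) -> (forall n, smooth_upto n b) ->
    (forall x : R, is_derive x 1 b (b' x)) ->
    (forall s, a s != 0 -> s1 + e <= s <= s2 - e) ->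
    (forall x, b x != 0 -> e <= x <= d - e) ->
    (\int[mu2]_z (u z * (a z.1 * b' z.2))%:E = 0)%E.

Variables (u : R * R -> R) (s1 s2 d : R).
Hypothesis d0 : 0 < d.
Hypothesis mu_ : measurable_fun (setT : set T2) u.
Hypothesis iu : mu2.-integrable setT (EFin \o u).
Hypothesis u0 : forall z, ~ (s1 < z.1 < s2 /\ 0 < z.2 < d) -> u z = 0.
Hypothesis wu : box_weak u s1 s2 d.

(** The two terms are weighted so as to cancel to the right of the supports: this
is a compactly supported primitive of a difference of plateaus, thus an
admissible second factor. *)
Let bump_primitive (x2 : R) n (x : R) : R :=
  (\int[mu]_y plateau 0 d n y) * primit (plateau 0 x2 n) x
  - (\int[mu]_y plateau 0 x2 n y) * primit (plateau 0 d n) x.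

Let bump (x2 : R) n (x : R) : R :=
  (\int[mu]_y plateau 0 d n y) * plateau 0 x2 n x
  - (\int[mu]_y plateau 0 x2 n y) * plateau 0 d n x.

Let is_derive_bump x2 n (x : R) : is_derive x 1 (bump_primitive x2 n) (bump x2 n x).
Proof.
have n0 : 0 <= 0 + n.+1%:R^-1 :> R by rewrite add0r.
have h1 := is_deriveZ (\int[mu]_y plateau 0 d n y) (is_derive_primit x
  (@plateau_support R 0 x2 n) n0 (@continuous_plateau _ _ _ n)).
have h2 := is_deriveZ (\int[mu]_y plateau 0 x2 n y) (is_derive_primit x
  (@plateau_support R 0 d n) n0 (@continuous_plateau _ _ _ n)).
exact: is_deriveB.
Qed.

Let smooth_bump x2 n k : smooth_upto k (bump x2 n).
Proof.
have -> : bump x2 n = fun x => (\int[mu]_y plateau 0 d n y) * plateau 0 x2 n x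
  + - (\int[mu]_y plateau 0 x2 n y) * plateau 0 d n x.
  by apply/funext => x; rewrite mulNr.
by apply: smooth_upto_add; apply: smooth_upto_scale; exact: smooth_upto_plateau.
Qed.

Let smooth_bump_primitive x2 n k : smooth_upto k (bump_primitive x2 n).
Proof.
by apply: smooth_uptoW; exists (bump x2 n); [exact: is_derive_bump|exact: smooth_bump].
Qed.

Let bump_primitive_support x2 n x : x2 <= d -> bump_primitive x2 n x != 0 ->
  n.+1%:R^-1 <= x <= d - n.+1%:R^-1.
Proof.
move=> x2d; rewrite /bump_primitive => h.
have : 0 < n.+1%:R^-1 :> R by rewrite invr_gt0.
move: (@plateau_support R 0 x2 n) (@plateau_support R 0 d n) h.
set e := n.+1%:R^-1 => H1 H2 h e0.
rewrite leNgt [X in _ && X]leNgt -negb_or; apply: contra h => /orP[xe|xe].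
  rewrite (primit_left H1) ?(primit_left H2) ?mulr0 ?subrr//.
  - by rewrite add0r ltW.
  - by rewrite add0r ltW.
have e1 : 0 <= 0 + e by rewrite add0r ltW.
rewrite (primit_right H1) ?(primit_right H2)//.
- by rewrite mulrC subrr.
- exact: ltW.
- apply: le_trans (ltW xe); lra.
Qed.

Let bump_bound x2 n x : 0 < x2 <= d -> `|bump x2 n x| <= 2 * d.
Proof.
move=> /andP[x20 x2d]; rewrite /bump; have -> : 2 * d = d + d by ring.
have bd l : 0 < l <= d -> 0 <= \int[mu]_y plateau 0 l n y <= d.
  move=> /andP[l0 ld]; rewrite integral_plateau_ge0/= (le_trans (integral_plateau_le _ l0))//.
  by rewrite subr0.
have pb l l' : 0 < l <= d -> `|(\int[mu]_y plateau 0 l n y) * plateau 0 l' n x| <= d.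
  move=> /bd/andP[h0 h1]; rewrite ger0_norm; last by apply: mulr_ge0 => //; exact: plateau_ge0.
  by rewrite (le_trans _ h1)// -[leRHS]mulr1 ler_wpM2l//; exact: plateau_le1.
apply: le_trans (ler_normB _ _) _.
by apply: lerD; apply: pb; rewrite ?d0 ?lexx ?x20 ?x2d.
Qed.

Let bump_cvg x2 x : 0 < x2 -> bump x2 n x @[n --> \oo] -->
  d * \1_(`]0, x2[%classic) x - x2 * \1_(`]0, d[%classic) x.
Proof.
move=> x20; apply: cvgB; (apply: cvgM; last exact: plateau_cvg).
  by have := integral_plateau_cvg d0; rewrite subr0.
by have := integral_plateau_cvg x20; rewrite subr0.
Qed.

Let mfst (f : R -> R) : measurable_fun setT f ->
  measurable_fun (setT : set T2) (fun z => f z.1).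
Proof. by move=> mf; exact: (measurableT_comp mf measurable_fst). Qed.

Let msnd (f : R -> R) : measurable_fun setT f ->
  measurable_fun (setT : set T2) (fun z => f z.2).
Proof. by move=> mf; exact: (measurableT_comp mf measurable_snd). Qed.

Let norm_indic_le1 (D : set R) (y : R) : `|\1_D y : R| <= 1.
Proof. by rewrite indicE; case: (y \in D); rewrite ?normr1 ?normr0. Qed.

Let kernel_fun (s x2 : R) (z : R * R) : R := \1_(`]s1, s[%classic) z.1 *
   (d * \1_(`]0, x2[%classic) z.2 - x2 * \1_(`]0, d[%classic) z.2).

Let measurable_kernel s x2 : measurable_fun (setT : set T2) (kernel_fun s x2).
Proof.
apply: measurable_funM; first by apply: mfst; exact: measurable_indic.
by apply: measurable_funB; apply: measurable_funM => //; apply: msnd; exact: measurable_indic.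
Qed.

(** As the plateaus increase to indicators, dominated convergence turns the weak
equation into an identity between integrals over sub-boxes. *)
Lemma box_weak_indicator (s x2 : R) : s1 < s <= s2 -> 0 < x2 <= d ->
  (\int[mu2]_z (u z * kernel_fun s x2 z)%:E = 0)%E.
Proof.
move=> /andP[s1s ss2] x2d; have /andP[x20 x2d'] := x2d.
pose f n (z : R * R) := (u z * (plateau s1 s n z.1 * bump x2 n z.2))%:E.
have f0 n : (\int[mu2]_z f n z = 0)%E.
  apply: (wu (e := n.+1%:R^-1) (b := bump_primitive x2 n)).
  - by rewrite invr_gt0.
  - by move=> k; exact: smooth_upto_plateau.
  - by move=> k; exact: smooth_bump_primitive.
  - exact: is_derive_bump.
  - move=> y /plateau_support; set e := _^-1 => /andP[? ?].
    by apply/andP; split; lra.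
  - by move=> x; exact: bump_primitive_support.
have mb n : measurable_fun setT (bump x2 n).
  by apply: continuous_measurable_fun; exact: smooth_upto_continuous (smooth_bump x2 n 0).
(* All kernels are bounded by [2 d], so [u] dominates up to this constant. *)
have [|||||_ _] := @dominated_convergence _ _ _ mu2 setT measurableT f
  (fun z => (u z * kernel_fun s x2 z)%:E) (fun z => ((2 * d)%:E * `|(u z)%:E|)%E).
- move=> n; apply/measurable_EFinP; apply: measurable_funM => //.
  by apply: measurable_funM; [apply: mfst; exact: measurable_plateau|exact: msnd].
- by apply/measurable_EFinP; exact: measurable_funM.
- apply: aeW => z _; apply: cvg_EFin; first exact: nearW.
  apply: cvgM; first exact: cvg_cst.
  by apply: cvgM; [exact: plateau_cvg|exact: bump_cvg].
- apply: integrableZl => //; exact: integrable_abse.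
- apply: aeW => z n _; rewrite /f /= -EFinM lee_fin normrM mulrC ler_wpM2r//.
  rewrite normrM -[leRHS]mul1r ler_pM//; last exact: bump_bound.
  by rewrite ger0_norm ?plateau_ge0// plateau_le1.
under eq_fun do rewrite f0.
by move/cvg_lim => <- //; rewrite lim_cst.
Qed.

Let gfun (x2 : R) (z : R * R) : R :=
  u z * (d * \1_(`]0, x2[%classic) z.2 - x2 * \1_(`]0, d[%classic) z.2).

Let mgfun x2 : measurable_fun (setT : set T2) (gfun x2).
Proof.
apply: measurable_funM => //.
by apply: measurable_funB; apply: measurable_funM => //; apply: msnd; exact: measurable_indic.
Qed.

Let igfun x2 : mu2.-integrable setT (EFin \o gfun x2).
Proof.
apply: (le_integrable measurableT _ _ (integrableZl measurableT (`|d| + `|x2|) iu)).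
  by apply/measurable_EFinP; exact: mgfun.
move=> z _ /=; rewrite lee_fin /gfun !normrM mulrC (ger0_norm (addr_ge0 (normr_ge0 d) (normr_ge0 x2))).
rewrite ler_wpM2r// (le_trans (ler_normB _ _))//.
by apply: lerD; rewrite normrM -[leRHS]mulr1 ler_wpM2l//;
  exact: norm_indic_le1.
Qed.

(** The first factor of the kernel being an arbitrary interval, the remaining
slice integral vanishes for almost every [s]. *)
Let gfun_slice0 x2 : 0 < x2 <= d ->
  {ae mu, forall s, s1 < s < s2 -> slice_integral (gfun x2) s = 0}.
Proof.
move=> x2d; apply: ae0_of_rat_integrals.
  apply: integrableS (integrable_slice_integral (mgfun x2) (igfun x2)) => //.
move=> q /andP[q1 q2].
have ik : mu2.-integrable setT (EFin \o (fun z => u z * kernel_fun (ratr q) x2 z)).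
  apply: (le_integrable measurableT _ _ (igfun x2)).
    by apply/measurable_EFinP; exact: measurable_funM.
  move=> z _ /=; rewrite lee_fin /kernel_fun mulrCA normrM ler_piMl//.
have := box_weak_indicator (s := ratr q) (x2 := x2); rewrite q1 ltW// => /(_ isT x2d).
rewrite -(integral_slice_integral ik) => h.
rewrite /Rintegral (@integral_itv_bndoo R); last first.
  by apply/measurable_EFinP; apply: measurable_funTS; exact: measurable_slice_integral.
rewrite integral_mkcond [X in fine X](_ : _ = 0%E)//.
rewrite -h; apply: eq_integral => s _; rewrite patchE.
have E : slice_integral (fun z => u z * kernel_fun (ratr q) x2 z) s =
    \int[mu]_y (\1_(`]s1, ratr q[%classic) s * gfun x2 (s, y)).
  by apply: eq_Rintegral => y _; rewrite /kernel_fun /gfun/= mulrCA.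
rewrite E indicE; case: (boolP (s \in _)) => sI; rewrite /slice_integral; congr EFin.
  by apply: eq_Rintegral => y _; rewrite mul1r.
rewrite (@eq_Rintegral _ _ _ mu setT (cst 0)) ?Rintegral_cst ?mul0r// => y _.
by rewrite mul0r.
Qed.

Let profile (s : R) : R := d^-1 * slice_integral u s.

Let measurable_profile : measurable_fun setT profile.
Proof. by apply: measurable_funM => //; exact: measurable_slice_integral. Qed.

(** [gfun_slice0] says that the integral of [u (s, .)] over [(0, q)] is
proportional to [q]; hence [u (s, .)] equals its mean. *)
Let slice_constant (s : R) : s1 < s < s2 ->
  mu.-integrable setT (fun y => (u (s, y))%:E) ->
  (forall q : rat, 0 < (ratr q : R) < d -> slice_integral (gfun (ratr q)) s = 0) ->
  {ae mu, forall y, 0 < y < d -> u (s, y) = profile s}.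
Proof.
move=> s12 is_ hq.
have dN0 : d != 0 by rewrite gt_eqF.
have isS (D : set R) : measurable (D : set T) ->
    mu.-integrable D (EFin \o (fun y => u (s, y))).
  by move=> mD; apply: integrableS is_.
have ic : mu.-integrable `[0, d] (EFin \o cst (profile s)).
  apply: continuous_compact_integrable; first exact: segment_compact.
  by apply: continuous_subspaceT => x; exact: cvg_cst.
suff : {ae mu, forall y, 0 < y < d -> u (s, y) - profile s = 0}.
  by apply: ae_imply => y h /h /subr0_eq.
apply: ae0_of_rat_integrals.
  have := @integrableB _ _ _ mu _ (measurable_itv _) _ _ (isS _ (measurable_itv _)) ic.
  exact: eq_integrable.
move=> q /[dup] q0d /andP[q0 qd].
have icq : mu.-integrable `[0, ratr q] (EFin \o cst (profile s)).
  apply: integrableS ic => // y /=; rewrite !in_itv/= => /andP[-> yq].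
  exact: le_trans yq (ltW qd).
rewrite (@RintegralB _ _ _ mu _ _ _ (measurable_itv _) (isS _ (measurable_itv _)) icq).
rewrite Rintegral_cst//.
have -> : fine (mu `[0, ratr q]) = ratr q.
  by rewrite lebesgue_measure_itv/= lte_fin q0 sube0.
have I1 : \int[mu]_(y in `[0, ratr q]) u (s, y) =
    \int[mu]_y (u (s, y) * \1_(`]0, ratr q[%classic) y).
  rewrite -Rintegral_itv_bndo_bndc; last exact: isS.
  rewrite -Rintegral_itv_obnd_cbnd; last exact: isS.
  rewrite Rintegral_mkcond; apply: eq_Rintegral => y _.
  by rewrite patchE indicE; case: (boolP (y \in _)); rewrite ?mulr1 ?mulr0.
have iI (l : R) : mu.-integrable setT
    (EFin \o (fun y => u (s, y) * \1_(`]0, l[%classic) y)).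
  apply: (le_integrable measurableT _ _ is_).
    apply/measurable_EFinP; apply: measurable_funM; last exact: measurable_indic.
    by case/integrableP : is_ => /measurable_EFinP.
  move=> y _ /=; rewrite lee_fin normrM ler_piMr//.
have := hq q q0d; rewrite /slice_integral /gfun.
under eq_Rintegral do rewrite mulrBr mulrCA [X in _ - X]mulrCA.
have iZ (k l : R) : mu.-integrable setT
    (EFin \o (fun y => k * (u (s, y) * \1_(`]0, l[%classic) y))).
  by apply: eq_integrable (integrableZl measurableT k (iI l)).
rewrite RintegralB//.
rewrite !RintegralZl//.
rewrite -I1 (_ : \int[mu]_y (u (s, y) * \1_(`]0, d[%classic) y) = slice_integral u s).
  move=> h; rewrite /profile; apply: (mulfI dN0).
  rewrite mulr0 mulrBr.
  have -> : d * (d^-1 * slice_integral u s * ratr q) = ratr q * slice_integral u s.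
    by field.
  exact: h.
apply: eq_Rintegral => y _; rewrite indicE.
case: (boolP (y \in _)) => [|yI]; first by rewrite mulr1.
rewrite mulr0; apply/esym/u0 => -[_]; apply/negP.
by move: yI; rewrite notin_setE/= in_itv/= => /negP.
Qed.

Let box_constancy_profile : {ae mu2, forall z, s1 < z.1 < s2 -> 0 < z.2 < d ->
  u z = profile z.1}.
Proof.
pose N : set T2 := [set z | s1 < z.1 < s2] `&` ([set z | 0 < z.2 < d] `&`
    [set z | u z - profile z.1 != 0]).
have mN : measurable N.
  apply: measurableI.
    rewrite (_ : [set _ | _] = fst @^-1` `]s1, s2[%classic); last first.
      by apply/seteqP; split => z /=; rewrite in_itv/=.
    by rewrite -[X in measurable X]setTI; apply: measurable_fst.
  apply: measurableI.
    rewrite (_ : [set _ | _] = snd @^-1` `]0, d[%classic); last first.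
      by apply/seteqP; split => z /=; rewrite in_itv/=.
    by rewrite -[X in measurable X]setTI; apply: measurable_snd.
  have mh : measurable_fun (setT : set T2) (fun z => u z - profile z.1).
    by apply: measurable_funB => //; exact: mfst.
  rewrite (_ : [set _ | _] = (fun z => u z - profile z.1) @^-1` (~` [set 0])); last first.
    by apply/seteqP; split => z /= /eqP.
  by rewrite -[X in measurable X]setTI; apply: mh => //; exact: measurableC.
exists N; split => //; last first.
  move=> z /=; rewrite !not_implyP => -[h1 [h2 h3]]; split => //; split => //=.
  by apply/eqP => /subr0_eq.
apply/(lebesgue2_null_xsection mN).
have hrat : {ae mu, forall s, forall q : rat, 0 < (ratr q : R) < d ->
    s1 < s < s2 -> slice_integral (gfun (ratr q)) s = 0}.
  have H : forall n : nat, {ae mu, forall s, forall q : rat,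
      unpickle n = Some q -> 0 < (ratr q : R) < d ->
      s1 < s < s2 -> slice_integral (gfun (ratr q)) s = 0}.
    move=> n; case: (unpickle n : option rat) => [q|]; last by apply: aeW.
    have [/andP[q0 qd]|hq] := boolP (0 < (ratr q : R) < d); last first.
      by apply: aeW => s _ [<-]; rewrite (negbTE hq).
    have := @gfun_slice0 (ratr q); rewrite q0 (ltW qd) => /(_ isT).
    by apply: ae_imply => s hs _ [<-] _.
  have := ae_foralln H; apply: filterS => s hs q.
  by apply: (hs (pickle q)); rewrite pickleK.
have iae := @ae_integrable1 _ _ _ _ _ mu mu _ iu.
apply: (ae_imply2 _ hrat iae) => s hq is_.
have [s12|s12] := boolP (s1 < s < s2); last first.
  rewrite (_ : xsection N s = set0) ?measure0//.
  apply/seteqP; split => // y; rewrite /xsection/= inE => -[/=].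
  by rewrite (negbTE s12).
apply: measure_negligible; first exact: measurable_xsection.
have := slice_constant s12 is_ (fun q q0d => hq q q0d s12).
apply: negligibleS => y; rewrite /xsection/= inE => -[_ [/= y0d hy]] h.
by move/eqP : hy; apply; rewrite h// subrr.
Qed.

Lemma box_constancy : {ae mu2, forall z, s1 < z.1 < s2 -> 0 < z.2 < d ->
  u z = d^-1 * slice_integral u z.1}.
Proof. exact: box_constancy_profile. Qed.

End box.

(** * The transport equation in characteristic coordinates *)

Section transport.
Context {R : realType}.
Local Notation mu := (@lebesgue_measure R).
Local Notation mu2 := (@lebesgue2 R).
Local Notation T := (measurableTypeR R).
Local Notation T2 := (T * T)%type.

(** The weak form of [k dh/dt + dh/dx = 0], whose solutions are the functions of
[t - k x]. *)
Definition weak_transport (k : R) (h : R * R -> R) := forall phi,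
  test_function phi ->
  (\int[mu2]_(z in Omega) (h z * (k * dt phi z + dx phi z))%:E = 0)%E.

Definition strip (S : R) : set (R * R) := `]0, S[%classic `*` `]0, 1[%classic.

Lemma measurable_strip S : measurable (strip S : set T2).
Proof. by apply: measurableX; exact: measurable_itv. Qed.

Definition strip_integrable (h : R * R -> R) :=
  measurable_fun (setT : set T2) h /\
  forall S, mu2.-integrable (strip S) (EFin \o h).

Definition box (s1 s2 d : R) : set (R * R) := `]s1, s2[%classic `*` `]0, d[%classic.

Lemma boxE s1 s2 d z : box s1 s2 d z = (s1 < z.1 < s2 /\ 0 < z.2 < d) :> Prop.
Proof. by rewrite /box /= !in_itv. Qed.

Lemma measurable_box s1 s2 d : measurable (box s1 s2 d : set T2).
Proof. by apply: measurableX; exact: measurable_itv. Qed.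

Lemma OmegaE (z : R * R) : Omega z = (0 < z.1 /\ 0 < z.2 < 1) :> Prop.
Proof. by []. Qed.

Lemma measurable_Omega : measurable (Omega : set T2).
Proof.
rewrite (_ : Omega = `]0, +oo[%classic `*` `]0, 1[%classic).
  by apply: measurableX; exact: measurable_itv.
by apply/seteqP; split => z /=; rewrite !in_itv/= ?andbT.
Qed.

Lemma continuous_pair (f g : R * R -> R) : continuous f -> continuous g ->
  continuous (fun z => (f z, g z)).
Proof. by move=> cf cg z; exact: (cvg_pair (cf z) (cg z)). Qed.

Lemma derive_zero_off (b b' : R -> R) (e f x : R) :
  (forall x : R, is_derive x 1 b (b' x)) ->
  (forall x, b x != 0 -> e <= x <= f) -> b' x != 0 -> e <= x <= f.
Proof.
move=> hb sb; apply: contraNT => xef.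
have [_ <-] := hb x; apply/eqP.
have b0 : \forall y \near x, b y = cst 0 y.
  move: xef; rewrite negb_and -!ltNge => /orP[xe|fx].
    near=> y; apply/eqP/negPn/negP => /sb /andP[ey _].
    by move: ey; rewrite leNgt => /negP; apply; near: y; exact: lt_nbhsl.
  near=> y; apply/eqP/negPn/negP => /sb /andP[_ yf].
  by move: yf; rewrite leNgt => /negP; apply; near: y; exact: lt_nbhsr.
by rewrite (near_eq_derive _ b0) derive_cst.
Unshelve. all: by end_near. Qed.

Section change_of_coordinates.
Variables (k p q r w : R) (M : R * R -> R * R) (h : R * R -> R).
Hypotheses (pq0 : p * k + q = 0) (rw0 : r * k + w != 0).
Hypothesis pM : preserving M.
Hypothesis cM : continuous M.
Hypothesis formM1 : forall z, p * (M z).1 + q * (M z).2 = z.1.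
Hypothesis formM2 : forall z, r * (M z).1 + w * (M z).2 = z.2.
Hypothesis Mform : forall z, M (p * z.1 + q * z.2, r * z.1 + w * z.2) = z.
Hypothesis pform :
  preserving (fun z => (p * z.1 + q * z.2, r * z.1 + w * z.2)).
Hypotheses (ih : strip_integrable h) (wh : weak_transport k h).
Variables (s1 s2 d S : R).
Hypothesis d0 : 0 < d.
Hypothesis MS : box s1 s2 d `<=` M @^-1` (strip S).

Let mh : measurable_fun (setT : set T2) h. Proof. by case: ih. Qed.

Let MO : box s1 s2 d `<=` M @^-1` Omega.
Proof.
move=> z /MS [/=]; rewrite !in_itv/= => /andP[z10 _] z2.
by rewrite OmegaE.
Qed.

Let u := (h \o M) \_ (box s1 s2 d).

Let mu_ : measurable_fun (setT : set T2) u.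
Proof.
apply: (@measurable_restrictT _ _ _ _ _ _ (measurable_box s1 s2 d)).1.
by apply: measurable_funTS; apply: measurableT_comp => //; case: pM.
Qed.

Let iu : mu2.-integrable setT (EFin \o u).
Proof.
have mS := measurable_strip S.
have i1 : mu2.-integrable setT ((EFin \o h) \_ (strip S)).
  by apply/(integrable_mkcond _ mS).1; case: ih.
apply: le_integrable (integrable_preserving pM i1) => //.
  by apply/measurable_EFinP; exact: mu_.
move=> z _ /=; rewrite /u !patchE; case: ifPn => [/set_mem bz|_].
  by rewrite mem_set//; exact: MS.
by rewrite normr0; exact: abse_ge0.
Qed.

(** In coordinates whose first one is constant along the characteristics, the
transport equation becomes the equation of [box_weak]. *)
Lemma transport_box_weak : box_weak ((h \o M) \_ (box s1 s2 d)) s1 s2 d.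
Proof.
move=> a b b' e e0 sa sb bb' ae be.
pose c := r * k + w.
pose bc x := c^-1 * b x.
have sbc n : smooth_upto n bc by exact: smooth_upto_scale.
have bcc' (x : R) : is_derive x 1 bc (c^-1 * b' x).
  by have := is_deriveZ c^-1 (bb' x).
(* The image of this compact box contains the support of the test function. *)
pose Q : set (R * R) := `[s1 + e, s2 - e]%classic `*` `[e, d - e]%classic.
have Qbox : Q `<=` box s1 s2 d.
  move=> z [/=]; rewrite !in_itv/= => /andP[? ?] /andP[? ?].
  by rewrite boxE; split; apply/andP; split; lra.
have tphi : test_function (fun z => a (p * z.1 + q * z.2) * bc (r * z.1 + w * z.2)).
  apply: (@test_function_separated _ _ _ _ _ _ _ (M @` Q)) => //.
  - apply: continuous_compact; first exact: continuous_subspaceT.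
    by apply: compact_setX; exact: segment_compact.
  - by move=> _ [z /Qbox Qz <-]; exact: MO.
  - move=> z az; rewrite mulf_eq0 negb_or => /andP[_ bz].
    exists (p * z.1 + q * z.2, r * z.1 + w * z.2); last exact: Mform.
    by split => /=; rewrite in_itv/=; [exact: ae|exact: be].
have [a' haa' _] := sa 1%N.
have ab'Q z : a z.1 * b' z.2 != 0 -> box s1 s2 d z.
  rewrite mulf_eq0 negb_or => /andP[az bz]; apply: Qbox.
  by split => /=; rewrite in_itv/=; [exact: ae|exact: derive_zero_off bb' be bz].
have cb' : continuous b'.
  have [b'' hb'' sb''] := sb 1%N.
  suff -> : b' = b'' by [].
  apply/funext => x; have [_ <-] := bb' x; by have [_ <-] := hb'' x.
pose G : T2 -> \bar R := fun z =>
   (h z * (a (p * z.1 + q * z.2) * b' (r * z.1 + w * z.2)))%:E.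
have mform (x y : R) : measurable_fun (setT : set T2) (fun z => x * z.1 + y * z.2).
  by apply: continuous_measurable2; exact: continuous_form.
have mG : measurable_fun (setT : set T2) G.
  apply/measurable_EFinP; apply: measurable_funM => //; apply: measurable_funM.
    have ma : measurable_fun setT a.
      by apply: continuous_measurable_fun; exact: smooth_upto_continuous (sa 0%N).
    exact: (measurableT_comp ma (mform p q)).
  exact: (measurableT_comp (continuous_measurable_fun cb') (mform r w)).
have := wh tphi; rewrite (eq_integral G); last first.
  move=> z _; congr EFin; congr (_ * _).
  rewrite (dt_dx_separated _ _ _ haa' bcc' pq0) -/c mulrCA; congr (_ * _).
  by rewrite mulrA divff// mul1r.
rewrite integral_mkcond (@integral_preserving _ M (G \_ Omega) pM); last first.
  exact: ((@measurable_restrictT _ _ _ _ _ G measurable_Omega).1 (measurable_funTS mG)).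
move=> <-; apply: eq_integral => z _; rewrite !patchE /G formM1 formM2.
have [->|ab0] := eqVneq (a z.1 * b' z.2) 0.
  by rewrite !mulr0; case: ifPn.
by have bz := ab'Q _ ab0; rewrite !mem_set//; exact: MO.
Qed.

Lemma measurable_transport_profile : measurable_fun setT (slice_integral u).
Proof. exact: measurable_slice_integral. Qed.

Lemma integrable_transport_profile :
  mu.-integrable setT (EFin \o slice_integral u).
Proof. exact: integrable_slice_integral. Qed.

Lemma transport_box_constancy :
  {ae mu2, forall z, s1 < p * z.1 + q * z.2 < s2 -> 0 < r * z.1 + w * z.2 < d ->
    h z = d^-1 * slice_integral u (p * z.1 + q * z.2)}.
Proof.
have u0 z : ~ (s1 < z.1 < s2 /\ 0 < z.2 < d) -> u z = 0.
  by rewrite -boxE => bz; rewrite /u patchE memNset.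
have := ae_preserving pform (box_constancy d0 mu_ iu u0 transport_box_weak).
apply: ae_imply => z /= hz z1 z2.
rewrite -hz// /u patchE mem_set; last by rewrite boxE.
by rewrite /= Mform.
Qed.

End change_of_coordinates.

(** The characteristics labelled by [s = t - k x] and parametrised by [x] are
complete in the strip as soon as [s] exceeds both [0] and [- k]. *)
Lemma transport_label_x k h (s1 s2 : R) : strip_integrable h ->
  weak_transport k h -> 0 <= s1 -> - k <= s1 ->
  mu.-integrable setT (EFin \o slice_integral ((h \o shear k) \_ (box s1 s2 1))) /\
  {ae mu2, forall z, s1 < z.1 - k * z.2 < s2 -> 0 < z.2 < 1 ->
    h z = slice_integral ((h \o shear k) \_ (box s1 s2 1)) (z.1 - k * z.2)}.
Proof.
move=> ih wh s10 s1k.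
have pform : preserving (fun z : R * R => (1 * z.1 + - k * z.2, 0 * z.1 + 1 * z.2)).
  rewrite (_ : (fun z => _) = shear (- k)); first exact: preserving_shear.
  by apply/funext => z; rewrite /shear !mul1r mul0r add0r.
have MS : box s1 s2 1 `<=` shear k @^-1` strip (s2 + `|k|).
  move=> z; rewrite boxE => -[/andP[z11 z12] /andP[z20 z21]].
  have h1 := ler_norm k; have h2 := normr_ge0 k.
  split; rewrite /= in_itv/=; last by rewrite z20 z21.
  apply/andP; split.
    have [k0|k0] := leP 0 k.
      by rewrite ltr_pwDl ?mulr_ge0// ?(le_lt_trans s10)// ltW.
    by nra.
  have := ler_norm (k * z.2); rewrite normrM (gtr0_norm z20); nra.
have cM : continuous (shear k).
  apply: continuous_pair => z; last exact: cvg_snd.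
  apply: cvgD; first exact: cvg_fst.
  by apply: cvgM; [exact: cvg_cst|exact: cvg_snd].
split; first exact: (integrable_transport_profile (preserving_shear k) ih MS).
have := @transport_box_constancy k 1 (- k) 0 1 (shear k) h _ _
   (preserving_shear k) cM _ _ _ pform ih wh s1 s2 1 _ ltr01 MS.
rewrite !mul1r subrr mul0r add0r oner_neq0 => /(_ erefl isT).
have E1 z : 1 * (shear k z).1 + - k * (shear k z).2 = z.1.
  by rewrite /shear/= mul1r mulNr addrK.
have E2 z : 0 * (shear k z).1 + 1 * (shear k z).2 = z.2.
  by rewrite /shear/= mul0r mul1r add0r.
have E3 z : shear k (1 * z.1 + - k * z.2, 0 * z.1 + 1 * z.2) = z.
  by case: z => t x; rewrite /shear/= !mul1r mul0r add0r mulNr subrK.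
move=> /(_ E1 E2 E3).
apply: ae_imply => z hz z1 z2.
have := hz; rewrite !mul1r mul0r add0r mulNr invr1 mul1r; exact.
Qed.

(** Near the initial segment the characteristics are labelled by the abscissa
[x - t / k] at time [0] and parametrised by [t]; the bounds on [x1], [x2] and
[d] keep the parallelogram inside the domain. *)
Lemma transport_label_t k h (x1 x2 d : R) : k != 0 -> strip_integrable h ->
  weak_transport k h -> 0 < d -> 0 <= x1 -> x2 <= 1 ->
  0 <= x1 + d / k -> x2 + d / k <= 1 ->
  exists2 F : R -> R, loc_int F &
  {ae mu2, forall z, x1 < z.2 - z.1 / k < x2 -> 0 < z.1 < d ->
    h z = F (z.2 - z.1 / k)}.
Proof.
move=> k0 ih wh d0 x10 x21 x1d x2d.
pose M (z : R * R) := (z.2, z.1 + z.2 / k).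
have pM : preserving M.
  rewrite (_ : M = (fun z => (z.2, z.1)) \o shear k^-1).
    by apply: preserving_comp; [exact: preserving_swap|exact: preserving_shear].
  by apply/funext => z; rewrite /M /shear/= (mulrC z.2).
have pform : preserving (fun z : R * R => (- k^-1 * z.1 + 1 * z.2, 1 * z.1 + 0 * z.2)).
  rewrite (_ : (fun z => _) = shear (- k^-1) \o (fun z => (z.2, z.1))).
    by apply: preserving_comp; [exact: preserving_shear|exact: preserving_swap].
  by apply/funext => z; rewrite /shear/= !mul1r mul0r addr0 addrC.
have MS : box x1 x2 d `<=` M @^-1` strip d.
  move=> z; rewrite boxE => -[/andP[z11 z12] /andP[z20 z21]].
  split; rewrite /= in_itv/=; first by rewrite z20 z21.
  have [th th0 th1] : exists2 th : R, 0 < th < 1 & z.2 = th * d.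
    exists (z.2 / d); last by rewrite divfK// gt_eqF.
    by rewrite divr_gt0//= ltr_pdivrMr// mul1r.
  rewrite th1 -mulrA; move: (d / k) x1d x2d => D x1d x2d.
  case/andP: th0 => t0 t1; apply/andP; split; nra.
have cM : continuous M.
  apply: continuous_pair => z; first exact: cvg_snd.
  apply: cvgD; first exact: cvg_fst.
  by apply: cvgM; [exact: cvg_snd|exact: cvg_cst].
exists (fun s => d^-1 * slice_integral ((h \o M) \_ (box x1 x2 d)) s).
  split; first by apply: measurable_funM => //; exact: (measurable_transport_profile pM ih).
  move=> S; apply: integrableS; last first.
    by apply: eq_integrable (integrableZl measurableT d^-1
      (integrable_transport_profile pM ih MS)).
  - by [].
  - exact: measurable_itv.
  - exact: measurableT.
have F1 : - k^-1 * k + 1 = 0 by rewrite mulNr mulVf// addNr.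
have F2 : 1 * k + 0 != 0 by rewrite mul1r addr0.
have E1 z : - k^-1 * (M z).1 + 1 * (M z).2 = z.1.
  by rewrite /M/= mul1r mulNr (mulrC z.2) addrC addrK.
have E2 z : 1 * (M z).1 + 0 * (M z).2 = z.2.
  by rewrite /M/= mul0r mul1r addr0.
have E3 z : M (- k^-1 * z.1 + 1 * z.2, 1 * z.1 + 0 * z.2) = z.
  case: z => t x; rewrite /M/= !mul1r mul0r addr0; congr pair.
  by rewrite mulNr (mulrC t) addrC addrA subrr add0r.
have := @transport_box_constancy k _ 1 1 0 M h F1 F2 pM cM E1 E2 E3 pform ih wh
   x1 x2 d _ d0 MS.
apply: ae_imply => z hz z1 z2.
have := hz; rewrite !mul1r mul0r addr0 mulNr (mulrC _ z.1) addrC; exact.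
Qed.

End transport.

(** * Weak solutions with zero initial trace *)

Section representation.
Context {R : realType}.
Local Notation mu := (@lebesgue_measure R).
Local Notation mu2 := (@lebesgue2 R).
Local Notation T := (measurableTypeR R).
Local Notation T2 := (T * T)%type.

Lemma ae_forall_countable d (X : measurableType d) (m : {measure set X -> \bar R})
    (I : countType) (P : I -> X -> Prop) :
  (forall i, {ae m, forall x, P i x}) -> {ae m, forall x, forall i, P i x}.
Proof.
move=> h.
have H (n : nat) : {ae m, forall x, forall i, unpickle n = Some i -> P i x}.
  case: (unpickle n : option I) => [i|]; last by apply: aeW.
  by apply: (@filterS _ _ (ae_filter_ringOfSetsType m)) (h i) => x Pix _ [<-].
apply: (@filterS _ _ (ae_filter_ringOfSetsType m)) (ae_foralln H) => x hx i.
by apply: (hx (pickle i)); rewrite pickleK.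
Qed.

Lemma ae_neq (c : R) : {ae mu, forall x, x != c}.
Proof.
exists [set c]; split; [exact: measurable_set1|exact: lebesgue_measure_set1|].
by move=> x /= /negP; rewrite negbK => /eqP.
Qed.

Lemma ae_fst (P : R -> Prop) : {ae mu, forall x, P x} ->
  {ae mu2, forall z : R * R, P z.1}.
Proof.
move=> [N [mN N0 sub]]; exists (N `*` setT); split.
- exact: measurableX.
- have E := @product_measure1E _ _ _ _ _ mu mu N setT mN measurableT.
  by apply: (etrans E); rewrite -[X in (X * _)%E]/(mu N) N0 mul0e.
- by move=> z /= nP; split => //; exact: sub.
Qed.

Lemma ae_eq_Rintegral (D : set R) (f g : R -> R) :
  {ae mu, forall x, D x -> f x = g x} ->
  \int[mu]_(x in D) f x = \int[mu]_(x in D) g x.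
Proof.
move=> fg; rewrite /Rintegral (@ae_eq_integral_nomeas _ _ _ mu D _ (EFin \o g))//.
by apply: ae_imply fg => x h /h /= ->.
Qed.

(** The label is the first coordinate of a measure-preserving map. *)
Lemma ae_label k : k != 0 -> forall P : R -> Prop, {ae mu, forall x, P x} ->
  {ae mu2, forall z : R * R, P (z.2 - z.1 / k)}.
Proof.
move=> k0 P /ae_fst hP.
have pM : preserving (shear (- k^-1) \o (fun z : R * R => (z.2, z.1))).
  by apply: preserving_comp; [exact: preserving_shear|exact: preserving_swap].
have := ae_preserving pM hP.
apply: ae_imply => z.
by rewrite /shear/= mulNr (mulrC _ z.1).
Qed.

Lemma avg_ae_eq (f g : R -> R) (c : R) : 0 < c ->
  {ae mu, forall t, 0 < t < c -> f t = g t} ->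
  \forall e \near 0^'+, e^-1 * (\int[mu]_(t in `[0, e]) f t) =
     e^-1 * (\int[mu]_(t in `[0, e]) g t).
Proof.
move=> c0 fg; near=> e.
have ec : e < c by near: e; exact: nbhs_right_lt.
congr (_ * _); apply: ae_eq_Rintegral.
apply: (ae_imply2 _ (ae_neq 0) fg).
move=> t t0 h /=; rewrite in_itv/= => /andP[t0' te]; apply: h.
by rewrite lt_neqAle eq_sym t0 t0' (le_lt_trans te).
Unshelve. all: by end_near. Qed.

Lemma avg_trace (F f : R -> R) (s k c : R) : loc_int F -> lebesgue_pt F s ->
  0 < c -> {ae mu, forall t, 0 < t < c -> f t = F (k * t + s)} ->
  e^-1 * (\int[mu]_(t in `[0, e]) f t) @[e --> 0^'+] --> F s.
Proof.
move=> lF Fs c0 fF; have h := avg_ae_eq c0 fF.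
apply: cvg_trans (avg_cvg k lF Fs); apply: near_eq_cvg.
by apply: filterS h => e ->.
Qed.

Lemma ae_lebesgue_pt (F : R -> R) : loc_int F -> {ae mu, forall s, lebesgue_pt F s}.
Proof. by move=> /loc_int_locally/lebesgue_differentiation. Qed.

(** On each small parallelogram resting on the initial segment the solution is a
function of the abscissa at time [0], which is its trace, hence zero. Countably
many rational parallelograms cover the region. *)
Lemma transport_zero_initial k (h : R * R -> R) : k != 0 -> strip_integrable h ->
  weak_transport k h ->
  {ae mu, forall x, 0 < x < 1 -> avg_t0 h x e @[e --> 0^'+] --> (0 : R)} ->
  {ae mu2, forall z, Omega z -> 0 < z.2 - z.1 / k < 1 -> h z = 0}.
Proof.
move=> k0 ih wh trace.
(* Parallelograms inside the domain; [q] only serves as an index. *)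
pose good (q : (rat * rat) * rat) (x1 x2 d : R) := [/\ 0 < d, 0 <= x1, x2 <= 1,
  0 <= x1 + d / k & x2 + d / k <= 1].
have H (q : (rat * rat) * rat) : {ae mu2, forall z : R * R,
    good q (ratr q.1.1) (ratr q.1.2) (ratr q.2) ->
    ratr q.1.1 < z.2 - z.1 / k < ratr q.1.2 -> 0 < z.1 < ratr q.2 -> h z = 0}.
  case: q => [[q1 q2] q3] /=.
  move: (ratr q1) (ratr q2) (ratr q3) => x1 x2 d.
  have [g|ng] := pselect (good (q1, q2, q3) x1 x2 d); last by apply: aeW.
  have [d0 x10 x21 x1d x2d] := g.
  have [F lF hF] := transport_label_t k0 ih wh d0 x10 x21 x1d x2d.
  suff F0 : {ae mu, forall s, x1 < s < x2 -> F s = 0}.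
    apply: (ae_imply2 _ hF (ae_label k0 F0)).
    by move=> z h1 h2 _ z1 z2; rewrite h1// h2.
  have := ae_imply3 _     (ae_slice_x hF) trace (ae_lebesgue_pt lF).
  apply => x hx tr xl /andP[x1x xx2].
  have tr0 : avg_t0 h x e @[e --> 0^'+] --> (0 : R).
    by apply: tr; rewrite (le_lt_trans x10 x1x) (lt_le_trans xx2 x21).
  have [c [c0 cd cx]] : exists c, [/\ 0 < c, c <= d &
      forall t, 0 < t < c -> x1 < x - t / k < x2].
    have kn : 0 < `|k^-1| by rewrite normr_gt0 invr_eq0.
    pose m := Num.min (x - x1) (x2 - x).
    have m0 : 0 < m by rewrite lt_min !subr_gt0 x1x xx2.
    exists (Num.min d (m / `|k^-1|)); split.
    - by rewrite lt_min d0 divr_gt0.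
    - by rewrite ge_min lexx.
    - move=> t /andP[t0]; rewrite lt_min => /andP[_]; rewrite ltr_pdivlMr// => tm.
      have : `|t / k| < m by rewrite normrM (gtr0_norm t0).
      rewrite ltr_norml lt_min => /andP[+ /andP[]].
      rewrite ltrNl lt_min => /andP[]; move: (t / k) => y ? ? ? ?.
      by apply/andP; split; lra.
  have : {ae mu, forall t, 0 < t < c -> h (t, x) = F (- k^-1 * t + x)}.
    apply: ae_imply hx => t ht /andP[t0 tc].
    rewrite ht/=.
    - by congr F; rewrite mulNr (mulrC _ t) addrC.
    - by apply: cx; rewrite t0.
    - by rewrite t0 (lt_le_trans tc).
  move=> /(avg_trace lF xl c0) tF.
  by apply/esym; apply: (cvg_unique (@Rhausdorff R) tr0 tF).
have := ae_forall_countable H.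
apply: ae_imply => z hz.
rewrite OmegaE => -[t0 /andP[x0 x1]] /andP[xi0 xi1].
have kn : 0 < `|k^-1| by rewrite normr_gt0 invr_eq0.
set xi := z.2 - z.1 / k in xi0 xi1.
(* The margin by which a rational parallelogram about [z] may exceed it. *)
pose eta := Num.min (Num.min xi (1 - xi)) (Num.min z.2 (1 - z.2)).
have eta0 : 0 < eta by rewrite !lt_min xi0 x0 !subr_gt0 xi1 x1.
have [e1 e2 e3 e4] : [/\ eta <= xi, eta <= 1 - xi, eta <= z.2 & eta <= 1 - z.2].
  by rewrite /eta !ge_min !lexx !orbT.
have [q1] : exists q : rat, ratr q \in `](xi - eta / 2), xi[.
  by apply: rat_in_itvoo; rewrite ltrBlDr ltrDl divr_gt0.
rewrite in_itv/= => /andP[q11 q12].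
have [q2] : exists q : rat, ratr q \in `]xi, (xi + eta / 2)[.
  by apply: rat_in_itvoo; rewrite ltrDl divr_gt0.
rewrite in_itv/= => /andP[q21 q22].
have [q3] : exists q : rat, ratr q \in `]z.1, (z.1 + eta / (2 * `|k^-1|))[.
  by apply: rat_in_itvoo; rewrite ltrDl divr_gt0// mulr_gt0.
rewrite in_itv/= => /andP[q31 q32].
apply: (hz ((q1, q2), q3)) => /=; [|by rewrite q12 q21|by rewrite t0 q31].
move: q11 q12 q21 q22 q31 q32.
move: (ratr q1) (ratr q2) (ratr q3) => y1 y2 d q11 q12 q21 q22 q31 q32.
have dk : `|(d - z.1) / k| < eta / 2.
  rewrite normrM gtr0_norm ?subr_gt0// -ltr_pdivlMr//.
  rewrite (_ : eta / 2 / _ = eta / (2 * `|k^-1|)); first by rewrite ltrBlDl.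
  by field; rewrite gt_eqF.
have xiE : xi = z.2 - z.1 / k by [].
move: dk; rewrite mulrBl ltr_norml => /andP[].
move: xiE q11 q12 q21 q22 eta0 e1 e2 e3 e4 q31 t0.
rewrite /good; clearbody xi eta; move: (z.1 / k) (d / k) => a b *; split; lra.
Qed.

End representation.

Section representation2.
Context {R : realType}.
Local Notation mu := (@lebesgue_measure R).
Local Notation mu2 := (@lebesgue2 R).
Local Notation T := (measurableTypeR R).
Local Notation T2 := (T * T)%type.

(** Characteristics with label at most [max 0 (- k)] meet the initial segment, and
[transport_zero_initial] applies; along the other ones the solution is constant
by [transport_label_x]. *)
Lemma transport_representation k (h : R * R -> R) : k != 0 ->
  strip_integrable h -> weak_transport k h ->
  {ae mu, forall x, 0 < x < 1 -> avg_t0 h x e @[e --> 0^'+] --> (0 : R)} ->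
  exists F : R -> R, [/\ loc_int F,
    forall s, s <= Num.max 0 (- k) -> F s = 0 &
    {ae mu2, forall z, Omega z -> h z = F (z.1 - k * z.2)}].
Proof.
move=> k0 ih wh trace; set s1 := Num.max 0 (- k).
have s10 : 0 <= s1 by rewrite le_max lexx.
have s1k : - k <= s1 by rewrite le_max lexx orbT.
have mh : measurable_fun (setT : set T2) h by case: ih.
pose u := (h \o shear k) \_ (`]s1, +oo[%classic `*` `]0, 1[%classic).
have mu_ : measurable_fun (setT : set T2) u.
  apply: (@measurable_restrictT _ _ _ _ _ _ _).1.
    by apply: measurableX; exact: measurable_itv.
  by apply: measurable_funTS; apply: measurableT_comp => //; exact: measurable_shear.
have uS (S s : R) : s < S ->
    slice_integral u s = slice_integral ((h \o shear k) \_ (box s1 S 1)) s.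
  move=> sS; apply: eq_Rintegral => y _; rewrite /u !patchE.
  have -> : ((s, y) \in box s1 S 1) = ((s, y) \in `]s1, +oo[%classic `*` `]0, 1[%classic).
    apply/idP/idP => /set_mem.
      rewrite boxE => -[/andP[s1s _] y01]; apply/mem_set.
      by split; rewrite /= in_itv/= ?andbT.
    move=> [/=]; rewrite !in_itv/= andbT => s1s y01; apply/mem_set.
    by rewrite boxE /= s1s.
  by [].
have F0 s : s <= s1 -> slice_integral u s = 0.
  move=> ss1; rewrite /slice_integral.
  rewrite (@eq_Rintegral _ _ _ mu setT (cst 0)) ?Rintegral_cst ?mul0r// => y _.
  rewrite /u patchE memNset// => -[/=]; rewrite in_itv/= andbT.
  by rewrite ltNge ss1.
exists (slice_integral u); split => //.
- split; first exact: measurable_slice_integral.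
  move=> S; have [iS _] := @transport_label_x _ k h s1 (S + 1) ih wh s10 s1k.
  have : mu.-integrable `[- S, S]
      (EFin \o slice_integral ((h \o shear k) \_ (box s1 (S + 1) 1))).
    by apply: integrableS iS => //; exact: measurable_itv.
  apply: eq_integrable; first exact: measurable_itv.
  move=> s; rewrite inE/= in_itv/= => /andP[_ sS]; congr EFin.
  by apply/esym/uS; lra.
have hn : {ae mu2, forall z : R * R, forall n : nat,
    s1 < z.1 - k * z.2 < n%:R -> 0 < z.2 < 1 -> h z = slice_integral u (z.1 - k * z.2)}.
  apply: ae_forall_countable => n.
  have [_] := @transport_label_x _ k h s1 n%:R ih wh s10 s1k.
  apply: ae_imply => z hz z1 z2.
  by rewrite (uS n%:R) ?hz//; case/andP: z1.
have hl : {ae mu2, forall z : R * R, z.1 - k * z.2 != s1}.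
  have := ae_preserving (preserving_shear (- k)) (ae_fst (ae_neq s1)).
  apply: ae_imply => z.
  by rewrite /shear/= mulNr.
have h0 := transport_zero_initial k0 ih wh trace.
apply: (ae_imply3 _ hn hl h0).
move=> z zn zl z0 Oz; move: (Oz); rewrite OmegaE => -[t0 x01].
have /andP[x0 x1] := x01.
have dE : z.1 - k * z.2 = - k * (z.2 - z.1 / k) by field.
have [s1s|ss1] := ltP s1 (z.1 - k * z.2).
  have [n] : exists n : nat, z.1 - k * z.2 < n%:R.
    exists (Num.bound `|z.1 - k * z.2|); apply: le_lt_trans (ler_norm _) _.
    exact: (@archi_boundP R).
  by move=> sn; apply: (zn n) => //; rewrite s1s.
rewrite F0//. apply: z0 => //.
have {}ss1 : z.1 - k * z.2 < s1 by rewrite lt_neqAle zl.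
have xiE : z.2 - z.1 / k = z.2 + z.1 * - k^-1 by rewrite mulrN.
move: ss1; rewrite /s1 lt_max => /orP[s0|sk].
  have [kp|kn] := ltP 0 k.
    have kV : 0 < k^-1 by rewrite invr_gt0.
    rewrite subr_gt0 ltr_pdivrMr// mulrC; apply/andP; split; first lra.
    by rewrite ltrBlDr (lt_trans x1)// ltrDl mulr_gt0.
  by nra.
have [kp|kn] := ltP 0 k.
  by nra.
have {}kn : k < 0 by rewrite lt_neqAle k0.
have kV : 0 < - k^-1 by rewrite oppr_gt0 invr_lt0.
have h1 : z.2 - z.1 / k < 1.
  have : - k * (z.2 - z.1 / k) < - k * 1 by rewrite -dE mulr1.
  by rewrite ltr_pM2l// oppr_gt0.
rewrite h1 andbT xiE addr_gt0// mulr_gt0//.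
Qed.

End representation2.

(** * Test functions extended by zero *)

Section testfun.
Context {R : realType}.
Local Notation mu := (@lebesgue_measure R).
Local Notation mu2 := (@lebesgue2 R).
Local Notation T := (measurableTypeR R).
Local Notation T2 := (T * T)%type.

Lemma open_Omega : open (Omega : set (R * R)).
Proof.
rewrite (_ : Omega = fst @^-1` [set t : R | 0 < t] `&`
   (snd @^-1` [set x : R | 0 < x] `&` snd @^-1` [set x : R | x < 1])).
  apply: openI; first by apply: open_comp => [z _|]; [exact: cvg_fst|exact: open_gt].
  by apply: openI; apply: open_comp => [z _|];
    [exact: cvg_snd|exact: open_gt|exact: cvg_snd|exact: open_lt].
by apply/seteqP; split => z /=; rewrite OmegaE => -[? ];
  [move/andP=> [? ?]|move=> [? ?]; split => //; apply/andP].
Qed.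

Section one_test_function.
Variable phi : R * R -> R.
Hypothesis tphi : test_function phi.

Let S := [set z : R * R | Omega z /\ phi z != 0].
Let K := Omega `&` closure S.

Let cK : compact K. Proof. by case: tphi. Qed.

Let closedK : closed K.
Proof. by apply: compact_closed cK; exact: (@norm_hausdorff R (R * R)%type). Qed.

Let near_off z : ~ K z -> \forall y \near z, ~ K y.
Proof. by move=> zK; apply: (open_nbhs_nbhs (conj (closed_openC closedK) zK)). Qed.

Let phi_off z : Omega z -> ~ K z -> phi z = 0.
Proof.
move=> Oz Kz; apply/eqP/negPn/negP => pz; apply: Kz; split => //.
by apply: subset_closure; split.
Qed.

(** A test function only has derivatives inside the open domain; its extension by
zero is differentiable everywhere, because the support is compact in it. *)
Definition zero_ext (f : R * R -> R) := f \_ Omega.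

Let zero_ext_off f z : ~ Omega z -> zero_ext f z = 0.
Proof. by move=> Oz; rewrite /zero_ext patchE memNset. Qed.

Let zero_ext_in f z : Omega z -> zero_ext f z = f z.
Proof. by move=> Oz; rewrite /zero_ext patchE mem_set. Qed.

Let near_in f z : Omega z -> \forall y \near z, f y = zero_ext f y.
Proof.
move=> Oz; have := open_nbhs_nbhs (conj open_Omega Oz); apply: filterS => y Oy.
by rewrite zero_ext_in.
Qed.

Let near_zero f z : (forall y, Omega y -> ~ K y -> f y = 0) -> ~ K z ->
  \forall y \near z, cst 0 y = zero_ext f y.
Proof.
move=> fK /near_off; apply: filterS => y Ky.
have [Oy|Oy] := pselect (Omega y); first by rewrite zero_ext_in// fK.
by rewrite zero_ext_off.
Qed.

Let continuous_zero_ext f : (forall z, Omega z -> {for z, continuous f}) ->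
  (forall y, Omega y -> ~ K y -> f y = 0) -> continuous (zero_ext f).
Proof.
move=> cf fK z; have [Kz|Kz] := pselect (K z).
  have Oz : Omega z by case: Kz.
  rewrite /continuous_at zero_ext_in//.
  apply: cvg_trans (cf z Oz); apply: near_eq_cvg.
  by have := near_in f Oz; apply: filterS.
have h := near_zero fK Kz; rewrite /continuous_at.
rewrite (_ : zero_ext f z = 0); last by rewrite -(nbhs_singleton h).
have c0 : (cst (0 : R) : R * R -> R) x @[x --> z] --> (0 : R) by exact: cvg_cst.
by apply: cvg_trans c0; apply: near_eq_cvg.
Qed.

Let derive_off v z : Omega z -> ~ K z -> 'D_v phi z = 0.
Proof.
move=> Oz Kz.
have h : \forall y \near z, phi y = cst 0 y.
  have h1 := near_zero phi_off Kz; have h2 := near_in phi Oz.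
  by apply: filterS2 h1 h2 => y -> ->.
by rewrite (near_eq_derive _ h) derive_cst.
Qed.

Let is_derive_ext v z : (forall z, Omega z -> derivable phi z v) ->
  is_derive z v (zero_ext phi) (zero_ext (fun z => 'D_v phi z) z).
Proof.
move=> dphi; have [Kz|Kz] := pselect (K z).
  have Oz : Omega z by case: Kz.
  rewrite zero_ext_in//; apply: near_eq_is_derive (near_in phi Oz) _.
  by apply: derivableP; exact: dphi.
rewrite (_ : zero_ext _ z = 0).
  apply: near_eq_is_derive (near_zero phi_off Kz) _; exact: is_derive_cst.
have [Oz|Oz] := pselect (Omega z); last by rewrite zero_ext_off.
by rewrite zero_ext_in// derive_off.
Qed.

Let regular : [/\ forall z, Omega z -> derivable phi z ((1, 0) : R * R),
   forall z, Omega z -> derivable phi z ((0, 1) : R * R),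
   forall z, Omega z -> {for z, continuous (dt phi)} &
   forall z, Omega z -> {for z, continuous (dx phi)}].
Proof. by case: tphi => /(_ 1%N) [_ [d1 d2 [c1 _] [c2 _]]] _; split. Qed.

Lemma test_ext_dt z : is_derive z ((1, 0) : R * R) (zero_ext phi) (zero_ext (dt phi) z).
Proof. by case: regular => d1 _ _ _; exact: is_derive_ext. Qed.

Lemma test_ext_dx z : is_derive z ((0, 1) : R * R) (zero_ext phi) (zero_ext (dx phi) z).
Proof. by case: regular => _ d2 _ _; exact: is_derive_ext. Qed.

Lemma continuous_ext_dt : continuous (zero_ext (dt phi)).
Proof. by case: regular => _ _ c1 _; apply: continuous_zero_ext => // z; exact: derive_off. Qed.

Lemma continuous_ext_dx : continuous (zero_ext (dx phi)).
Proof. by case: regular => _ _ _ c2; apply: continuous_zero_ext => // z; exact: derive_off. Qed.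

Lemma test_ext_support : exists S : R, 0 < S /\ forall z, ~ strip S z ->
  [/\ zero_ext phi z = 0, zero_ext (dt phi) z = 0 & zero_ext (dx phi) z = 0].
Proof.
have [M [_ /(_ (`|M| + 1))]] := compact_bounded cK.
have M1 : M < `|M| + 1 by rewrite (le_lt_trans (ler_norm M))// ltrDl.
move=> /(_ M1) KM; exists (`|M| + 2); split; first by rewrite ltr_wpDl.
move=> z zS; have Kz : ~ K z.
  move=> Kz; apply: zS; have [Oz _] := Kz; move: Oz; rewrite OmegaE => -[t0 x01].
  split; rewrite /= in_itv/= ?x01// t0/=.
  have := KM z Kz; rewrite /= prod_normE ge_max => /andP[h _].
  by move: h (ler_norm z.1); lra.
have [Oz|Oz] := pselect (Omega z); last by rewrite !zero_ext_off.
by rewrite !zero_ext_in// phi_off// /dt /dx !derive_off.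
Qed.

Lemma continuous_zero_bounded (f : R * R -> R) : continuous (zero_ext f) ->
  (forall y, Omega y -> ~ K y -> f y = 0) ->
  exists B : R, forall z, `|zero_ext f z| <= B.
Proof.
move=> cf fK.
have cI : compact (zero_ext f @` K).
  by apply: continuous_compact => //; exact: continuous_subspaceT.
have [M [_ /(_ (`|M| + 1))]] := compact_bounded cI.
have M1 : M < `|M| + 1 by rewrite (le_lt_trans (ler_norm M))// ltrDl.
move=> /(_ M1) KM; exists (`|M| + 1) => z.
have [Kz|Kz] := pselect (K z); first by apply: KM; exists z.
have [Oz|Oz] := pselect (Omega z); last by rewrite zero_ext_off// normr0 addr_ge0.
by rewrite zero_ext_in// fK// normr0 addr_ge0.
Qed.

Lemma test_ext_bounded : exists B : R, forall z,
  `|zero_ext (dt phi) z| <= B /\ `|zero_ext (dx phi) z| <= B.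
Proof.
have [B1 h1] := continuous_zero_bounded continuous_ext_dt (@derive_off _).
have [B2 h2] := continuous_zero_bounded continuous_ext_dx (@derive_off _).
exists (Num.max B1 B2) => z; split; rewrite le_max; first by rewrite h1.
by rewrite h2 orbT.
Qed.

(** Chain rule along a characteristic, from continuous partial derivatives. *)
Lemma is_derive_along k s (x : R) :
  is_derive x 1 (fun y : R => zero_ext phi (s + k * y, y))
  (k * zero_ext (dt phi) (s + k * x, x) + zero_ext (dx phi) (s + k * x, x)).
Proof.
set g := zero_ext phi; set gt := zero_ext (dt phi); set gx := zero_ext (dx phi).
have dgt (t y : R) : is_derive t 1 (fun t => g (t, y)) (gt (t, y)).
  have := test_ext_dt (t, y); rewrite -/g -/gt => -[d e].
  have E : (fun h : R => h^-1 *: ((g \o shift (t, y)) (h *: ((1, 0) : R * R)) - g (t, y))) =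
     (fun h : R => h^-1 *: (((fun t => g (t, y)) \o shift t) (h *: (1 : R)) - g (t, y))).
    apply/funext => h /=; congr (_ *: (g _ - _)).
    by rewrite -[LHS]/(h * 1 + t, h * 0 + y) mulr0 add0r.
  by split; [rewrite /derivable -E|rewrite /derive -E].
have dgx (t y : R) : is_derive y 1 (fun y => g (t, y)) (gx (t, y)).
  have := test_ext_dx (t, y); rewrite -/g -/gx => -[d e].
  have E : (fun h : R => h^-1 *: ((g \o shift (t, y)) (h *: ((0, 1) : R * R)) - g (t, y))) =
     (fun h : R => h^-1 *: (((fun y => g (t, y)) \o shift y) (h *: (1 : R)) - g (t, y))).
    apply/funext => h /=; congr (_ *: (g _ - _)).
    by rewrite -[LHS]/(h * 0 + t, h * 1 + y) mulr0 add0r.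
  by split; [rewrite /derivable -E|rewrite /derive -E].
have cgt : continuous gt := continuous_ext_dt.
(* Split the increment: mean value theorem in [t] at fixed [h + x], difference
   quotient in [x]. *)
have mvt (h : R) : exists2 th : R, `|th| <= `|k * h| &
    g (s + k * (h + x), h + x) - g (s + k * x, h + x) =
    gt (s + k * x + th, h + x) * (k * h).
  have cg (y : R) (a b : R) : {within `[a, b], continuous (fun t => g (t, y))}.
    apply: continuous_subspaceT => t; apply: differentiable_continuous.
    by apply/derivable1_diffP; have [] := dgt t y.
  have [kh|kh] := leP 0 (k * h).
    have ab : s + k * x <= s + k * (h + x) by rewrite mulrDr; lra.
    have [c] := @MVT_segment R (fun t => g (t, h + x)) (fun t => gt (t, h + x)) _ _ ab
      (fun t _ => dgt t _) (cg _ _ _).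
    rewrite in_itv/= => /andP[c1 c2] ->; exists (c - (s + k * x)).
      by rewrite (ger0_norm kh) ger0_norm; lra.
    by congr (gt (_, _) * _); ring.
  have ab : s + k * (h + x) <= s + k * x by rewrite mulrDr; lra.
  have [c] := @MVT_segment R (fun t => g (t, h + x)) (fun t => gt (t, h + x)) _ _ ab
    (fun t _ => dgt t _) (cg _ _ _).
  rewrite in_itv/= => /andP[c1 c2] E; exists (c - (s + k * x)).
    by rewrite (ltr0_norm kh) ler0_norm; lra.
  rewrite -[LHS]opprB E -mulrN.
  by congr (gt (_, _) * _); ring.
have [th hth1 hth2] : exists2 th : R -> R, (forall h, `|th h| <= `|k * h|) &
    forall h, g (s + k * (h + x), h + x) - g (s + k * x, h + x) =
    gt (s + k * x + th h, h + x) * (k * h).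
  have /choice[th hth] : forall h : R, exists th : R, `|th| <= `|k * h| /\
    g (s + k * (h + x), h + x) - g (s + k * x, h + x) =
    gt (s + k * x + th, h + x) * (k * h).
    by move=> h; have [th h1 h2] := mvt h; exists th.
  by exists th => h; have [] := hth h.
have l0 : h @[h --> (0 : R)^'] --> (0 : R) by exact: cvg_within.
have kn0 : `|k| * `|h| @[h --> (0 : R)^'] --> (0 : R).
  rewrite -[X in _ --> X](mulr0 `|k|); apply: cvgM; first exact: cvg_cst.
  by rewrite -[X in _ --> X](@normr0 _ R); apply: cvg_norm; exact: l0.
have th0 : th h @[h --> (0 : R)^'] --> (0 : R).
  apply: (@squeeze_cvgr _ _ _ _ (fun h => - (`|k| * `|h|)) (fun h => `|k| * `|h|)).
  - by apply: nearW => h; rewrite -ler_norml -normrM.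
  - by rewrite -[X in _ --> X]oppr0; exact: cvgN.
  - exact: kn0.
have c1 : gt (s + k * x + th h, h + x) @[h --> (0 : R)^'] --> gt (s + k * x, x).
  have p : (s + k * x + th h, h + x) @[h --> (0 : R)^'] --> (s + k * x, x).
    have p1 : s + k * x + th h @[h --> (0 : R)^'] --> s + k * x.
      by rewrite -[X in _ --> X]addr0; apply: cvgD => //; exact: cvg_cst.
    have p2 : h + x @[h --> (0 : R)^'] --> x.
      by rewrite -[X in _ --> X]add0r; apply: cvgD => //; exact: cvg_cst.
    exact: (cvg_pair p1 p2).
  exact: (cvg_comp _ _ p (cgt (s + k * x, x))).
have [dx1 dx2] := dgx (s + k * x) x.
have c2 : h^-1 *: (g (s + k * x, h *: (1 : R) + x) - g (s + k * x, x)) @[h --> (0 : R)^'] -->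
    gx (s + k * x, x).
  by rewrite -dx2; exact: dx1.
have cc : h^-1 *: (g (s + k * (h *: (1 : R) + x), h *: (1 : R) + x) - g (s + k * x, x))
    @[h --> (0 : R)^'] --> k * gt (s + k * x, x) + gx (s + k * x, x).
  have c3 : k * gt (s + k * x + th h, h + x) @[h --> (0 : R)^'] --> k * gt (s + k * x, x).
    by apply: cvgM c1; exact: cvg_cst.
  have c4 : k * gt (s + k * x + th h, h + x) +
      h^-1 *: (g (s + k * x, h *: (1 : R) + x) - g (s + k * x, x)) @[h --> (0 : R)^'] -->
      k * gt (s + k * x, x) + gx (s + k * x, x) by exact: cvgD c3 c2.
  have nz : \forall h \near (0 : R)^', h != 0 by exact: nbhs_dnbhs_neq.
  have e : \forall h \near (0 : R)^', k * gt (s + k * x + th h, h + x) +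
      h^-1 *: (g (s + k * x, h *: (1 : R) + x) - g (s + k * x, x)) =
      h^-1 *: (g (s + k * (h *: (1 : R) + x), h *: (1 : R) + x) - g (s + k * x, x)).
    apply: filterS nz => h h0; rewrite -![_ *: _]/(_ * _) !mulr1.
    rewrite -[g (s + k * (h + x), h + x)](subrK (g (s + k * x, h + x))) hth2.
    by field.
  have c5 := near_eq_cvg e.
  by apply: cvg_trans c4; exact: c5.
split; first by apply/cvg_ex; eexists; exact: cc.
exact/cvg_lim.
Unshelve. all: by end_near. Qed.

End one_test_function.

End testfun.

(** * Travelling waves are weak solutions *)

Section wave.
Context {R : realType}.
Local Notation mu := (@lebesgue_measure R).
Local Notation mu2 := (@lebesgue2 R).
Local Notation T := (measurableTypeR R).
Local Notation T2 := (T * T)%type.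

Definition wave (k : R) (F : R -> R) (z : R * R) : R := F (z.1 - k * z.2).

Lemma measurable_wave k F : measurable_fun setT F ->
  measurable_fun (setT : set T2) (wave k F).
Proof.
move=> mF; apply: (measurableT_comp mF).
by apply: measurable_funB => //; apply: measurable_funM.
Qed.

(** After shearing, the strip is contained in a rectangle, where Tonelli
applies. *)
Lemma strip_integrable_wave k F : loc_int F -> strip_integrable (wave k F).
Proof.
move=> lF; have mF : measurable_fun setT F by case: lF.
have mw := measurable_wave k mF.
split=> // S.
have mS := measurable_strip S.
apply/integrableP; split.
  by apply/measurable_EFinP; exact: measurable_funTS.
(* Labels of points of the strip are at most this large. *)
pose A := `|S| + `|k|.
pose f : T2 -> \bar R := fun z => `|(EFin \o wave k F) z|%E.
have mf : measurable_fun (setT : set T2) f.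
  by apply: measurableT_comp => //; apply/measurable_EFinP.
have mfS : measurable_fun (setT : set T2) (f \_ (strip S)).
  exact: ((@measurable_restrictT _ _ _ _ _ f mS).1 (measurable_funTS mf)).
have pos z : (0 <= (f \_ (strip S)) z)%E by apply: erestrict_ge0 => ? _; exact: abse_ge0.
rewrite integral_mkcond (ge0_integral_preserving (preserving_shear k) mfS)//.
pose g1 : R -> \bar R := (fun s => `|(EFin \o F) s|%E) \_ `[- A, A].
pose g2 : R -> R := \1_(`[0, 1]%classic).
have mg1 : measurable_fun setT g1.
  apply/(measurable_restrictT _ _).1 => //; apply: measurableT_comp => //.
  by apply/measurable_EFinP; exact: measurable_funTS.
have g10 s : (0 <= g1 s)%E by apply: erestrict_ge0 => ? _; exact: abse_ge0.
apply: (@le_lt_trans _ _ (\int[mu2]_z (g1 z.1 * (g2 z.2)%:E))%E).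
  apply: ae_ge0_le_integral_nomeas => //.
    by move=> z _; rewrite mule_ge0// lee_fin.
  apply: aeW => z _; rewrite patchE; case: ifPn => [/set_mem[/=]|_]; last first.
    by rewrite mule_ge0// lee_fin.
  rewrite !in_itv/= => /andP[h1 h2] /andP[h3 h4].
  have -> : g2 z.2 = 1 by rewrite /g2 indicE mem_set//= in_itv/= !ltW.
  rewrite mule1 /g1 patchE mem_set/=; last first.
    rewrite in_itv/= -ler_norml /A.
    have := ler_norm S; have := ler_norm k; have := ler_norm (- k).
    rewrite normrN => ? ? ?; rewrite ler_norml; apply/andP; split; nra.
  by rewrite /f /wave/= addrK.
have mg12 : measurable_fun (setT : set T2) (fun z => g1 z.1 * (g2 z.2)%:E)%E.
  apply: emeasurable_funM; first exact: (measurableT_comp mg1 measurable_fst).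
  apply/measurable_EFinP; apply: (@measurableT_comp _ _ _ _ _ _ g2) => //.
  exact: measurable_indic.
rewrite (@fubini_tonelli1 _ _ _ _ _ mu mu _ mg12)//; last first.
  by move=> z; rewrite mule_ge0// lee_fin.
have I1 : (\int[mu]_x (g2 x)%:E = 1)%E.
  rewrite /g2 integral_indic// setIT.
  have h : mu `[0%R, 1%R]%classic = 1%E by rewrite lebesgue_measure_itv/= lte_fin ltr01 sube0.
  exact: h.
rewrite /fubini_F/=.
under eq_integral => s _.
  rewrite ge0_integralZl//; last 2 first.
  - apply/measurable_EFinP; exact: measurable_indic.
  - by move=> x _; rewrite lee_fin.
  rewrite I1 mule1; over.
rewrite /g1 -integral_mkcond.
by have /integrableP[_] := loc_intS (- A) A lF.
Qed.

(** After shearing, the inner integral is that of a total derivative along a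
characteristic, which vanishes because the test function does at both
ends. *)
Lemma weak_transport_wave k F : loc_int F -> weak_transport k (wave k F).
Proof.
move=> lF phi tphi.
have mF : measurable_fun setT F by case: lF.
set gt := zero_ext (dt phi); set gx := zero_ext (dx phi).
have cgt : continuous gt := continuous_ext_dt tphi.
have cgx : continuous gx := continuous_ext_dx tphi.
pose w z := wave k F z * (k * gt z + gx z).
have cG : continuous (fun z => k * gt z + gx z).
  by move=> z; apply: cvgD; [apply: cvgM; [exact: cvg_cst|exact: cgt]|exact: cgx].
have mw : measurable_fun (setT : set T2) w.
  by apply: measurable_funM; [exact: measurable_wave|exact: continuous_measurable2].
have [S [S0 offS]] := test_ext_support tphi.
have [B hB] := test_ext_bounded tphi.
have mS := measurable_strip S.
have iw : mu2.-integrable setT (EFin \o w).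
  have i1 : mu2.-integrable setT ((EFin \o wave k F) \_ (strip S)).
    by apply/(integrable_mkcond _ mS).1; case: (strip_integrable_wave k lF).
  apply: (le_integrable measurableT _ _ (integrableZl measurableT ((`|k| + 1) * `|B|) i1)).
    by apply/measurable_EFinP.
  move=> z _ /=; rewrite /w patchE; case: ifPn => [_|/negP zS]; last first.
    have [_ h1 h2] : [/\ zero_ext phi z = 0, gt z = 0 & gx z = 0].
      by apply: offS => zS'; apply: zS; exact: mem_set.
    by rewrite h1 h2 mulr0 addr0 mulr0 normr0; exact: abse_ge0.
  rewrite /= lee_fin !normrM mulrC ler_wpM2r//.
  rewrite (ger0_norm (addr_ge0 (normr_ge0 k) ler01)) normr_id.
  have [b1 b2] := hB z; have b3 := ler_norm B.
  rewrite (le_trans (ler_normD _ _))// normrM mulrDl mul1r lerD//.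
    by rewrite ler_wpM2l// (le_trans b1).
  by rewrite (le_trans b2).
rewrite integral_mkcond.
transitivity (\int[mu2]_z (w z)%:E)%E.
  apply: eq_integral => z _; rewrite patchE /w /gt /gx /zero_ext !patchE.
  by case: ifPn => // _; rewrite mulr0 addr0 mulr0.
rewrite (integral_preserving (preserving_shear k)); last by apply/measurable_EFinP.
have iws := integrable_preserving (preserving_shear k) iw.
rewrite -(@integral12_prod_meas1 _ _ _ _ _ mu mu _ iws).
rewrite integral0_eq// => s _; rewrite /fubini_F/=.
pose G x := k * gt (s + k * x, x) + gx (s + k * x, x).
have cline : continuous (fun x : R => (s + k * x, x)).
  move=> x; have p1 : s + k * y @[y --> x] --> s + k * x.
    by apply: cvgD; [exact: cvg_cst|apply: cvgM; [exact: cvg_cst|exact: cvg_id]].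
  have p2 : y @[y --> x] --> x by exact: cvg_id.
  exact: (cvg_pair p1 p2).
have cGs : continuous G.
  by move=> x; exact: (cvg_comp _ _ (cline x) (cG (s + k * x, x))).
have offG x : ~ (0 < x < 1) -> G x = 0.
  move=> x01; have off : ~ Omega (s + k * x, x) by rewrite OmegaE => -[].
  by rewrite /G /gt /gx /zero_ext !patchE memNset//= mulr0 addr0.
have dG (x : R) : is_derive x 1 (fun y : R => zero_ext phi (s + k * y, y)) (G x).
  exact: is_derive_along.
have FTC : (\int[mu]_(x in `[0%R, 1%R]) (G x)%:E = 0)%E.
  rewrite (@continuous_FTC2 R G (fun y : R => zero_ext phi (s + k * y, y)) 0 1)//.
  - have off0 (x : R) : ~ (0 < x < 1) -> zero_ext phi (s + k * x, x) = 0.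
      by move=> x01; rewrite /zero_ext patchE memNset// OmegaE => -[].
    by rewrite !off0 ?ltxx ?andbF// subee.
  - exact: continuous_subspaceT.
  - have cg : continuous (fun y : R => zero_ext phi (s + k * y, y)).
      move=> x; apply: differentiable_continuous; apply/derivable1_diffP.
      by have [] := dG x.
    split; [by move=> x _; have [] := dG x| |].
      by apply: cvg_at_right_filter; exact: cg.
    by apply: cvg_at_left_filter; exact: cg.
  - by move=> x _; rewrite derive1E; have [] := dG x.
under eq_integral => x _ do rewrite /w /wave /shear/= addrK -/(G x) EFinM.
have iG : mu.-integrable setT (EFin \o G).
  have i0 : mu.-integrable `[0, 1] (EFin \o G).
    apply: continuous_compact_integrable; first exact: segment_compact.
    exact: continuous_subspaceT.
  have := (@integrable_mkcond _ _ _ mu _ (EFin \o G) (measurable_itv _)).1 i0.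
  apply: eq_integrable => // x _.
  rewrite patchE; case: ifPn => //; rewrite notin_setE/= in_itv/= => /negP x01.
  rewrite offG// => /andP[? ?]; move/negP: x01; apply; lra.
rewrite integralZl// [X in (_ * X)%E](_ : _ = 0%E) ?mule0//.
rewrite -FTC [RHS]integral_mkcond; apply: eq_integral => x _.
rewrite patchE; case: ifPn => //; rewrite notin_setE/= in_itv/= => /negP x01.
rewrite offG// => /andP[? ?]; move/negP: x01; apply; lra.
Qed.

End wave.

(** * Borel representatives *)

Section Lp.
Context {R : realType}.
Local Notation mu := (@lebesgue_measure R).
Local Notation mu2 := (@lebesgue2 R).
Local Notation T := (measurableTypeR R).
Local Notation T2 := (T * T)%type.

Lemma lebesgue_setT_gt0 : (0 < mu setT)%E.
Proof.
apply: (@lt_le_trans _ _ (mu `[0, 1])).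
  by rewrite lebesgue_measure_itv/= lte_fin ltr01 sube0 lte_fin.
by apply: le_measure; rewrite ?inE//.
Qed.

(** Also for functions that are not measurable, as required by the slices of
functions in [L1loc_Lp]. *)
Lemma ae_eq_Lnorm (p : \bar R) (f g : R -> \bar R) :
  {ae mu, forall x, f x = g x} -> Lnorm mu p f = Lnorm mu p g.
Proof.
move=> fg; rewrite unlock; case: p => [r| |].
- congr (_ `^ _)%E; apply: ae_eq_integral_nomeas.
  by apply: ae_imply fg => x ->.
- case: ifPn => // _; apply: eq_ess_sup.
  by apply: ae_imply fg => x /= ->.
- case: ifPn => // _; apply: eq_ess_inf.
  by apply: ae_imply fg => x /= ->.
Qed.

Lemma ae_itvoo (a b : R) (P : R -> Prop) :
  {ae mu, forall x, a < x < b -> P x} -> {ae mu, forall x, a <= x <= b -> P x}.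
Proof.
move=> h; have h1 := ae_neq a; have h2 := ae_neq b.
apply: (ae_imply3 _ h1 h2 h).
move=> x xa xb hx /andP[ax xb']; apply: hx.
by rewrite !lt_neqAle ax xb' eq_sym xa xb.
Qed.

Lemma ae_eq_Lp_norm01 p (f g : R -> R) :
  {ae mu, forall x, 0 < x < 1 -> f x = g x} -> Lp_norm01 p f = Lp_norm01 p g.
Proof.
move=> /ae_itvoo fg; apply: ae_eq_Lnorm.
apply: ae_imply fg => x h.
rewrite /= !patchE; case: ifPn => // /set_mem/=; rewrite in_itv/= => /h ->.
by [].
Qed.

(** Hoelder's inequality on an interval of length one. *)
Lemma Lnorm1_le_Lp_norm01 p (f : R -> R) : (1 <= p)%E -> measurable_fun setT f ->
  (\int[mu]_(x in `[0%R, 1%R]) `|(f x)%:E| <= Lp_norm01 p f)%E.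
Proof.
move=> p1 mf; set f1 : R -> R := f \_ `[0, 1].
have mf1 : measurable_fun setT f1.
  apply: (@measurable_restrictT _ _ _ _ _ _ _).1; first exact: measurable_itv.
  exact: measurable_funTS.
have E : (\int[mu]_(x in `[0%R, 1%R]) `|(f x)%:E|)%E = Lnorm mu 1%:E (EFin \o f1).
  rewrite Lnorm1 [LHS]integral_mkcond; apply: eq_integral => x _.
  by rewrite /f1 /= !patchE; case: ifPn => //; rewrite normr0.
rewrite E /Lp_norm01 -/f1; case: p p1 => [r| |] // r1.
- have [->|r1'] := eqVneq r 1; first by [].
  have {}r1 : 1 < r by rewrite lt_neqAle eq_sym r1'; move: r1; rewrite lee_fin.
  have r0 : 0 < r by lra.
  pose q := (1 - r^-1)^-1.
  have rV : r^-1 < 1 by rewrite invf_lt1.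
  have q0 : 0 < q by rewrite invr_gt0 subr_gt0.
  have pq : r^-1 + q^-1 = 1 by rewrite /q invrK addrC subrK.
  pose I1 : R -> R := \1_(`[0, 1]%classic).
  have mI1 : measurable_fun setT I1 by exact: measurable_indic.
  have := hoelder mu mf1 mI1 r0 q0 pq.
  rewrite (_ : (f1 \* I1)%R = f1); last first.
    apply/funext => x; rewrite /f1 /I1 /= patchE indicE.
    by case: (boolP (x \in _)); rewrite ?mulr1 ?mulr0.
  rewrite [X in (_ * X)%E](_ : _ = 1%E) ?mule1//.
  have I1q : (\int[mu]_x (`|(EFin \o I1) x| `^ q) = 1)%E.
    transitivity (\int[mu]_x (I1 x)%:E)%E.
      apply: eq_integral => x _; rewrite /I1 /= indicE.
      by case: (x \in _); rewrite ?normr1 ?normr0 ?powR1 ?powR0// gt_eqF.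
    rewrite integral_indic// setIT.
    have h : mu `[0%R, 1%R]%classic = 1%E.
      by rewrite lebesgue_measure_itv/= lte_fin ltr01 sube0.
    exact: h.
  by rewrite unlock I1q poweR1r.
- rewrite -E unlock /Lnorm lebesgue_setT_gt0.
  set M := ess_sup _ _.
  apply: (@le_trans _ _ (\int[mu]_(x in `[0%R, 1%R]) M)%E).
    apply: ae_ge0_le_integral_nomeas => //.
    - move=> x _; apply: (@le_trans _ _ (ess_sup mu (cst 0%E))).
        by rewrite ess_sup_cst// lebesgue_setT_gt0.
      by apply: le_ess_sup; apply: aeW => y /=.
    - have := ess_sup_ge mu (abse \o (EFin \o f1)).
      apply: ae_imply => x + x01.
      by rewrite /f1 /= patchE mem_set.
  rewrite integral_cst//= lebesgue_measure_itv/= lte_fin ltr01 sube0 mule1.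
  exact: lexx.
Qed.

(** For almost every [t] the slices of the function and of its Borel
representative have the same norm, and the norm bounds the integral; Tonelli
concludes. *)
Lemma L1loc_Lp_strip p (h : R * R -> R) : (1 <= p)%E -> L1loc_Lp p h ->
  exists2 g : R * R -> R, strip_integrable g & ae_eq mu2 Omega h g.
Proof.
move=> p1 [[g0 mg0 hg0] hT].
pose g := g0 \_ Omega.
have mg : measurable_fun (setT : set T2) g.
  exact: ((@measurable_restrictT _ _ _ _ _ g0 measurable_Omega).1 mg0).
have hg : {ae mu2, forall z, Omega z -> h z = g z}.
  apply: ae_imply hg0 => z hz Oz.
  by rewrite hz// /g patchE mem_set.
exists g => //; split => // S.
have mS := measurable_strip S.
apply/integrableP; split.
  by apply/measurable_EFinP; exact: measurable_funTS.
(* The norms are controlled on [[0, S']] for positive [S'] only. *)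
pose S' := `|S| + 1.
have S'0 : 0 < S' by rewrite ltr_wpDl.
pose f : T2 -> \bar R := fun z => `|(EFin \o g) z|%E.
have mf : measurable_fun (setT : set T2) f.
  by apply: measurableT_comp => //; apply/measurable_EFinP.
have mfS : measurable_fun (setT : set T2) (f \_ (strip S)).
  exact: ((@measurable_restrictT _ _ _ _ _ f mS).1 (measurable_funTS mf)).
have pos z : (0 <= (f \_ (strip S)) z)%E by apply: erestrict_ge0 => ? _; exact: abse_ge0.
rewrite integral_mkcond (@fubini_tonelli1 _ _ _ _ _ mu mu _ mfS)//.
apply: le_lt_trans (hT S' S'0).
rewrite [leRHS]integral_mkcond.
apply: ae_ge0_le_integral_nomeas.
- by move=> t _; apply: integral_ge0.
- by move=> t _; apply: erestrict_ge0 => s _; exact: Lnorm_ge0.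
apply: ae_imply (ae_slice_t hg) => t ht _.
rewrite /fubini_F patchE; case: ifPn => [/set_mem/=|tS].
  rewrite in_itv/= => /andP[t0 tS].
  have [t0'|t0'] := eqVneq t 0.
    rewrite integral0_eq; first exact: Lnorm_ge0.
    by move=> x _; rewrite patchE memNset// => -[/=]; rewrite in_itv/= t0' ltxx.
  have tp : 0 < t by rewrite lt_neqAle eq_sym t0'.
  rewrite (_ : Lp_norm01 p (fun x => h (t, x)) = Lp_norm01 p (fun x => g (t, x))); last first.
    apply: ae_eq_Lp_norm01.
    apply: ae_imply ht => x hx x01.
    by apply: hx; rewrite OmegaE.
  apply: le_trans (Lnorm1_le_Lp_norm01 p1 _); last first.
    exact: (measurableT_comp mg (pair1_measurable t)).
  rewrite [leRHS]integral_mkcond.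
  apply: ae_ge0_le_integral_nomeas => //.
    by move=> x _; apply: erestrict_ge0 => ? _; exact: abse_ge0.
  apply: aeW => x _; rewrite !patchE; case: ifPn => [/set_mem[/=]|_].
    by rewrite !in_itv/= => _ /andP[x0 x1]; rewrite mem_set//= in_itv/= !ltW.
  by case: ifPn => // _; exact: abse_ge0.
rewrite integral0_eq// => x _; rewrite patchE memNset// => -[/=].
rewrite !in_itv/= => /andP[t0 tS'] _; move: tS; rewrite notin_setE/= in_itv/=; apply.
by rewrite ltW// ltW// (lt_trans tS')// /S' (le_lt_trans (ler_norm S))// ltrDl.
Qed.

End Lp.

(** * Pairings with test functions, averages along lines *)

Section pairing.
Context {R : realType}.
Local Notation mu := (@lebesgue_measure R).
Local Notation mu2 := (@lebesgue2 R).
Local Notation T := (measurableTypeR R).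
Local Notation T2 := (T * T)%type.
Implicit Types (g h D phi : R * R -> R).

Lemma strip_integrable_lin (a b : R) g h : strip_integrable g ->
  strip_integrable h -> strip_integrable (fun z => a * g z + b * h z).
Proof.
move=> [mg ig] [mh ih]; split=> [|S].
  by apply: measurable_funD; apply: measurable_funM.
have mS := measurable_strip S.
have := integrableD mS (integrableZl mS a (ig S)) (integrableZl mS b (ih S)).
by apply: eq_integrable.
Qed.

(** The pairing of [g] with a derivative of a test function, as a real number on
the whole plane: it is linear in [g], while the integrals of the weak equations
are not obviously so. *)
Definition pair_with g D : R := \int[mu2]_z (g z * zero_ext D z).

Lemma integrable_pairing g phi D : test_function phi -> D = dt phi \/ D = dx phi ->
  strip_integrable g ->
  mu2.-integrable setT (EFin \o (fun z => g z * zero_ext D z)).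
Proof.
move=> tphi DE [mg ig].
have cD : continuous (zero_ext D).
  by case: DE => ->; [exact: continuous_ext_dt|exact: continuous_ext_dx].
have [S [S0 offS]] := test_ext_support tphi.
have [B hB] := test_ext_bounded tphi.
have mS := measurable_strip S.
have i1 : mu2.-integrable setT ((EFin \o g) \_ (strip S)).
  by apply/(integrable_mkcond _ mS).1.
apply: (le_integrable measurableT _ _ (integrableZl measurableT `|B| i1)).
  apply/measurable_EFinP; apply: measurable_funM => //.
  exact: continuous_measurable2.
move=> z _ /=; rewrite patchE; case: ifPn => [_|/negP zS]; last first.
  have -> : zero_ext D z = 0.
    have [|_ h1 h2] := offS z; first by move=> zS'; apply: zS; exact: mem_set.
    by case: DE => ->.
  by rewrite mulr0 normr0; exact: abse_ge0.
rewrite /= lee_fin !normrM mulrC normr_id ler_wpM2r//.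
have [b1 b2] := hB z; have b3 := ler_norm B.
by case: DE => ->; [rewrite (le_trans b1)|rewrite (le_trans b2)].
Qed.

Lemma pair_with_lin phi D a b g h : test_function phi ->
  D = dt phi \/ D = dx phi -> strip_integrable g -> strip_integrable h ->
  pair_with (fun z => a * g z + b * h z) D = a * pair_with g D + b * pair_with h D.
Proof.
move=> tphi DE ig ih.
have i1 := integrable_pairing tphi DE ig; have i2 := integrable_pairing tphi DE ih.
rewrite /pair_with -!RintegralZl// -RintegralD//.
- by apply: eq_Rintegral => z _; ring.
- by apply: eq_integrable (integrableZl measurableT a i1).
- by apply: eq_integrable (integrableZl measurableT b i2).
Qed.

(** Both weak telegrapher's equations are of this form. *)
Lemma integral_pairing phi c (h1 h2 g1 g2 : R * R -> R) : test_function phi ->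
  strip_integrable g1 -> strip_integrable g2 ->
  ae_eq mu2 Omega h1 g1 -> ae_eq mu2 Omega h2 g2 ->
  (\int[mu2]_(z in Omega) (c * h1 z * dt phi z + h2 z * dx phi z)%:E =
   (c * pair_with g1 (dt phi) + pair_with g2 (dx phi))%:E)%E.
Proof.
move=> tphi ig1 ig2 e1 e2.
have i1 := integrable_pairing tphi (or_introl erefl) ig1.
have i2 := integrable_pairing tphi (or_intror erefl) ig2.
pose w1 (z : R * R) : R := g1 z * zero_ext (dt phi) z.
pose w2 (z : R * R) : R := g2 z * zero_ext (dx phi) z.
have i1c : mu2.-integrable setT (EFin \o (fun z => c * w1 z)).
  by apply: eq_integrable (integrableZl measurableT c i1).
have iw : mu2.-integrable setT (EFin \o (fun z => c * w1 z + w2 z)).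
  by apply: eq_integrable (integrableD measurableT i1c i2).
rewrite integral_mkcond.
transitivity (\int[mu2]_z (c * w1 z + w2 z)%:E)%E.
  apply: ae_eq_integral_nomeas.
  apply: (ae_imply2 _ e1 e2).
  move=> z h1z h2z _; rewrite patchE /w1 /w2 /zero_ext/= !patchE.
  case: ifPn => [/set_mem Oz|_]; last by rewrite !mulr0 addr0.
  by rewrite h1z// h2z// mulrA.
rewrite -(fineK (integrable_fin_num measurableT iw)); congr EFin.
apply: (etrans (@RintegralD _ _ _ mu2 setT _ _ measurableT i1c i2)).
by congr (_ + _); exact: (@RintegralZl _ _ _ mu2 setT _ c measurableT i1).
Qed.

Lemma weak_transportE k g : strip_integrable g ->
  weak_transport k g <-> (forall phi, test_function phi ->
    k * pair_with g (dt phi) + pair_with g (dx phi) = 0).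
Proof.
move=> ig; have E phi : test_function phi ->
   (\int[mu2]_(z in Omega) (g z * (k * dt phi z + dx phi z))%:E =
    (k * pair_with g (dt phi) + pair_with g (dx phi))%:E)%E.
  move=> tphi; rewrite -(@integral_pairing phi k g g g g)//; last 2 first.
  - exact: ae_eq_refl.
  - exact: ae_eq_refl.
  by apply: eq_integral => z _; congr EFin; ring.
split=> h phi tphi; have := E _ tphi.
  by rewrite h// => -[].
by move=> ->; rewrite h.
Qed.

End pairing.

Section line_average.
Context {R : realType}.
Local Notation mu := (@lebesgue_measure R).
Local Notation mu2 := (@lebesgue2 R).
Local Notation T := (measurableTypeR R).
Local Notation T2 := (T * T)%type.

Definition line_avg (f : R -> R) (e : R) : R := e^-1 * \int[mu]_(s in `[0, e]) f s.

(** The linear combination is taken under the integral for small [e] only, where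
integrability on [[0, c]] suffices. *)
Lemma line_avg_lin (f g : R -> R) (a b c l m : R) : 0 < c ->
  mu.-integrable `[0, c] (EFin \o f) -> mu.-integrable `[0, c] (EFin \o g) ->
  line_avg f e @[e --> 0^'+] --> l -> line_avg g e @[e --> 0^'+] --> m ->
  line_avg (fun s => a * f s + b * g s) e @[e --> 0^'+] --> a * l + b * m.
Proof.
move=> c0 jf jg fl gm.
have h : a * line_avg f e + b * line_avg g e @[e --> 0^'+] --> a * l + b * m.
  by apply: cvgD; (apply: cvgM; first exact: cvg_cst).
apply: cvg_trans h; apply: near_eq_cvg; near=> e.
have ec : e <= c by near: e; exact: nbhs_right_le.
have sub : `[0, e] `<=` `[0, c].
  by move=> s /=; rewrite !in_itv/= => /andP[-> /le_trans]; apply.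
have jf' : mu.-integrable `[0, e] (EFin \o f) by apply: integrableS jf.
have jg' : mu.-integrable `[0, e] (EFin \o g) by apply: integrableS jg.
rewrite /line_avg.
rewrite (@RintegralD _ _ _ mu)//.
- rewrite !(@RintegralZl _ _ _ mu)//; ring.
- by apply: eq_integrable (@integrableZl _ _ _ mu _ (measurable_itv _) a _ jf').
- by apply: eq_integrable (@integrableZl _ _ _ mu _ (measurable_itv _) b _ jg').
Unshelve. all: by end_near. Qed.

Variables (h g : R * R -> R).
Hypotheses (ig : strip_integrable g) (hg : ae_eq mu2 Omega h g).

Let mg : measurable_fun (setT : set T2) g. Proof. by case: ig. Qed.

Let igS n : mu2.-integrable setT ((EFin \o g) \_ (strip n%:R)).
Proof.
have mS := measurable_strip (n%:R : R).
by apply/(integrable_mkcond _ mS).1; case: ig.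
Qed.

Lemma ae_row_integrable :
  {ae mu, forall t, 0 < t -> mu.-integrable `[0, 1] (fun x => (g (t, x))%:E)}.
Proof.
have H n := @ae_integrable1 _ _ _ _ _ mu mu _ (igS n).
have := ae_foralln H; apply: ae_imply => t ht t0.
have [n tn] : exists n : nat, t < n%:R.
  exists (Num.bound `|t|); apply: le_lt_trans (ler_norm _) _; exact: (@archi_boundP R).
have i1 := ht n.
have i2 : mu.-integrable `]0, 1[ (fun x => (g (t, x))%:E).
  have i3 : mu.-integrable `]0, 1[ (fun y => ((EFin \o g) \_ (strip n%:R)) (t, y)).
    by apply: integrableS i1.
  apply: eq_integrable i3; first exact: measurable_itv.
  by move=> x xI; rewrite patchE mem_set//; split => /=; [rewrite in_itv/= t0 tn|exact/set_mem].
apply/integrableP; split.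
  apply/measurable_EFinP; apply: measurable_funTS.
  exact: (measurableT_comp mg (pair1_measurable t)).
case/integrableP : i2 => m2 l2.
rewrite integral_itv_bndoo//; exact: measurableT_comp.
Qed.

Lemma ae_column_integrable :
  {ae mu, forall x, 0 < x < 1 -> mu.-integrable `[0, 1] (fun t => (g (t, x))%:E)}.
Proof.
have := @ae_integrable2 _ _ _ _ _ mu mu _ (igS 2).
apply: ae_imply => x i1 x01.
have i2 : mu.-integrable `]0, 1[ (fun t => (g (t, x))%:E).
  have i3 : mu.-integrable `]0, 1[ (fun y => ((EFin \o g) \_ (strip 2%:R)) (y, x)).
    by apply: integrableS i1.
  apply: eq_integrable i3; first exact: measurable_itv.
  move=> t; rewrite inE/= in_itv/= => /andP[t0 t1].
  rewrite patchE mem_set//; split => /=; rewrite in_itv/= ?x01// t0/=; lra.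
apply/integrableP; split.
  apply/measurable_EFinP; apply: measurable_funTS.
  exact: (measurableT_comp mg (pair2_measurable x)).
case/integrableP : i2 => m2 l2.
rewrite integral_itv_bndoo//; exact: measurableT_comp.
Qed.

Lemma integrable_reflect (f : R -> R) : measurable_fun setT f ->
  mu.-integrable `[0, 1] (EFin \o f) ->
  mu.-integrable `[0, 1] (EFin \o (fun y => f (1 - y))).
Proof.
move=> mf jf; apply/integrableP; split.
  apply/measurable_EFinP; apply: measurable_funTS.
  have := measurable_line (-1) 1 mf; apply: eq_measurable_fun => y _.
  by rewrite mulN1r addrC.
have /integrableP[_] := jf; rewrite integral_mkcond => jf'.
rewrite integral_mkcond; apply: le_lt_trans jf'.
have := @le_integral_affine _ (-1) 1
   ((fun y => `|(EFin \o (fun y => f (1 - y)%R)) y|%E) \_ `[0, 1])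
   ((fun y => `|(EFin \o f) y|%E) \_ `[0, 1]).
rewrite normrN normr1 mul1e; apply => //.
- apply/(measurable_restrictT _ _).1 => //; apply: measurableT_comp => //.
  by apply/measurable_EFinP; exact: measurable_funTS.
- by move=> x; apply: erestrict_ge0 => ? _; exact: abse_ge0.
- by move=> x; apply: erestrict_ge0 => ? _; exact: abse_ge0.
- move=> r; rewrite !patchE; case: ifPn => [/set_mem/=|_]; last first.
    by case: ifPn => // _; exact: abse_ge0.
  rewrite in_itv/= => /andP[r0 r1]; rewrite mem_set/=; last by rewrite in_itv/=; apply/andP; split; lra.
  by rewrite mulN1r (addrC (- r)).
Qed.

Lemma avg_x0_line : {ae mu, forall t, 0 < t ->
  \forall e \near 0^'+, avg_x0 h t e = line_avg (fun x => g (t, x)) e}.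
Proof.
apply: ae_imply (ae_slice_t hg) => t ht t0.
apply: (avg_ae_eq ltr01).
by apply: ae_imply ht => x hx x01; apply: hx.
Qed.

Lemma avg_t0_line : {ae mu, forall x, 0 < x < 1 ->
  \forall e \near 0^'+, avg_t0 h x e = line_avg (fun t => g (t, x)) e}.
Proof.
apply: ae_imply (ae_slice_x hg) => x hx x01.
apply: (avg_ae_eq ltr01).
apply: ae_imply hx => t ht /andP[t0 t1].
by apply: ht.
Qed.

(** Averages at the end [x = 1] are turned into averages at [0] by reflection. *)
Lemma avg_x1_line : {ae mu, forall t, 0 < t ->
  \forall e \near 0^'+, avg_x1 h t e = line_avg (fun x => g (t, 1 - x)) e}.
Proof.
apply: ae_imply (ae_slice_t hg) => t ht t0.
near=> e.
have e0 : 0 < e by near: e; exact: nbhs_right_gt.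
have e1 : e < 1 by near: e; exact: nbhs_right_lt.
rewrite /avg_x1 /line_avg; congr (_ * _).
transitivity (\int[mu]_(s in `[1 - e, 1]) g (t, s)).
  apply: ae_eq_Rintegral.
  apply: (ae_imply2 _ (ae_neq 1) ht).
  move=> x x1 hx /=; rewrite in_itv/= => /andP[ex x1']; apply: hx.
  by split => //=; rewrite (lt_le_trans _ ex) ?subr_gt0//= lt_neqAle x1.
have mgt : measurable_fun setT (fun x => g (t, x)).
  exact: (measurableT_comp mg (pair1_measurable t)).
rewrite Rintegral_mkcond [RHS]Rintegral_mkcond /Rintegral.
rewrite (@integral_affine _ (-1) 1).
- rewrite normrN normr1 mul1e; congr fine; apply: eq_integral => x _.
  congr EFin; rewrite !patchE mulN1r (addrC (- x)).
  have -> : (1 - x \in `[(1 - e), 1]%classic) = (x \in `[0, e]%classic).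
    by apply/idP/idP => /set_mem/=; rewrite in_itv/= => /andP[? ?];
      apply/mem_set; rewrite /= in_itv/=; apply/andP; split; lra.
  by [].
- by rewrite oppr_eq0 oner_neq0.
- apply/measurable_EFinP; apply/(measurable_restrictT _ _).1 => //.
  exact: measurable_funTS.
Unshelve. all: by end_near. Qed.

End line_average.

(** * Coercivity and the difference of two solutions *)

Section coercivity.
Context {R : realType}.

(** The quadratic form of [A^T] equals that of [A]. *)
Lemma loewner_le_quadratic n (A : 'M[R]_n) (alpha : R) (y : 'cV[R]_n) :
  loewner_le (alpha%:M) (A + A^T) ->
  alpha * \sum_j y j 0 ^+ 2 <= 2 * \sum_j y j 0 * (A *m y) j 0.
Proof.
move=> /(_ y) h; rewrite -subr_ge0; move: h; congr (_ <= _).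
rewrite mulmxBr mulmxBl mulmxDr mulmxDl.
have -> : y^T *m A^T *m y = (y^T *m A *m y)^T.
  by rewrite !trmx_mul trmxK mulmxA.
rewrite mul_mx_scalar -scalemxAl !mxE; congr (_ - _ * _).
  rewrite mulr2n mulrDl mul1r.
  have E : \sum_j (y^T *m A) 0 j * y j 0 = \sum_j y j 0 * (A *m y) j 0.
    transitivity ((y^T *m A *m y) 0 0); first by rewrite mxE.
    by rewrite -mulmxA mxE; apply: eq_bigr => j _; rewrite !mxE.
  by rewrite E.
by apply: eq_bigr => j _; rewrite !mxE expr2.
Qed.

(** A strictly dissipative load cannot balance a coercive one: the pairing of [y]
with [A y] would be both nonnegative and nonpositive. *)
Lemma coercive_dissipation n (A : 'M[R]_n) (alpha : R) (z : 'I_n -> R) (y : 'cV[R]_n) :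
  0 < alpha -> loewner_le (alpha%:M) (A + A^T) -> (forall j, 0 < z j) ->
  (forall j, z j * y j 0 = - (A *m y) j 0) -> y = 0.
Proof.
move=> a0 /(@loewner_le_quadratic _ _ _ y) h z0 zy.
have : 0 <= \sum_j z j * y j 0 ^+ 2.
  by apply: sumr_ge0 => j _; rewrite mulr_ge0 ?sqr_ge0// ltW.
have <- : - (\sum_j y j 0 * (A *m y) j 0) = \sum_j z j * y j 0 ^+ 2.
  rewrite -sumrN; apply: eq_bigr => j _.
  by rewrite -mulrN -zy expr2 mulrCA.
move=> h1; have s0 : 0 <= \sum_j y j 0 ^+ 2 by apply: sumr_ge0 => j _; exact: sqr_ge0.
have h3 : \sum_j y j 0 ^+ 2 = 0.
  apply/eqP; rewrite eq_le s0 andbT.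
  by rewrite -(pmulr_rle0 _ a0); lra.
have /psumr_eq0P h4 := h3.
apply/matrixP => j l; rewrite (ord1 l) mxE.
by apply/eqP; rewrite -sqrf_eq0; apply/eqP/h4 => // i _; exact: sqr_ge0.
Qed.

End coercivity.

Section difference.
Context {R : realType} {N : nat}.
Local Notation mu := (@lebesgue_measure R).
Local Notation mu2 := (@lebesgue2 R).
Local Notation T := (measurableTypeR R).
Variables (L C : 'I_N -> R) (p : \bar R) (A : R -> 'M[R]_(N + N)).
Variables (v0 i0 : 'I_N -> R -> R).
Hypothesis (hp : (1 <= p)%E).

Let traces (h g : R * R -> R) (h0 : R -> R) :=
  [/\ strip_integrable g, ae_eq mu2 Omega h g,
    {ae mu, forall x, 0 < x < 1 -> line_avg (fun t => g (t, x)) e @[e --> 0^'+] --> h0 x},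
    {ae mu, forall t, 0 < t -> line_avg (fun x => g (t, x)) e @[e --> 0^'+] --> hat_x0 h t} &
    {ae mu, forall t, 0 < t -> line_avg (fun x => g (t, 1 - x)) e @[e --> 0^'+] --> hat_x1 h t}].

Let traces_exist h h0 : L1loc_Lp p h -> strict_extension h ->
  {ae mu, forall x, 0 < x < 1 -> hat_t0 h x = h0 x} ->
  exists g, traces h g h0.
Proof.
move=> lh [s0 s1 st] hh; have [g ig hg] := L1loc_Lp_strip hp lh.
exists g; split; [exact: ig|exact: hg| | |].
- have := avg_t0_line hg; move: st.
  apply: (ae_imply3 _ hh).
  move=> x hx cx lx x01; rewrite -hx//.
  by apply: cvg_trans (cx x01); apply: near_eq_cvg; apply: filterS (lx x01) => e ->.
- have := avg_x0_line hg; move: s0.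
  apply: ae_imply2 => x cx lx x01.
  by apply: cvg_trans (cx x01); apply: near_eq_cvg; apply: filterS (lx x01) => e ->.
- have := avg_x1_line ig hg; move: s1.
  apply: ae_imply2 => x cx lx x01.
  by apply: cvg_trans (cx x01); apply: near_eq_cvg; apply: filterS (lx x01) => e ->.
Qed.

Let lineB (g g' : R -> R) l m : mu.-integrable `[0, 1] (EFin \o g) ->
  mu.-integrable `[0, 1] (EFin \o g') ->
  line_avg g e @[e --> 0^'+] --> l -> line_avg g' e @[e --> 0^'+] --> m ->
  line_avg (fun s => g s - g' s) e @[e --> 0^'+] --> l - m.
Proof.
move=> j j' gl gm; have := @line_avg_lin _ _ _ 1 (-1) 1 l m ltr01 j j' gl gm.
have -> : (fun s => 1 * g s + -1 * g' s) = (fun s => g s - g' s).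
  by apply/funext => s; rewrite mul1r mulN1r.
by rewrite mul1r mulN1r.
Qed.

Let tracesB h g h' g' h0 : traces h g h0 -> traces h' g' h0 ->
  [/\ strip_integrable (fun z => g z - g' z),
    ae_eq mu2 Omega (fun z => h z - h' z) (fun z => g z - g' z),
    {ae mu, forall x, 0 < x < 1 -> line_avg (fun t => g (t, x) - g' (t, x)) e @[e --> 0^'+] --> (0 : R)},
    {ae mu, forall t, 0 < t -> line_avg (fun x => g (t, x) - g' (t, x)) e @[e --> 0^'+] -->
       hat_x0 h t - hat_x0 h' t} &
    {ae mu, forall t, 0 < t -> line_avg (fun x => g (t, 1 - x) - g' (t, 1 - x)) e @[e --> 0^'+] -->
       hat_x1 h t - hat_x1 h' t}].
Proof.
move=> [ig hg t0 x0 x1] [ig' hg' t0' x0' x1'].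
have mrow (g1 : R * R -> R) t : strip_integrable g1 -> measurable_fun setT (fun x => g1 (t, x)).
  by move=> [mg _]; exact: (measurableT_comp mg (pair1_measurable t)).
split.
- have := strip_integrable_lin 1 (-1) ig ig'; congr strip_integrable.
  by apply/funext => z; rewrite mul1r mulN1r.
- apply: (ae_imply2 _ hg hg') => z hz hz' Oz.
  by rewrite hz// hz'.
- apply: (ae_imply4 _ t0 t0' (ae_column_integrable ig) (ae_column_integrable ig')).
  move=> x cx cx' j j' x01.
  by have := lineB (j x01) (j' x01) (cx x01) (cx' x01); rewrite subrr.
- apply: (ae_imply4 _ x0 x0' (ae_row_integrable ig) (ae_row_integrable ig')).
  by move=> t cx cx' j j' tp; exact: lineB (j tp) (j' tp) (cx tp) (cx' tp).
- apply: (ae_imply4 _ x1 x1' (ae_row_integrable ig) (ae_row_integrable ig')).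
  move=> t cx cx' j j' tp; apply: lineB (cx tp) (cx' tp).
    by apply: (@integrable_reflect _ (fun x => g (t, x))); [exact: mrow|exact: j].
  by apply: (@integrable_reflect _ (fun x => g' (t, x))); [exact: mrow|exact: j'].
Qed.

(** Passing to Borel representatives makes all quantities linear, so that two
solutions can be subtracted: equations, initial traces and boundary traces. *)
Lemma solution_difference v i v' i' :
  telegrapher_solution L C p A v0 i0 v i ->
  telegrapher_solution L C p A v0 i0 v' i' ->
  forall k, exists dv di : R * R -> R,
  [/\ strip_integrable dv /\ strip_integrable di,
    ae_eq mu2 Omega (fun z => v k z - v' k z) dv /\
    ae_eq mu2 Omega (fun z => i k z - i' k z) di,
    forall phi, test_function phi ->
      L k * pair_with di (dt phi) + pair_with dv (dx phi) = 0 /\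
      C k * pair_with dv (dt phi) + pair_with di (dx phi) = 0,
    {ae mu, forall x, 0 < x < 1 ->
      (line_avg (fun t => dv (t, x)) e @[e --> 0^'+] --> (0 : R)) /\
      (line_avg (fun t => di (t, x)) e @[e --> 0^'+] --> (0 : R))} &
    {ae mu, forall t, 0 < t ->
      [/\ line_avg (fun x => dv (t, x)) e @[e --> 0^'+] --> hat_x0 (v k) t - hat_x0 (v' k) t,
          line_avg (fun x => di (t, x)) e @[e --> 0^'+] --> hat_x0 (i k) t - hat_x0 (i' k) t,
          line_avg (fun x => dv (t, 1 - x)) e @[e --> 0^'+] --> hat_x1 (v k) t - hat_x1 (v' k) t &
          line_avg (fun x => di (t, 1 - x)) e @[e --> 0^'+] --> hat_x1 (i k) t - hat_x1 (i' k) t]}].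
Proof.
move=> [lp st ini eqi eqv _] [lp' st' ini' eqi' eqv' _] k.
have fst_ae (P Q : R -> Prop) : {ae mu, forall x, 0 < x < 1 -> P x /\ Q x} ->
    {ae mu, forall x, 0 < x < 1 -> P x}.
  by apply: ae_imply => x h /h[].
have snd_ae (P Q : R -> Prop) : {ae mu, forall x, 0 < x < 1 -> P x /\ Q x} ->
    {ae mu, forall x, 0 < x < 1 -> Q x}.
  by apply: ae_imply => x h /h[].
have [gv tv] := traces_exist (lp k).1 (st k).1 (fst_ae _ _ (ini k)).
have [gi ti] := traces_exist (lp k).2 (st k).2 (snd_ae _ _ (ini k)).
have [gv' tv'] := traces_exist (lp' k).1 (st' k).1 (fst_ae _ _ (ini' k)).
have [gi' ti'] := traces_exist (lp' k).2 (st' k).2 (snd_ae _ _ (ini' k)).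
have [dv1 dv2 dv3 dv4 dv5] := tracesB tv tv'.
have [di1 di2 di3 di4 di5] := tracesB ti ti'.
exists (fun z => gv z - gv' z), (fun z => gi z - gi' z); split.
- by split; [exact: dv1|exact: di1].
- by split; [exact: dv2|exact: di2].
- case: tv tv' ti ti' => [igv ev _ _ _] [igv' ev' _ _ _] [igi ei _ _ _] [igi' ei' _ _ _] phi tphi.
  have pB D g g' : D = dt phi \/ D = dx phi -> strip_integrable g -> strip_integrable g' ->
      pair_with (fun z => g z - g' z) D = pair_with g D - pair_with g' D.
    move=> DE ig ig'; rewrite -[LHS]/(pair_with _ _).
    have := pair_with_lin 1 (-1) tphi DE ig ig'; rewrite mul1r mulN1r => <-.
    by congr pair_with; apply/funext => z; rewrite mul1r mulN1r.
  have [Dt Dx] : (dt phi = dt phi \/ dt phi = dx phi) /\ (dx phi = dt phi \/ dx phi = dx phi).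
    by split; [left|right].
  rewrite (pB _ _ _ Dt igi igi') (pB _ _ _ Dx igv igv').
  rewrite (pB _ _ _ Dt igv igv') (pB _ _ _ Dx igi igi').
  move: (eqi k phi tphi) (eqv k phi tphi) (eqi' k phi tphi) (eqv' k phi tphi).
  rewrite (integral_pairing _ tphi igi igv ei ev) (integral_pairing _ tphi igv igi ev ei).
  rewrite (integral_pairing _ tphi igi' igv' ei' ev') (integral_pairing _ tphi igv' igi' ev' ei').
  have lin (l a b c d : R) : l * a + c = 0 -> l * b + d = 0 ->
    l * (a - b) + (c - d) = 0 by move=> h h'; lra.
  move=> [h1] [h2] [h3] [h4].
  by split; [exact: lin h1 h3|exact: lin h2 h4].
- by apply: (ae_imply2 _ dv3 di3) => x h1 h2 x01; split; [exact: h1|exact: h2].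
- apply: (ae_imply4 _ dv4 di4 dv5 di5) => t h1 h2 h3 h4 tp.
  by split; [exact: h1|exact: h2|exact: h3|exact: h4].
Qed.

End difference.

(** * The two waves of a difference *)

Section waves.
Context {R : realType}.
Local Notation mu := (@lebesgue_measure R).
Local Notation mu2 := (@lebesgue2 R).
Local Notation T := (measurableTypeR R).

Lemma line_avg_two_waves (F G u : R -> R) (k k' s s' a b : R) :
  loc_int F -> loc_int G -> lebesgue_pt F s -> lebesgue_pt G s' ->
  {ae mu, forall x, 0 < x < 1 -> u x = a * F (k * x + s) + b * G (k' * x + s')} ->
  line_avg u e @[e --> 0^'+] --> a * F s + b * G s'.
Proof.
move=> lF lG Fs Gs uE.
have key (H : R -> R) q r : loc_int H ->
    mu.-integrable `[0, 1] (EFin \o (fun x => H (q * x + r))).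
  move=> lH; have [q0|q0] := eqVneq q 0; last exact: (loc_intS 0 1 (loc_int_affine r q0 lH)).
  have hc : mu.-integrable `[0, 1] (EFin \o cst (H r)).
    apply: continuous_compact_integrable; first exact: segment_compact.
    by apply: continuous_subspaceT => x; exact: cst_continuous.
  apply: (@eq_integrable _ _ _ mu _ (measurable_itv _) _ _ _ hc) => x _.
  by rewrite /= q0 mul0r add0r.
have h := @line_avg_lin _ _ _ a b 1 _ _ ltr01 (key _ _ _ lF) (key _ _ _ lG)
  (avg_cvg k lF Fs) (avg_cvg k' lG Gs).
apply: cvg_trans h; apply: near_eq_cvg.
have h := avg_ae_eq ltr01 uE.
by apply: filterS h => e he; rewrite /line_avg he.
Qed.

Lemma sqrt_impedance (l c : R) : 0 < l -> 0 < c ->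
  [/\ 0 < Num.sqrt (l * c), 0 < Num.sqrt (l / c),
      l = Num.sqrt (l * c) * Num.sqrt (l / c) &
      c = Num.sqrt (l * c) / Num.sqrt (l / c)].
Proof.
move=> l0 c0.
have lc : 0 < l * c by rewrite mulr_gt0.
have ld : 0 < l / c by rewrite divr_gt0.
have h1 : l = Num.sqrt (l * c) * Num.sqrt (l / c).
  rewrite -sqrtrM ?ltW// -[in RHS]mulrA [X in Num.sqrt (_ * X)]mulrC divfK ?gt_eqF//.
  by rewrite -expr2 sqrtr_sqr gtr0_norm.
split; rewrite ?sqrtr_gt0//.
have h : Num.sqrt (l / c) != 0 by rewrite gt_eqF ?sqrtr_gt0.
apply: (mulIf h); rewrite divfK//.
apply: (mulIf h); rewrite -h1 -mulrA -expr2 sqr_sqrtr ?ltW//.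
by rewrite mulrCA divff ?gt_eqF ?mulr1.
Qed.

(** [f] and [g] below are the two travelling components. The representation
theorem makes them waves, and the traces at both ends are read off at Lebesgue
points. *)
Lemma difference_waves (tau Z : R) (dv di : R * R -> R) (V0 I0 V1 I1 : R -> R) :
  0 < tau -> 0 < Z ->
  strip_integrable dv -> strip_integrable di ->
  (forall phi, test_function phi ->
      tau * Z * pair_with di (dt phi) + pair_with dv (dx phi) = 0 /\
      tau / Z * pair_with dv (dt phi) + pair_with di (dx phi) = 0) ->
  {ae mu, forall x, 0 < x < 1 ->
      (line_avg (fun t => dv (t, x)) e @[e --> 0^'+] --> (0 : R)) /\
      (line_avg (fun t => di (t, x)) e @[e --> 0^'+] --> (0 : R))} ->
  {ae mu, forall t, 0 < t ->
      [/\ line_avg (fun x => dv (t, x)) e @[e --> 0^'+] --> V0 t,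
          line_avg (fun x => di (t, x)) e @[e --> 0^'+] --> I0 t,
          line_avg (fun x => dv (t, 1 - x)) e @[e --> 0^'+] --> V1 t &
          line_avg (fun x => di (t, 1 - x)) e @[e --> 0^'+] --> I1 t]} ->
  exists F G : R -> R,
  [/\ forall s, s <= 0 -> F s = 0,
      forall s, s <= tau -> G s = 0,
      {ae mu2, forall z, Omega z ->
        dv z = F (z.1 - tau * z.2) + G (z.1 + tau * z.2) /\
        Z * di z = F (z.1 - tau * z.2) - G (z.1 + tau * z.2)} &
      {ae mu, forall t, 0 < t ->
      [/\ V0 t = F t + G t, Z * I0 t = F t - G t,
          V1 t = F (t - tau) + G (t + tau) &
          Z * I1 t = F (t - tau) - G (t + tau)]}].
Proof.
move=> tau0 Z0 idv idi weak ini bdry.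
pose f z := 2^-1 * dv z + Z / 2 * di z.
pose g z := 2^-1 * dv z + (- (Z / 2)) * di z.
have jf : strip_integrable f by exact: strip_integrable_lin.
have jg : strip_integrable g by exact: strip_integrable_lin.
have Z0' : Z != 0 by rewrite gt_eqF.
have t0 : tau != 0 by rewrite gt_eqF.
have wf : weak_transport tau f.
  apply/(weak_transportE _ jf) => phi tphi; have [h1 h2] := weak _ tphi.
  rewrite !(pair_with_lin _ _ tphi _ idv idi); try (by left); try by right.
  have : 2^-1 * (tau * Z * pair_with di (dt phi) + pair_with dv (dx phi)) +
    Z / 2 * (tau / Z * pair_with dv (dt phi) + pair_with di (dx phi)) = 0 by rewrite h1 h2 !mulr0 addr0.
  move: (pair_with _ _) (pair_with _ _) (pair_with _ _) (pair_with _ _) => a b c d <-.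
  by field.
have wg : weak_transport (- tau) g.
  apply/(weak_transportE _ jg) => phi tphi; have [h1 h2] := weak _ tphi.
  rewrite !(pair_with_lin _ _ tphi _ idv idi); try (by left); try by right.
  have : 2^-1 * (tau * Z * pair_with di (dt phi) + pair_with dv (dx phi)) -
    Z / 2 * (tau / Z * pair_with dv (dt phi) + pair_with di (dx phi)) = 0 by rewrite h1 h2 !mulr0 subr0.
  move: (pair_with _ _) (pair_with _ _) (pair_with _ _) (pair_with _ _) => a b c d <-.
  by field.
have trace a b : {ae mu, forall x, 0 < x < 1 ->
    avg_t0 (fun z => a * dv z + b * di z) x e @[e --> 0^'+] --> (0 : R)}.
  apply: (ae_imply4 _ ini (ae_column_integrable idv) (ae_column_integrable idi) ini).
  move=> x hx j j' _ x01; have [h1 h2] := hx x01.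
  have := @line_avg_lin _ _ _ a b 1 _ _ ltr01 (j x01) (j' x01) h1 h2.
  by rewrite !mulr0 addr0.
have [F [lF F0 fF]] := transport_representation t0 jf wf (trace _ _).
have t0' : - tau != 0 by rewrite oppr_eq0.
have [G [lG G0 gG]] := transport_representation t0' jg wg (trace _ _).
have rep : {ae mu2, forall z, Omega z ->
        dv z = F (z.1 - tau * z.2) + G (z.1 + tau * z.2) /\
        Z * di z = F (z.1 - tau * z.2) - G (z.1 + tau * z.2)}.
  apply: (ae_imply2 _ fF gG) => z h1 h2 Oz.
  have := h1 Oz; have := h2 Oz; rewrite mulNr opprK => <- <-; rewrite /f /g.
  by split; field.
exists F, G; split => //.
- by move=> s s0; apply: F0; rewrite le_max s0.
- by move=> s s0; apply: G0; rewrite le_max opprK s0 orbT.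
have pF := ae_lebesgue_pt lF; have pG := ae_lebesgue_pt lG.
have one0 : (1 : R) != 0 := oner_neq0 _.
have pF1 := ae_affine (- tau) one0 pF; have pG1 := ae_affine tau one0 pG.
have pFG : {ae mu, forall t, [/\ lebesgue_pt F t, lebesgue_pt G t,
    lebesgue_pt F (t - tau) & lebesgue_pt G (t + tau)]}.
  by apply: (ae_imply4 _ pF pG pF1 pG1) => t h1 h2; rewrite mul1r => h3 h4; split.
have sl := ae_slice_t rep.
apply: (ae_imply4 _ bdry pFG sl sl) => t hb [q1 q2 q3 q4] hs _ tp.
have m1 : (-1 : R) != 0 by rewrite oppr_eq0.
have hs' := ae_affine 1 m1 hs.
have [b1 b2 b3 b4] := hb tp.
have sub1 (u : R -> R) a b c d :
    {ae mu, forall x : R, 0 < x < 1 -> u x = a * F (c * x + t) + b * G (d * x + t)} ->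
    forall l, line_avg u e @[e --> 0^'+] --> l -> l = a * F t + b * G t.
  move=> hu l ul; have h := line_avg_two_waves lF lG q1 q2 hu.
  exact: (cvg_unique _ ul h).
have sub2 (u : R -> R) a b c d :
    {ae mu, forall x : R, 0 < x < 1 -> u x = a * F (c * x + (t - tau)) + b * G (d * x + (t + tau))} ->
    forall l, line_avg u e @[e --> 0^'+] --> l -> l = a * F (t - tau) + b * G (t + tau).
  move=> hu l ul; have h := line_avg_two_waves lF lG q3 q4 hu.
  exact: (cvg_unique _ ul h).
have cancel a b : Z * (Z^-1 * a + - Z^-1 * b) = a - b by field.
have Oin x : 0 < x < 1 -> Omega (t, x) by move=> ?; split.
have Oin' x : 0 < x < 1 -> Omega (t, 1 - x).
  by move=> /andP[? ?]; split => //=; apply/andP; split; lra.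
split.
- rewrite (sub1 _ 1 1 (- tau) tau _ _ b1) ?mul1r//.
  apply: ae_imply hs => x hx x01.
  have [-> _] := hx (Oin _ x01); rewrite /= !mul1r; congr (F _ + G _); ring.
- rewrite (sub1 _ Z^-1 (- Z^-1) (- tau) tau _ _ b2); first by field.
  apply: ae_imply hs => x hx x01.
  have [_ h] := hx (Oin _ x01); apply: (mulfI Z0'); rewrite h /= cancel; congr (F _ - G _); ring.
- rewrite (sub2 _ 1 1 tau (- tau) _ _ b3) ?mul1r//.
  apply: ae_imply hs' => x; rewrite mulN1r (addrC (- x)) => hx x01.
  have [-> _] := hx (Oin' _ x01); rewrite /= !mul1r; congr (F _ + G _); ring.
- rewrite (sub2 _ Z^-1 (- Z^-1) tau (- tau) _ _ b4); first by field.
  apply: ae_imply hs' => x; rewrite mulN1r (addrC (- x)) => hx x01.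
  have [_ h] := hx (Oin' _ x01); apply: (mulfI Z0'); rewrite h /= cancel; congr (F _ - G _); ring.
Qed.

End waves.

(** * Uniqueness *)

Section uniqueness.
Context {R : realType} {N : nat}.
Local Notation mu := (@lebesgue_measure R).
Local Notation mu2 := (@lebesgue2 R).
Variables (L C : 'I_N -> R) (p : \bar R) (A : R -> 'M[R]_(N + N)).
Hypotheses (hL : forall k, 0 < L k) (hC : forall k, 0 < C k) (hp : (1 <= p)%E).
Hypothesis A_coercive : exists2 alpha : R, 0 < alpha &
       {ae @lebesgue_measure R, forall t, 0 <= t ->
          loewner_le (alpha%:M) (A t + (A t)^T)}.

Lemma min_delay (tau : 'I_N -> R) : (forall k, 0 < tau k) ->
  exists2 delta : R, 0 < delta & forall k, delta <= tau k.
Proof.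
move=> tau0; exists (\big[Num.min/1]_k tau k).
  by elim/big_ind : _ => // x y x0 y0; rewrite lt_min x0.
by move=> k; exact: bigmin_le_cond.
Qed.

(** By induction on [n], the waves of the difference vanish at times up to
[n * delta], with [delta] the smallest delay: what arrives at an end at such
times left the opposite end during the previous step, so nothing arrives, and
[coercive_dissipation] shows that nothing leaves. *)
Lemma telegrapher_solution_unique v0 i0 v i v' i' :
  telegrapher_solution L C p A v0 i0 v i ->
  telegrapher_solution L C p A v0 i0 v' i' ->
  forall k, ae_eq mu2 Omega (v k) (v' k) /\ ae_eq mu2 Omega (i k) (i' k).
Proof.
move=> sol sol'.
pose tau k := Num.sqrt (L k * C k); pose Z k := Num.sqrt (L k / C k).
have tau0 k : 0 < tau k by have [] := sqrt_impedance (hL k) (hC k).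
have Z0 k : 0 < Z k by have [] := sqrt_impedance (hL k) (hC k).
have LE k : L k = tau k * Z k by have [] := sqrt_impedance (hL k) (hC k).
have CE k : C k = tau k / Z k by have [] := sqrt_impedance (hL k) (hC k).
pose V0 k t := hat_x0 (v k) t - hat_x0 (v' k) t.
pose V1 k t := hat_x1 (v k) t - hat_x1 (v' k) t.
pose I0 k t := hat_x0 (i k) t - hat_x0 (i' k) t.
pose I1 k t := hat_x1 (i k) t - hat_x1 (i' k) t.
have waves k : exists FG : (R -> R) * (R -> R),
  [/\ forall s, s <= 0 -> FG.1 s = 0,
      forall s, s <= tau k -> FG.2 s = 0,
      {ae mu2, forall z, Omega z ->
        v k z - v' k z = FG.1 (z.1 - tau k * z.2) + FG.2 (z.1 + tau k * z.2) /\
        Z k * (i k z - i' k z) = FG.1 (z.1 - tau k * z.2) - FG.2 (z.1 + tau k * z.2)} &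
      {ae mu, forall t, 0 < t ->
      [/\ V0 k t = FG.1 t + FG.2 t, Z k * I0 k t = FG.1 t - FG.2 t,
          V1 k t = FG.1 (t - tau k) + FG.2 (t + tau k) &
          Z k * I1 k t = FG.1 (t - tau k) - FG.2 (t + tau k)]}].
  have [dv [di [[idv idi] [edv edi] weak ini bdry]]] := solution_difference hp sol sol' k.
  rewrite LE CE in weak.
  have [F [G [F0 G0 rep tr]]] := difference_waves (tau0 k) (Z0 k) idv idi weak ini bdry.
  exists (F, G); split => //=.
  apply: (ae_imply4 _ edv edi rep rep) => z h1 h2 h3 _ Oz.
  have [h4 h5] := h3 Oz; split; first by rewrite -h4; exact: h1.
  by rewrite -h5; congr (_ * _); exact: h2.
have [FG hFG] := choice waves.
pose F k := (FG k).1; pose G k := (FG k).2.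
have F0 k s : s <= 0 -> F k s = 0 by have [h _ _ _] := hFG k; exact: h.
have G0 k s : s <= tau k -> G k s = 0 by have [_ h _ _] := hFG k; exact: h.
have rep k : {ae mu2, forall z, Omega z ->
        v k z - v' k z = F k (z.1 - tau k * z.2) + G k (z.1 + tau k * z.2) /\
        Z k * (i k z - i' k z) = F k (z.1 - tau k * z.2) - G k (z.1 + tau k * z.2)}.
  by have [_ _ h _] := hFG k.
have tr : {ae mu, forall t, forall k, 0 < t ->
      [/\ V0 k t = F k t + G k t, Z k * I0 k t = F k t - G k t,
          V1 k t = F k (t - tau k) + G k (t + tau k) &
          Z k * I1 k t = F k (t - tau k) - G k (t + tau k)]}.
  by apply: ae_forall_countable => k; have [_ _ _ h] := hFG k.
have bdry : {ae mu, forall t, 0 < t ->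
    col_mx (\col_k V0 k t) (\col_k V1 k t) =
    A t *m col_mx (\col_k - I0 k t) (\col_k I1 k t)}.
  have [_ _ _ _ _ bs] := sol; have [_ _ _ _ _ bs'] := sol'.
  apply: (ae_imply2 _ bs bs') => t h h' t0.
  have E (a b c d : 'I_N -> R) : col_mx (\col_k (a k - b k)) (\col_k (c k - d k)) =
    col_mx (\col_k a k) (\col_k c k) - col_mx (\col_k b k) (\col_k d k).
    rewrite opp_col_mx add_col_mx; congr col_mx; apply/matrixP => x y; rewrite !mxE//.
  rewrite /V0 /V1 E h// h'// -mulmxBr -E; congr (_ *m col_mx _ _).
  by apply/matrixP => x y; rewrite !mxE /I0 opprB opprK addrC.
clearbody V0 V1 I0 I1 F G tau Z.
have [delta d0 dtau] := min_delay tau0.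
have vanish (n : nat) : {ae mu, forall t, t <= n%:R * delta ->
    forall k, F k t = 0 /\ G k (t + tau k) = 0}.
  elim: n => [|n IH].
    apply: aeW => t; rewrite mul0r => t0 k; rewrite F0// G0//.
    by rewrite gerDr.
  have IHs : {ae mu, forall t, forall k, t - tau k <= n%:R * delta ->
      forall l, F l (t - tau k) = 0 /\ G l (t - tau k + tau l) = 0}.
    apply: ae_forall_countable => k.
    have := ae_affine (- tau k) (oner_neq0 R) IH.
    by apply: ae_imply => t; rewrite mul1r.
  have [alpha a0 co] := A_coercive.
  apply: (ae_imply4 _ IHs tr bdry co) => t hI hT hB hA tn.
  have [t0|t0] := leP t 0.
    by move=> k; rewrite F0// G0// gerDr.
  have small k : t - tau k <= n%:R * delta.
    by move: tn; rewrite -natr1 mulrDl mul1r => tn; have := dtau k; lra.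
  have Fd k : F k (t - tau k) = 0 by have [] := hI k (small k) k.
  have Gd k : G k t = 0 by have [_] := hI k (small k) k; rewrite subrK.
  pose y : 'cV[R]_(N + N) := col_mx (\col_k - I0 k t) (\col_k I1 k t).
  pose z (j : 'I_(N + N)) := match fintype.split j with inl k => Z k | inr k => Z k end.
  have y0 : y = 0.
    apply: (@coercive_dissipation _ _ (A t) alpha z y a0 (hA (ltW t0))).
      by move=> j; rewrite /z; case: fintype.split => k.
    move=> j; rewrite -hB// /z; case: (fintype.split_ordP j) => k ->.
      rewrite /y !col_mxEu !mxE.
      have [-> _ _ _] := hT k t0; rewrite mulrN; have [_ -> _ _] := hT k t0.
      by rewrite Gd subr0 addr0.
    rewrite /y !col_mxEd !mxE.
    have [_ _ -> _] := hT k t0; have [_ _ _ ->] := hT k t0.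
    by rewrite Fd !add0r.
  move=> k; have [_ h1 _ h2] := hT k t0; split.
    move: h1; have := congr1 (fun M : 'cV_(N + N) => M (lshift N k) 0) y0.
    rewrite /y col_mxEu !mxE => /eqP; rewrite oppr_eq0 => /eqP ->.
    by rewrite mulr0 Gd subr0.
  move: h2; have := congr1 (fun M : 'cV_(N + N) => M (rshift N k) 0) y0.
  rewrite /y col_mxEd !mxE => ->.
  by rewrite mulr0 Fd sub0r => /esym/eqP; rewrite oppr_eq0 => /eqP.
have zero : {ae mu, forall t k, F k t = 0 /\ G k t = 0}.
  have h1 : {ae mu, forall t k, F k t = 0 /\ G k (t + tau k) = 0}.
    apply: ae_imply (ae_foralln vanish) => t h k.
    have [n tn] : exists n : nat, t <= n%:R * delta.
      exists (Num.bound `|t / delta|); rewrite -ler_pdivrMr//.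
      by apply/ltW; apply: le_lt_trans (ler_norm _) _; exact: (@archi_boundP R).
    exact: h tn k.
  apply: ae_forall_countable => k.
  have h2 := ae_affine (- tau k) (oner_neq0 R) h1.
  apply: (ae_imply2 _ h1 h2) => t h3 h4.
  by have [-> _] := h3 k; have [_] := h4 k; rewrite mul1r subrK.
have line k (s : R) : {ae mu2, forall z : R * R, F k (z.1 + s * z.2) = 0 /\ G k (z.1 + s * z.2) = 0}.
  have h1 : {ae mu, forall t, F k t = 0 /\ G k t = 0}.
    by apply: ae_imply zero => t.
  exact: ae_preserving (preserving_shear s) (ae_fst h1).
move=> k; have key : {ae mu2, forall z, Omega z -> v k z = v' k z /\ i k z = i' k z}.
  apply: (ae_imply4 _ (rep k) (line k (- tau k)) (line k (tau k)) (rep k)) => z h1 h2 h3 _ Oz.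
  have [e1 e2] := h1 Oz; move: h2 e1 e2; rewrite mulNr => -[-> _]; have [_ ->] := h3.
  rewrite addr0 subr0 => /subr0_eq -> /eqP.
  by rewrite mulf_eq0 (gt_eqF (Z0 k))/= subr_eq0 => /eqP ->.
by split; apply: ae_imply key => z h /h[].
Qed.

End uniqueness.

(** * Locally p-integrable functions of one variable *)

Section local_Lp.
Context {R : realType}.
Local Notation mu := (@lebesgue_measure R).
Local Notation mu2 := (@lebesgue2 R).
Variables (p : \bar R) (hp : (1 <= p)%E).
Implicit Types (F G f g : R -> R).

(** All estimates on the construction are of this kind. The constant does not
depend on the shift [c], which gives bounds uniform in time. *)
Lemma Lnorm_affine_dominated (a M : R) : a != 0 -> 0 <= M ->
  exists2 K : R, 0 <= K & forall c f g, measurable_fun setT g ->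
    (forall r, `|f r| <= M * `|g (a * r + c)|) ->
    (Lnorm mu p (EFin \o f) <= K%:E * Lnorm mu p (EFin \o g))%E.
Proof.
move=> a0 M0; case: p hp => [r||//] r1.
- have r0 : 0 < r by rewrite (lt_le_trans ltr01)// -lee_fin.
  exists ((M `^ r * `|a|^-1) `^ r^-1) => [|c f g mg fg]; first exact: powR_ge0.
  have c0 : 0 <= M `^ r * `|a|^-1 by rewrite mulr_ge0 ?powR_ge0// invr_ge0.
  rewrite unlock -poweR_EFin -poweRM; last 2 first.
  - by rewrite lee_fin.
  - by apply: integral_ge0 => x _; exact: poweR_ge0.
  apply: gt0_ler_poweR; first by rewrite invr_ge0 ltW.
  - by rewrite in_itv/= leey andbT integral_ge0// => x _; exact: poweR_ge0.
  - by rewrite in_itv/= leey andbT mule_ge0 ?lee_fin// integral_ge0// => x _; exact: poweR_ge0.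
  have mgr : measurable_fun setT (fun x => (`|(EFin \o g) x| `^ r)%E).
    apply: (@measurableT_comp _ _ _ _ _ _ (fun x : \bar R => x `^ r)%E) => //.
      exact: measurable_poweR.
    by apply: measurableT_comp => //; exact/measurable_EFinP.
  have h := @le_integral_affine _ a c (fun x => (`|(EFin \o f) x| `^ r)%E)
    (fun x => ((M `^ r)%:E * `|(EFin \o g) x| `^ r)%E) a0 _ _ _ _.
  have {}h : (`|a|%:E * \int[mu]_x `|(EFin \o f) x| `^ r <=
      (M `^ r)%:E * \int[mu]_x `|(EFin \o g) x| `^ r)%E.
    rewrite -[leRHS]ge0_integralZl//; last 2 first.
    - by move=> x _; exact: poweR_ge0.
    - by rewrite lee_fin powR_ge0.
    apply: h => //.
    - exact: measurable_funeM.
    - by move=> x; exact: poweR_ge0.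
    - by move=> x; rewrite mule_ge0 ?poweR_ge0// lee_fin powR_ge0.
    - move=> x /=; rewrite -EFinM lee_fin -powRM//.
      by apply: ge0_ler_powR; rewrite ?nnegrE ?mulr_ge0// ltW.
  have ai : (0 <= (`|a|^-1)%:E :> \bar R)%E by rewrite lee_fin invr_ge0.
  have := lee_wpmul2l ai h; rewrite !muleA -!EFinM mulVf ?normr_eq0// mul1e.
  by rewrite (mulrC (`|a|^-1)).
- exists M => // c f g mg fg.
  rewrite unlock lebesgue_setT_gt0.
  have [s0 hs] : (0 <= ess_sup mu (abse \o (EFin \o g)))%E /\
      {ae mu, forall x, (`|(EFin \o g) x| <= ess_sup mu (abse \o (EFin \o g)))%E}.
    split; last exact: ess_sup_ge.
    by apply: ess_sup_gee; [exact: lebesgue_setT_gt0|apply: aeW => x; exact: abse_ge0].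
  apply/ess_supP; have := ae_affine c a0 hs.
  apply: ae_imply => x hx.
  apply: (@le_trans _ _ (M * `|g (a * x + c)|)%:E); first by rewrite lee_fin.
  by rewrite EFinM; apply: lee_pmul.
Qed.

Definition cut T F : R -> R := F \_ `[- T, T].

(** A class stable under the operations of the delay system, and uniform in [p]
thanks to the norm. *)
Definition Lp_loc F := measurable_fun setT F /\
  forall T : R, (Lnorm mu p (EFin \o cut T F) < +oo)%E.

Let mcut F T : measurable_fun setT F -> measurable_fun setT (cut T F).
Proof.
move=> mF; apply: (@measurable_restrictT _ _ _ _ _ _ _).1; first exact: measurable_itv.
exact: measurable_funTS.
Qed.

Let abs_affine (a c t T : R) : `|t| <= T -> a * t + c \in `[- (`|a| * T + `|c|), `|a| * T + `|c|].
Proof.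
move=> tT; rewrite in_itv/= -ler_norml; apply: le_trans (ler_normD _ _) _.
by rewrite lerD2r normrM ler_wpM2l.
Qed.

(** Locality and stability in one statement: on each bounded interval, a bound by
an affine reparametrisation of a function of the class. *)
Lemma Lp_loc_dominated f : measurable_fun setT f ->
  (forall T : R, exists g a c M, [/\ Lp_loc g, a != 0, 0 <= M &
     forall t, `|t| <= T -> `|f t| <= M * `|g (a * t + c)|]) ->
  Lp_loc f.
Proof.
move=> mf h; split=> // T; have [g [a [c [M [[mg gT] a0 M0 fg]]]]] := h T.
have [K K0 hK] := Lnorm_affine_dominated a0 M0.
apply: (@le_lt_trans _ _ (K%:E * Lnorm mu p (EFin \o cut (`|a| * T + `|c|)%R g))%E).
  apply: (hK c); first exact: mcut.
  move=> r; rewrite /cut !patchE; case: ifPn => [/set_mem/=|_]; last first.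
    by rewrite normr0 mulr_ge0.
  rewrite in_itv/= -ler_norml => rT.
  by rewrite mem_set/=; [exact: fg|exact: abs_affine].
by apply: lte_mul_pinfty => //; rewrite lee_fin.
Qed.

Lemma Lp_loc_affine a c F : a != 0 -> Lp_loc F -> Lp_loc (fun t => F (a * t + c)).
Proof.
move=> a0 lF; apply: Lp_loc_dominated => [|T].
  by apply: measurable_line; case: lF.
by exists F, a, c, 1; split => // t _; rewrite mul1r.
Qed.

Lemma Lp_loc_mul (b F : R -> R) : measurable_fun setT b ->
  (forall T, exists K : R, forall t, `|t| <= T -> `|b t| <= K) ->
  Lp_loc F -> Lp_loc (fun t => b t * F t).
Proof.
move=> mb hb lF; apply: Lp_loc_dominated => [|T].
  by apply: measurable_funM => //; case: lF.
have [K hK] := hb T; exists F, 1, 0, `|K|; split => // t tT.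
rewrite mul1r addr0 normrM ler_wpM2r//.
by apply: le_trans (hK _ tT) (ler_norm _).
Qed.

Lemma Lp_loc_local F : measurable_fun setT F ->
  (forall T, exists2 G, Lp_loc G & forall t, `|t| <= T -> F t = G t) -> Lp_loc F.
Proof.
move=> mF h; apply: Lp_loc_dominated => // T; have [G lG FG] := h T.
by exists G, 1, 0, 1; split => // t tT; rewrite !mul1r addr0 FG.
Qed.

Lemma Lp_locD F G : Lp_loc F -> Lp_loc G -> Lp_loc (fun t => F t + G t).
Proof.
move=> [mF iF] [mG iG]; split=> [|T]; first exact: measurable_funD.
have E : cut T (fun t => F t + G t) = cut T F \+ cut T G.
  by apply/funext => t; rewrite /cut /= !patchE; case: ifPn => //; rewrite addr0.
rewrite E; apply: le_lt_trans (eminkowski _ _ _ hp) _; [exact: mcut..|].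
exact: lte_add_pinfty.
Qed.

Lemma Lp_loc_sum (I : finType) (F : I -> R -> R) :
  (forall i, Lp_loc (F i)) -> Lp_loc (fun t => \sum_i F i t).
Proof.
move=> lF; pose S (s : seq I) t := \sum_(i <- s) F i t.
suff : Lp_loc (S (index_enum I)) by [].
elim: (index_enum I) => [|i s IH].
  have -> : S [::] = cst 0 by apply/funext => t; rewrite /S big_nil.
  split=> // T; have -> : cut T (cst 0) = cst (0 : R).
    by apply/funext => t; rewrite /cut patchE; case: ifPn.
  by rewrite (_ : EFin \o _ = cst 0%E)// Lnorm0 ?ltry// gt_eqF// (lt_le_trans _ hp).
have -> : S (i :: s) = (fun t => F i t + S s t) by apply/funext => t; rewrite /S big_cons.
exact: Lp_locD.
Qed.

(** The profile of a wave controls its slices at all times in a bounded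
interval. *)
Lemma Lp_loc_slice a F (T : R) : a != 0 -> Lp_loc F ->
  exists2 K : R, 0 <= K & forall c, `|c| <= T -> (Lp_norm01 p (fun x => F (a * x + c)%R) <= K%:E)%E.
Proof.
move=> a0 [mF iF]; have [K K0 hK] := Lnorm_affine_dominated a0 (@ler01 R).
set J := `|a| * 1 + `|T|.
have J0 := Lnorm_ge0 mu p (EFin \o cut J F).
have Jfin : Lnorm mu p (EFin \o cut J F) \is a fin_num by rewrite ge0_fin_numE.
exists (K * fine (Lnorm mu p (EFin \o cut J F))) => [|c cT].
  by rewrite mulr_ge0// fine_ge0.
rewrite EFinM fineK//; apply: (hK c); first exact: mcut.
move=> r; rewrite mul1r /cut !patchE; case: ifPn => [/set_mem/=|_]; last by rewrite normr0.
rewrite in_itv/= => /andP[r0 r1]; rewrite mem_set//= /J.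
have r1' : `|r| <= 1 by rewrite ger0_norm.
have := abs_affine a c r1'; rewrite !in_itv/= => /andP[h1 h2].
have cT' : `|c| <= `|T| by apply: le_trans cT (ler_norm _).
by apply/andP; split; lra.
Qed.

(** An affine map brings any interval to [[0, 1]], where the norm bounds the
integral. *)
Lemma Lp_loc_loc_int F : Lp_loc F -> loc_int F.
Proof.
move=> lF; have mF : measurable_fun setT F by case: lF.
split=> // T; set S := `|T| + 1.
have S0 : 0 < S by rewrite /S ltr_wpDl.
have TS : `[- T, T] `<=` `[- S, S].
  move=> t /=; rewrite !in_itv/= -!ler_norml /S => h.
  by rewrite (le_trans h)// (le_trans (ler_norm _))// lerDl.
apply: (@integrableS _ _ _ mu `[- S, S]) => //.
have S2 : 2 * S != 0 by rewrite mulf_neq0// gt_eqF.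
have [K K0 hK] := Lp_loc_slice `|S| S2 lF.
(* [f'] runs through [[- S, S]] as [x] runs through [[0, 1]]. *)
pose f' x := F (2 * S * x + - S).
have mf' : measurable_fun setT f' by exact: measurable_line.
have h1 := Lnorm1_le_Lp_norm01 hp mf'.
have {}h1 : (\int[mu]_(x in `[0%R, 1%R]) `|(f' x)%:E| < +oo)%E.
  apply: le_lt_trans h1 _; apply: le_lt_trans (hK (- S) _) (ltry K).
  by rewrite normrN.
apply/integrableP; split; first by apply/measurable_EFinP; exact: measurable_funTS.
rewrite integral_mkcond; rewrite integral_mkcond in h1.
have k0 : (2 * S)^-1 != 0 by rewrite invr_eq0.
set I := (X in (X < _)%E); set J := (X in (X < _)%E) in h1.
have h : (`|(2 * S)^-1|%:E * I <= J)%E.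
  apply: (@le_integral_affine _ (2 * S)^-1 2^-1) => //.
  - apply/(measurable_restrictT _ _).1 => //; apply: measurableT_comp => //.
    by apply/measurable_EFinP; exact: measurable_funTS.
  - by move=> x; apply: erestrict_ge0 => ? _; exact: abse_ge0.
  - by move=> x; apply: erestrict_ge0 => ? _; exact: abse_ge0.
  - move=> r; rewrite !patchE; case: ifPn => [/set_mem/=|_]; last first.
      by case: ifPn => // _; exact: abse_ge0.
    have S1 : 0 < 2 * S by rewrite mulr_gt0.
    have Sn0 : S != 0 by rewrite gt_eqF.
    have -> : (2 * S)^-1 * r + 2^-1 = (r + S) / (2 * S) by field.
    rewrite in_itv/= => /andP[r0 r1]; rewrite mem_set/=; last first.
      rewrite in_itv/=; apply/andP; split.
        by rewrite divr_ge0// ?(ltW S1)//; lra.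
      by rewrite ler_pdivrMr// mul1r; lra.
    by rewrite /f' (_ : 2 * S * ((r + S) / (2 * S)) + - S = r)//; field.
rewrite ltNge leye_eq; apply/negP => /eqP IE; move: h; rewrite IE gt0_muley ?lte_fin ?normr_gt0//.
by rewrite leye_eq => /eqP JE; move: h1; rewrite JE ltxx.
Qed.

End local_Lp.

(** * The delay system *)

Section delay_system.
Context {R : realType} {n : nat}.
Variables (B : R -> 'M[R]_n) (swap : 'I_n -> 'I_n) (tau : 'I_n -> R).
Variables (init : 'I_n -> R -> R) (delta : R).
Hypotheses (delta0 : 0 < delta) (delta_tau : forall j, delta <= tau j).

(** The solution by steps: [delay_iter m] is correct up to time [m * delta], as a
step reads values at least [delta] earlier. *)
Fixpoint delay_iter (m : nat) (j : 'I_n) (t : R) : R :=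
  if m is m'.+1 then
    if t <= 0 then init j t
    else \sum_l B t j l * delay_iter m' (swap l) (t - tau l)
  else init j t.

Lemma delay_iter_init m j t : t <= 0 -> delay_iter m j t = init j t.
Proof. by case: m => //= m ->. Qed.

Lemma delay_iterS m j t : t <= m%:R * delta -> delay_iter m.+1 j t = delay_iter m j t.
Proof.
elim: m j t => [|m IH] j t tm; first by rewrite delay_iter_init// -(mul0r delta).
rewrite [LHS]/= [RHS]/=; case: ifPn => // _; apply: eq_bigr => l _.
congr (_ * _); apply: IH; have := delta_tau l.
by move: tm; rewrite -natr1 mulrDl mul1r; lra.
Qed.

Lemma delay_iter_stable m m' j t : t <= m%:R * delta -> (m <= m')%N ->
  delay_iter m' j t = delay_iter m j t.
Proof.
move=> tm /subnK <-; elim: (m' - m)%N => [//|k IH]; rewrite addSn -IH.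
apply: delay_iterS; apply: le_trans tm _.
by rewrite ler_wpM2r// ?(ltW delta0)// ler_nat leq_addl.
Qed.

(** The number of iterations depends on [t]: it is large enough for the iterates
to be stationary at [t]. *)
Definition delay_sol j t := delay_iter (Num.bound `|t / delta|) j t.

Lemma delay_solE m j t : t <= m%:R * delta -> delay_sol j t = delay_iter m j t.
Proof.
move=> tm; rewrite /delay_sol; set b := Num.bound _.
have tb : t <= b%:R * delta.
  rewrite -ler_pdivrMr//; apply/ltW; apply: le_lt_trans (ler_norm _) _.
  exact: (@archi_boundP R).
have [mb|/ltnW bm] := leqP m b; first exact: delay_iter_stable.
by apply/esym; exact: delay_iter_stable.
Qed.

Lemma delay_sol_local (T : R) : exists m0, forall m, (m0 <= m)%N -> forall j t, t <= T ->
  delay_sol j t = delay_iter m j t.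
Proof.
exists (Num.bound `|T / delta|) => m m0m j t tT; apply: delay_solE; apply: le_trans tT _.
rewrite -ler_pdivrMr//; apply/ltW; apply: le_lt_trans (ler_norm _) _.
apply: lt_le_trans (@archi_boundP R _ (normr_ge0 _)) _.
by rewrite ler_nat.
Qed.

Lemma delay_sol_init j t : t <= 0 -> delay_sol j t = init j t.
Proof. exact: delay_iter_init. Qed.

Lemma delay_sol_recursion j t : 0 < t ->
  delay_sol j t = \sum_l B t j l * delay_sol (swap l) (t - tau l).
Proof.
move=> t0; have [m hm] := delay_sol_local t.
rewrite (hm m.+1)//= leNgt t0/=.
apply: eq_bigr => l _; rewrite (hm m)// gerBl.
by apply: le_trans (delta_tau l); exact: ltW.
Qed.

(** On bounded intervals the solution is an iterate, and one step only involves
bounded coefficients, shifts, sums and cutting off at time [0]. *)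
Lemma delay_sol_Lp_loc p : (1 <= p)%E -> (forall j l, measurable_fun setT (fun t => B t j l)) ->
  (forall T, exists K : R, forall t, `|t| <= T -> forall j l, `|B t j l| <= K) ->
  (forall j, Lp_loc p (init j)) -> forall j, Lp_loc p (delay_sol j).
Proof.
move=> hp mB bB iinit.
have iter m : forall j, Lp_loc p (delay_iter m j).
  elim: m => [//|m IH] j.
  have cut (P : set R) F : measurable P -> Lp_loc p F -> Lp_loc p (fun t => \1_P t * F t).
    move=> mP lF; apply: Lp_loc_mul => // T; exists 1 => t _.
    by rewrite indicE; case: (_ \in _); rewrite ?normr1 ?normr0.
  have h1 := cut `]-oo, 0]%classic (init j) (measurable_itv _) (iinit j).
  have h2 : Lp_loc p (fun t => \1_(`]0, +oo[%classic) t *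
      \sum_l B t j l * delay_iter m (swap l) (t - tau l)).
    apply: cut; first exact: measurable_itv.
    apply: Lp_loc_sum => // l; apply: Lp_loc_mul => //.
      by move=> T; have [K hK] := bB T; exists K => t /hK.
    have := @Lp_loc_affine _ p hp 1 (- tau l) _ (oner_neq0 R) (IH (swap l)).
    by congr Lp_loc; apply/funext => t; rewrite mul1r.
  have := Lp_locD hp h1 h2; congr Lp_loc; apply/funext => t.
  rewrite !indicE /=; case: (leP t 0) => t0.
    by rewrite mem_set ?memNset ?mul1r ?mul0r ?addr0//= in_itv/= ?t0// ltNge t0.
  by rewrite memNset ?mem_set ?mul1r ?mul0r ?add0r//= in_itv/= ?t0// leNgt t0.
have msol j : measurable_fun setT (delay_sol j).
  apply: (@measurable_fun_cvg _ _ _ setT (fun m => delay_iter m j) (delay_sol j)).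
  - by move=> m; case: (iter m j).
  - move=> t _; have [m hm] := delay_sol_local t.
    by apply: cvg_near_cst; exists m => // k /= mk; rewrite -(hm k).
move=> j; apply: Lp_loc_local => // T.
have [m hm] := delay_sol_local T; exists (delay_iter m j) => // t tT.
by apply: hm => //; apply: le_trans tT; exact: ler_norm.
Qed.

Lemma continuous_glue (f g : R -> R) : continuous f -> continuous g -> f 0 = g 0 ->
  continuous (fun t : R => if t <= 0 then f t else g t).
Proof.
move=> cf cg fg.
have -> : (fun t : R => if t <= 0 then f t else g t) =
    (fun t : R => f (Num.min t 0) + g (Num.max t 0) - g 0).
  apply/funext => t; case: leP => t0; first by rewrite addrK.
  by rewrite fg addrAC subrr add0r.
move=> t; apply: cvgB; last exact: cvg_cst; apply: cvgD.
  apply: (@continuous_comp _ _ _ (fun t : R => Num.min t 0) f); last exact: cf.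
  by apply: continuous_min; [exact: cvg_id|exact: cvg_cst].
apply: (@continuous_comp _ _ _ (fun t : R => Num.max t 0) g); last exact: cg.
by apply: continuous_max; [exact: cvg_id|exact: cvg_cst].
Qed.

Lemma continuous_sum (I : finType) (F : I -> R -> R) :
  (forall i, continuous (F i)) -> continuous (fun t => \sum_i F i t).
Proof.
have add_cont : continuous (fun x : R * R => x.1 + x.2) by move=> x; exact: add_continuous.
by move=> cF; apply: (continuous_big add_cont).
Qed.

(** The hypothesis at time [0] is what gluing the initial data to the first step
requires; later steps inherit it. *)
Lemma delay_sol_continuous : (forall j l, continuous (fun t => B t j l)) ->
  (forall j, continuous (init j)) ->
  (forall j, init j 0 = \sum_l B 0 j l * init (swap l) (- tau l)) ->
  forall j, continuous (delay_sol j).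
Proof.
move=> cB cinit compat.
have iter m : forall j, continuous (delay_iter m j).
  elim: m => [//|m IH] j; apply: continuous_glue => //.
    apply: continuous_sum => l t.
    apply: cvgM; first exact: cB.
    apply: (@continuous_comp _ _ _ (fun t : R => t - tau l) (delay_iter m (swap l))); last exact: IH.
    by apply: cvgB; [exact: cvg_id|exact: cvg_cst].
  rewrite compat; apply: eq_bigr => l _; congr (_ * _); apply/esym.
  rewrite sub0r; apply: delay_iter_init; rewrite oppr_le0.
  by apply: le_trans (delta_tau l); exact: ltW.
move=> j t; have [m hm] := delay_sol_local (t + 1).
rewrite /continuous_at (hm m) ?lerDl//.
apply: cvg_trans (iter m j t); apply: near_eq_cvg; near=> s.
apply/esym/(hm m) => //; near: s.
by exists 1 => //= s /=; rewrite ltr_distlC => /andP[_ /ltW].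
Unshelve. all: by end_near. Qed.

End delay_system.

(** * The scattering matrix of the boundary coupling *)

Section scattering.
Context {R : realType} {n : nat}.
Variables (z : 'I_n -> R) (alpha : R).
Hypotheses (z0 : forall j, 0 < z j) (alpha0 : 0 < alpha).
Implicit Types (A : 'M[R]_n) (y w : 'cV[R]_n).

Definition load_mx A : 'M[R]_n := diag_mx (\row_j z j) + A.

Lemma load_mxE A y j : (load_mx A *m y) j 0 = z j * y j 0 + (A *m y) j 0.
Proof. by rewrite mulmxDl mul_diag_mx !mxE. Qed.

(** The impedances only add to the coercivity of [A]. *)
Lemma load_mx_lower A y : loewner_le (alpha%:M) (A + A^T) ->
  alpha * \sum_j y j 0 ^+ 2 <= 2 * \sum_j y j 0 * (load_mx A *m y) j 0.
Proof.
move=> /(@loewner_le_quadratic _ _ _ _ y) h; apply: le_trans h _.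
rewrite ler_wpM2l//; apply: ler_sum => j _; rewrite load_mxE mulrDr lerDr.
by rewrite mulrCA -expr2 mulr_ge0 ?sqr_ge0// ltW.
Qed.

Lemma load_mx_unit A : loewner_le (alpha%:M) (A + A^T) -> load_mx A \in unitmx.
Proof.
move=> h; rewrite -unitmx_tr -row_free_unit -kermx_eq0.
apply/rowV0P => v /sub_kermxP vM.
have My : load_mx A *m v^T = 0 by rewrite -[LHS]trmxK trmx_mul trmxK vM trmx0.
have : v^T = 0.
  apply: (coercive_dissipation alpha0 h z0) => j.
  have := congr1 (fun X : 'cV_n => X j 0) My; rewrite load_mxE [in RHS]mxE => /eqP.
  by rewrite addr_eq0 => /eqP.
by move=> /(congr1 trmx); rewrite trmxK trmx0.
Qed.

(** A column [y] of the inverse solves [(D + A) y = e_l]; pairing with [y] gives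
[alpha |y|^2 <= 2 y_l], which bounds first [y_l], then all entries. *)
Lemma invmx_load_bound A j l : loewner_le (alpha%:M) (A + A^T) ->
  `|invmx (load_mx A) j l| <= 2 / alpha.
Proof.
move=> h; have Mu := load_mx_unit h.
pose y := col l (invmx (load_mx A)).
have yE i : invmx (load_mx A) i l = y i 0 by rewrite mxE.
have := load_mx_lower y h.
have -> : load_mx A *m y = col l 1%:M by rewrite /y colE mulmxA mulmxV// -colE.
have -> : \sum_i y i 0 * (col l 1%:M : 'cV_n) i 0 = y l 0.
  rewrite (bigD1 l)//= !mxE eqxx mulr1 big1 ?addr0// => i il.
  by rewrite !mxE (negbTE il) mulr0.
move=> hy.
have sq i : alpha * y i 0 ^+ 2 <= 2 * y l 0.
  apply: le_trans hy; rewrite ler_wpM2l ?(ltW alpha0)//.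
  by rewrite (bigD1 i)//= lerDl; apply: sumr_ge0 => k _; exact: sqr_ge0.
have yl : y l 0 <= 2 / alpha.
  rewrite ler_pdivlMr//; have := sq l.
  have yl0 : 0 <= y l 0.
    have : 0 <= alpha * y l 0 ^+ 2 by rewrite mulr_ge0 ?sqr_ge0// ltW.
    by move=> /le_trans /(_ (sq l)); rewrite pmulr_rge0.
  move: yl0; rewrite le_eqVlt => /predU1P[<-|yl0]; first by rewrite mul0r.
  by rewrite expr2 mulrA ler_pM2r// mulrC.
have a20 : 0 <= 2 / alpha by rewrite divr_ge0// ltW.
rewrite yE -(@ler_pXn2r _ 2) ?nnegrE//.
rewrite real_normK ?num_real//.
have : alpha * y j 0 ^+ 2 <= alpha * (2 / alpha) ^+ 2.
  apply: le_trans (sq j) _; apply: le_trans (_ : 2 * (2 / alpha) <= _); first by rewrite ler_wpM2l.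
  rewrite le_eqVlt; apply/orP; left; apply/eqP; field.
  by rewrite gt_eqF.
by rewrite ler_pM2l.
Qed.

(** The entries of the inverse are bounded where [A] is coercive, that is for
almost every time; clipping makes the bound valid at all times and does not
change them there. *)
Definition clip (x : R) := Num.max (- (2 / alpha)) (Num.min (2 / alpha) x).

Lemma clip_id x : `|x| <= 2 / alpha -> clip x = x.
Proof. by rewrite ler_norml /clip => /andP[h1 h2]; rewrite min_r// max_r. Qed.

Lemma clip_bound x : `|clip x| <= 2 / alpha.
Proof.
have a0 : 0 <= 2 / alpha by rewrite divr_ge0// ltW.
rewrite ler_norml /clip le_max lexx/= ge_max ge_min lexx/= andbT.
by rewrite (le_trans _ a0)// oppr_le0.
Qed.

(** [1 - 2 D (D + A)^-1], where the inverse is written with the adjugate to make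
measurability and continuity in [A] plain. *)
Definition scattering A : 'M[R]_n := \matrix_(j, l) ((j == l)%:R -
  2 * z j * clip ((\det (load_mx A))^-1 * (\adj (load_mx A)) j l)).

Lemma scattering_bound A j l : `|scattering A j l| <= 1 + 2 * z j * (2 / alpha).
Proof.
rewrite mxE; apply: le_trans (ler_normB _ _) _; apply: lerD.
  by case: (_ == _); rewrite ?normr1 ?normr0.
rewrite normrM ger0_norm ?mulr_ge0// ?(ltW (z0 _))//.
by rewrite ler_wpM2l ?mulr_ge0 ?clip_bound// ltW.
Qed.

(** [y = 2 (D + A)^-1 W] satisfies [D y = W - U] by definition of [U], and
[A y = 2 W - D y = W + U]. *)
Lemma scattering_boundary A (U W y : 'cV[R]_n) : loewner_le (alpha%:M) (A + A^T) ->
  U = scattering A *m W -> (forall j, z j * y j 0 = W j 0 - U j 0) ->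
  U + W = A *m y.
Proof.
move=> h UE yE; have Mu := load_mx_unit h.
have invE : (\det (load_mx A))^-1 *: \adj (load_mx A) = invmx (load_mx A).
  by rewrite /invmx Mu.
have sE : scattering A = 1%:M - 2 *: (diag_mx (\row_j z j) *m invmx (load_mx A)).
  apply/matrixP => j l; rewrite [LHS]mxE.
  have -> : (\det (load_mx A))^-1 * (\adj (load_mx A)) j l = invmx (load_mx A) j l.
    by rewrite -invE [RHS]mxE.
  by rewrite clip_id ?invmx_load_bound// mul_diag_mx [RHS]mxE !mxE mulrA.
set q := 2 *: (invmx (load_mx A) *m W).
have Uq : U = W - diag_mx (\row_j z j) *m q.
  by rewrite UE sE mulmxBl mul1mx -scalemxAl -mulmxA /q scalemxAr.
have yq : y = q.
  apply/matrixP => j k; rewrite (ord1 k); apply: (mulfI (lt0r_neq0 (z0 j))).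
  by rewrite yE Uq mul_diag_mx !mxE opprB addrC subrK.
have : load_mx A *m q = 2 *: W by rewrite /q -scalemxAr mulmxA mulmxV// mul1mx.
rewrite /load_mx mulmxDl => Mq.
(* This is [(D + A) q = 2 W], solved for [A q]. *)
have -> : A *m y = 2 *: W - diag_mx (\row_j z j) *m q.
  by rewrite -Mq yq addrAC subrr add0r.
by rewrite Uq scaler_nat mulr2n addrAC.
Qed.

End scattering.

Section regularity.
Context {R : realType}.

(** [x^-1 = x * (x^2)^-1] for all [x], zero included, reduces the claim to real
powers of nonnegative numbers. *)
Lemma measurable_inv : measurable_fun setT (fun x : R => x^-1).
Proof.
have -> : (fun x : R => x^-1) = (fun x : R => x * (x ^+ 2) `^ (-1)).
  apply/funext => x; rewrite powR_inv1 ?sqr_ge0//.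
  by have [->|x0] := eqVneq x 0; rewrite ?invr0 ?mul0r// expr2 invfM mulrA divff// mul1r.
apply: measurable_funM => //.
by apply: (measurableT_comp (measurable_powR _)); exact: exprn_measurable.
Qed.

Lemma measurable_det d (X : measurableType d) n (A : X -> 'M[R]_n) :
  (forall j l, measurable_fun setT (fun t => A t j l)) ->
  measurable_fun setT (fun t => \det (A t)).
Proof.
move=> mA; apply: measurable_sum => s.
apply: measurable_funM => //.
by apply: measurable_prod => i _; exact: mA.
Qed.

Lemma continuous_det n (A : R -> 'M[R]_n) :
  (forall j l, continuous (fun t => A t j l)) -> continuous (fun t => \det (A t)).
Proof.
move=> cA; apply: continuous_sum => s t; apply: cvgM; first exact: cvg_cst.
have mul_cont : continuous (fun x : R * R => x.1 * x.2) by move=> x; exact: mul_continuous.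
by apply: (continuous_big mul_cont) => i _; exact: cA.
Qed.

Variables (n : nat) (z : 'I_n -> R) (alpha : R).

Lemma measurable_scattering d (X : measurableType d) (A : X -> 'M[R]_n) :
  (forall j l, measurable_fun setT (fun t => A t j l)) ->
  forall j l, measurable_fun setT (fun t => scattering z alpha (A t) j l).
Proof.
move=> mA j l.
have mM i k : measurable_fun setT (fun t => load_mx z (A t) i k).
  have -> : (fun t => load_mx z (A t) i k) = (fun t => diag_mx (\row_j z j) i k + A t i k).
    by apply/funext => t; rewrite /load_mx mxE.
  exact: measurable_funD.
have madj : measurable_fun setT (fun t => (\adj (load_mx z (A t))) j l).
  under eq_fun do rewrite mxE /cofactor.
  apply: measurable_funM => //; apply: measurable_det => i k.
  by under eq_fun do rewrite 2!mxE; exact: mM.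
under eq_fun do rewrite mxE.
apply: measurable_funB => //; apply: measurable_funM => //.
apply: measurable_maxr => //; apply: measurable_minr => //.
apply: measurable_funM => //.
by apply: (measurableT_comp measurable_inv); exact: measurable_det.
Qed.

Lemma continuous_scattering (A : R -> 'M[R]_n) : (forall j, 0 < z j) -> 0 < alpha ->
  (forall j l, continuous (fun t => A t j l)) ->
  (forall t, loewner_le (alpha%:M) (A t + (A t)^T)) ->
  forall j l, continuous (fun t => scattering z alpha (A t) j l).
Proof.
move=> z0 a0 cA co j l.
have cM i k : continuous (fun t => load_mx z (A t) i k).
  have -> : (fun t => load_mx z (A t) i k) = (fun t => diag_mx (\row_j z j) i k + A t i k).
    by apply/funext => t; rewrite /load_mx mxE.
  by move=> t; apply: cvgD; [exact: cvg_cst|exact: cA].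
have cadj : continuous (fun t => (\adj (load_mx z (A t))) j l).
  under eq_fun do rewrite mxE /cofactor.
  move=> t; apply: cvgM; first exact: cvg_cst.
  have h : continuous (fun t => \det (row' l (col' j (load_mx z (A t))))).
    apply: continuous_det => i k.
    by under eq_fun do rewrite 2!mxE; exact: cM.
  exact: h.
have -> : (fun t => scattering z alpha (A t) j l) =
    (fun t => (j == l)%:R - 2 * z j * invmx (load_mx z (A t)) j l).
  apply/funext => t; rewrite mxE.
  have Mu := load_mx_unit z0 a0 (co t).
  have -> : (\det (load_mx z (A t)))^-1 * (\adj (load_mx z (A t))) j l = invmx (load_mx z (A t)) j l.
    by rewrite /invmx Mu [RHS]mxE.
  by rewrite clip_id// invmx_load_bound.
move=> t; apply: cvgB; first exact: cvg_cst.
apply: cvgM; first exact: cvg_cst.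
have E s : invmx (load_mx z (A s)) j l = (\det (load_mx z (A s)))^-1 * (\adj (load_mx z (A s))) j l.
  by rewrite /invmx (load_mx_unit z0 a0 (co s)) [LHS]mxE.
rewrite E; under eq_cvg do rewrite E.
apply: cvgM; last exact: cadj.
apply: cvgV; last exact: continuous_det.
by have := load_mx_unit z0 a0 (co t); rewrite unitmxE unitfE.
Qed.

End regularity.

(** * Superposition of two waves *)

Section two_waves.
Context {R : realType}.
Local Notation mu := (@lebesgue_measure R).
Local Notation mu2 := (@lebesgue2 R).
Local Notation T := (measurableTypeR R).
Local Notation T2 := (T * T)%type.
Variables (p : \bar R) (hp : (1 <= p)%E) (F G : R -> R) (k k' a b : R).
Hypotheses (lF : Lp_loc p F) (lG : Lp_loc p G) (k0 : k != 0) (k'0 : k' != 0).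

Definition two_waves (z : R * R) : R := a * wave k F z + b * wave k' G z.

Let iF : loc_int F. Proof. exact: (Lp_loc_loc_int hp lF). Qed.
Let iG : loc_int G. Proof. exact: (Lp_loc_loc_int hp lG). Qed.

Lemma strip_integrable_two_waves : strip_integrable two_waves.
Proof. by apply: strip_integrable_lin; exact: strip_integrable_wave. Qed.

(** Minkowski's inequality, the two slices being bounded uniformly on bounded time
intervals. *)
Lemma L1loc_Lp_two_waves : L1loc_Lp p two_waves.
Proof.
split.
  exists two_waves; last exact: ae_eq_refl.
  by apply: measurable_funTS; case: strip_integrable_two_waves.
move=> S S0.
have scale (c : R) H : Lp_loc p H -> Lp_loc p (fun t => c * H t).
  by move=> lH; apply: (Lp_loc_mul hp) => // S'; exists `|c|.
have nk : - k != 0 by rewrite oppr_eq0.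
have nk' : - k' != 0 by rewrite oppr_eq0.
have [K1 K10 h1] := Lp_loc_slice hp S nk (scale a _ lF).
have [K2 K20 h2] := Lp_loc_slice hp S nk' (scale b _ lG).
apply: (@le_lt_trans _ _ (\int[mu]_(t in `[0%R, S]) (K1 + K2)%:E)%E); last first.
  rewrite integral_cst//= lebesgue_measure_itv/= lte_fin S0 sube0.
  by rewrite -EFinM ltry.
apply: ae_ge0_le_integral_nomeas.
- by move=> t _; exact: Lnorm_ge0.
- by move=> t _; rewrite lee_fin addr_ge0.
apply: aeW => t; rewrite /= in_itv/= => /andP[t0 tS].
have tS' : `|t| <= S by rewrite ger0_norm.
pose f x := a * F (- k * x + t); pose g x := b * G (- k' * x + t).
have mcut (H : R -> R) : measurable_fun setT H -> measurable_fun setT (H \_ `[0, 1] : R -> R).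
  move=> mH; apply: (@measurable_restrictT _ _ _ _ _ _ _).1; first exact: measurable_itv.
  exact: measurable_funTS.
have mf : measurable_fun setT f.
  by apply: measurable_funM => //; apply: measurable_line; case: lF.
have mg : measurable_fun setT g.
  by apply: measurable_funM => //; apply: measurable_line; case: lG.
rewrite EFinD; apply: le_trans (leeD (h1 _ tS') (h2 _ tS')).
apply: le_trans (eminkowski mu (mcut f mf) (mcut g mg) hp).
rewrite /Lp_norm01 le_eqVlt; apply/orP; left; apply/eqP; congr Lnorm.
apply/funext => x /=; congr EFin; rewrite !patchE; case: ifPn => _; last by rewrite addr0.
by rewrite /two_waves /wave /f /g /= !(addrC _ t) !mulNr.
Qed.

Lemma two_waves_trace_x0 : {ae mu, forall t, 0 < t ->
  avg_x0 two_waves t e @[e --> 0^'+] --> a * F t + b * G t}.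
Proof.
apply: (ae_imply2 _ (ae_lebesgue_pt iF) (ae_lebesgue_pt iG)).
move=> t Ft Gt _; apply: (@line_avg_two_waves _ F G _ (- k) (- k')) => //.
by apply: aeW => x _; rewrite /two_waves /wave /= !mulNr !(addrC _ t).
Qed.

Lemma two_waves_trace_x1 : {ae mu, forall t, 0 < t ->
  avg_x1 two_waves t e @[e --> 0^'+] --> a * F (t - k) + b * G (t - k')}.
Proof.
have pF := ae_affine (- k) (oner_neq0 R) (ae_lebesgue_pt iF).
have pG := ae_affine (- k') (oner_neq0 R) (ae_lebesgue_pt iG).
have self : ae_eq mu2 Omega two_waves two_waves by exact: ae_eq_refl.
have line := avg_x1_line strip_integrable_two_waves self.
apply: (ae_imply3 _ pF pG line).
move=> t; rewrite !mul1r => Ft Gt lt t0.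
have h : line_avg (fun x => two_waves (t, 1 - x)) e @[e --> 0^'+] --> a * F (t - k) + b * G (t - k').
  apply: (@line_avg_two_waves _ F G _ k k') => //.
  apply: aeW => x _; rewrite /two_waves /wave /=.
  by congr (_ * F _ + _ * G _); ring.
by apply: cvg_trans h; apply: near_eq_cvg; apply: filterS (lt t0) => e ->.
Qed.

Lemma two_waves_trace_t0 : {ae mu, forall x, 0 < x < 1 ->
  avg_t0 two_waves x e @[e --> 0^'+] --> a * F (- k * x) + b * G (- k' * x)}.
Proof.
have nk : - k != 0 by rewrite oppr_eq0.
have nk' : - k' != 0 by rewrite oppr_eq0.
have pF := ae_affine 0 nk (ae_lebesgue_pt iF).
have pG := ae_affine 0 nk' (ae_lebesgue_pt iG).
apply: (ae_imply2 _ pF pG).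
move=> x; rewrite !addr0 => Fx Gx _; apply: (@line_avg_two_waves _ F G _ 1 1) => //.
by apply: aeW => t _; rewrite /two_waves /wave /= !mul1r !mulNr.
Qed.

Lemma strict_extension_two_waves : strict_extension two_waves.
Proof.
split.
- apply: ae_imply two_waves_trace_x0 => t h /h; exact: cvgP.
- apply: ae_imply two_waves_trace_x1 => t h /h; exact: cvgP.
- apply: ae_imply two_waves_trace_t0 => t h /h; exact: cvgP.
Qed.

Lemma two_waves_hats :
  [/\ {ae mu, forall t, 0 < t -> hat_x0 two_waves t = a * F t + b * G t},
      {ae mu, forall t, 0 < t -> hat_x1 two_waves t = a * F (t - k) + b * G (t - k')} &
      {ae mu, forall x, 0 < x < 1 -> hat_t0 two_waves x = a * F (- k * x) + b * G (- k' * x)}].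
Proof.
split.
- by apply: ae_imply two_waves_trace_x0 => t h /h; exact: cvg_lim.
- by apply: ae_imply two_waves_trace_x1 => t h /h; exact: cvg_lim.
- by apply: ae_imply two_waves_trace_t0 => t h /h; exact: cvg_lim.
Qed.

End two_waves.

(** * Construction of a solution *)

Section construction.
Context {R : realType} {N : nat}.
Local Notation mu := (@lebesgue_measure R).
Local Notation mu2 := (@lebesgue2 R).
Local Notation n := (N + N)%N.
Variables (L C : 'I_N -> R).
Hypotheses (hL : forall k, 0 < L k) (hC : forall k, 0 < C k).
Variables (A : R -> 'M[R]_n) (alpha delta : R) (v0 i0 : 'I_N -> R -> R).
Hypotheses (alpha0 : 0 < alpha) (delta0 : 0 < delta).

Definition delay k := Num.sqrt (L k * C k).
Definition impedance k := Num.sqrt (L k / C k).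
Local Notation tau := delay.
Local Notation Z := impedance.

Hypothesis (delta_delay : forall k, delta <= delay k).

Lemma delay_gt0 k : 0 < tau k. Proof. by have [] := sqrt_impedance (hL k) (hC k). Qed.
Lemma impedance_gt0 k : 0 < Z k. Proof. by have [] := sqrt_impedance (hL k) (hC k). Qed.
Lemma inductanceE k : L k = tau k * Z k. Proof. by have [] := sqrt_impedance (hL k) (hC k). Qed.
Lemma capacitanceE k : C k = tau k / Z k. Proof. by have [] := sqrt_impedance (hL k) (hC k). Qed.

(** The ends at [x = 0] come first, then those at [x = 1]: the order of the
boundary condition. *)
Definition on_ends (S : Type) (f g : 'I_N -> S) (j : 'I_n) : S :=
  match fintype.split j with inl k => f k | inr k => g k end.

Lemma on_ends_l S (f g : 'I_N -> S) k : on_ends f g (lshift N k) = f k.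
Proof.
rewrite /on_ends; case: fintype.split_ordP => j => [/lshift_inj ->|/eqP] //.
by rewrite eq_lrshift.
Qed.

Lemma on_ends_r S (f g : 'I_N -> S) k : on_ends f g (rshift N k) = g k.
Proof.
rewrite /on_ends; case: fintype.split_ordP => j => [/eqP|/rshift_inj ->] //.
by rewrite eq_rlshift.
Qed.

Lemma on_endsP (P : 'I_n -> Prop) : (forall k, P (lshift N k)) ->
  (forall k, P (rshift N k)) -> forall j, P j.
Proof. by move=> hl hr j; case: (fintype.split_ordP j) => k ->. Qed.

Definition other_end : 'I_n -> 'I_n := on_ends (@rshift N N) (@lshift N N).
Definition end_delay : 'I_n -> R := on_ends delay delay.
Definition end_impedance : 'I_n -> R := on_ends impedance impedance.

(** The initial data give the wave leaving the end [x = 0] at time [- tau x] and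
the one leaving the end [x = 1] at time [- tau (1 - x)]: these are the
characteristics through [(0, x)]. *)
Definition initial_wave : 'I_n -> R -> R := on_ends
  (fun k s => 2^-1 * v0 k (- (tau k)^-1 * s + 0) + Z k / 2 * i0 k (- (tau k)^-1 * s + 0))
  (fun k s => 2^-1 * v0 k ((tau k)^-1 * s + 1) + - (Z k / 2) * i0 k ((tau k)^-1 * s + 1)).

(** The waves leaving each end, as functions of the time of departure. *)
Definition outgoing : 'I_n -> R -> R :=
  delay_sol (fun t => scattering end_impedance alpha (A t)) other_end end_delay initial_wave delta.

(** The wave leaving the end [x = 1], indexed by its arrival at [x = 0]. *)
Definition incoming k (s : R) := outgoing (rshift N k) (1 * s + - tau k).

Definition voltage k := two_waves (outgoing (lshift N k)) (incoming k) (tau k) (- tau k) 1 1.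
Definition current k :=
  two_waves (outgoing (lshift N k)) (incoming k) (tau k) (- tau k) (Z k)^-1 (- (Z k)^-1).

Let delta_end j : delta <= end_delay j.
Proof. by elim/on_endsP: j => k; rewrite /end_delay ?on_ends_l ?on_ends_r. Qed.

Lemma end_impedance_gt0 j : 0 < end_impedance j.
Proof. by elim/on_endsP: j => k; rewrite /end_impedance ?on_ends_l ?on_ends_r impedance_gt0. Qed.

(** The recursion of the delay system is [U = scattering W], so
[scattering_boundary] applies. *)
Lemma outgoing_boundary t : 0 < t -> loewner_le (alpha%:M) (A t + (A t)^T) ->
  col_mx (\col_k (outgoing (lshift N k) t + incoming k t))
         (\col_k (outgoing (lshift N k) (t - tau k) + incoming k (t + tau k))) =
  A t *m col_mx (\col_k - ((Z k)^-1 * (outgoing (lshift N k) t - incoming k t)))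
         (\col_k ((Z k)^-1 * (outgoing (lshift N k) (t - tau k) - incoming k (t + tau k)))).
Proof.
move=> t0 co; set y := col_mx (\col_k - _) _.
have inc k : incoming k t = outgoing (rshift N k) (t - tau k) by rewrite /incoming mul1r.
have inc' k : incoming k (t + tau k) = outgoing (rshift N k) t.
  by rewrite /incoming mul1r addrK.
pose U : 'cV[R]_n := \col_j outgoing j t.
pose W : 'cV[R]_n := \col_j outgoing (other_end j) (t - end_delay j).
have UE : U = scattering end_impedance alpha (A t) *m W.
  apply/matrixP => j i; rewrite (ord1 i) !mxE /outgoing delay_sol_recursion//.
  by apply: eq_bigr => l _; rewrite [W _ _]mxE.
have yE j : end_impedance j * y j 0 = W j 0 - U j 0.
  rewrite [W _ _]mxE [U _ _]mxE.
  elim/on_endsP: j => k; rewrite /end_impedance /other_end /end_delay /y.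
    rewrite !on_ends_l col_mxEu mxE inc mulrN mulrA divff ?gt_eqF ?impedance_gt0//.
    by rewrite mul1r opprB.
  rewrite !on_ends_r col_mxEd mxE inc' mulrA divff ?gt_eqF ?impedance_gt0//.
  by rewrite mul1r.
rewrite -(scattering_boundary end_impedance_gt0 alpha0 co UE yE).
apply/matrixP => j i; rewrite (ord1 i) [RHS]mxE [W _ _]mxE [U _ _]mxE.
elim/on_endsP: j => k; rewrite /other_end /end_delay.
  by rewrite !on_ends_l col_mxEu mxE inc.
by rewrite !on_ends_r col_mxEd mxE inc' addrC.
Qed.

Lemma outgoing_initial k x : 0 <= x <= 1 ->
  outgoing (lshift N k) (- tau k * x) = 2^-1 * v0 k x + Z k / 2 * i0 k x /\
  incoming k (- - tau k * x) = 2^-1 * v0 k x + - (Z k / 2) * i0 k x.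
Proof.
move=> /andP[x0 x1]; have t0 := delay_gt0 k.
have tn0 : tau k != 0 by rewrite gt_eqF.
split.
  rewrite /outgoing delay_sol_init; last by rewrite mulNr oppr_le0 mulr_ge0// ltW.
  rewrite /initial_wave on_ends_l.
  by rewrite (_ : - (tau k)^-1 * (- tau k * x) + 0 = x)//; field.
rewrite /incoming /outgoing delay_sol_init; last first.
  by rewrite opprK mul1r -{2}(mulr1 (tau k)) -mulrBr pmulr_rle0// subr_le0.
rewrite /initial_wave on_ends_r.
by rewrite (_ : (tau k)^-1 * (1 * (- - tau k * x) + - tau k) + 1 = x)//; field.
Qed.

Section regularity.
Variables (p : \bar R) (hp : (1 <= p)%E).
Hypothesis mA : forall j l, measurable_fun setT (fun t => A t j l).
Hypothesis lv0 : forall k, Lp_loc p (v0 k).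
Hypothesis li0 : forall k, Lp_loc p (i0 k).

Lemma outgoing_Lp_loc j : Lp_loc p (outgoing j).
Proof.
apply: delay_sol_Lp_loc => //.
- by move=> i l; exact: measurable_scattering.
- move=> S; exists (\sum_j (1 + 2 * end_impedance j * (2 / alpha))) => t _ i l.
  apply: le_trans (scattering_bound end_impedance_gt0 alpha0 _ i l) _.
  rewrite [leRHS](bigD1 i)//= lerDl; apply: sumr_ge0 => q _.
  rewrite addr_ge0// mulr_ge0// ?mulr_ge0 ?invr_ge0 ?(ltW alpha0)//.
  by rewrite ltW ?end_impedance_gt0.
- have scale (c : R) H : Lp_loc p H -> Lp_loc p (fun t => c * H t).
    by move=> lH; apply: (Lp_loc_mul hp) => // S'; exists `|c|.
  have ti k : (tau k)^-1 != 0 by rewrite invr_eq0 gt_eqF ?delay_gt0.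
  have ti' k : - (tau k)^-1 != 0 by rewrite oppr_eq0.
  elim/on_endsP => k; rewrite /initial_wave ?on_ends_l ?on_ends_r;
    by apply: Lp_locD => //; apply: scale; apply: Lp_loc_affine.
Qed.

Lemma incoming_Lp_loc k : Lp_loc p (incoming k).
Proof. by apply: Lp_loc_affine; rewrite ?oner_neq0//; exact: outgoing_Lp_loc. Qed.

Let tn k : tau k != 0. Proof. by rewrite gt_eqF ?delay_gt0. Qed.
Let tn' k : - tau k != 0. Proof. by rewrite oppr_eq0. Qed.

(** The coefficients and data of the construction are Borel; those of the
problem agree with them almost everywhere, which is all that traces and
boundary condition see. *)
Lemma constructed_solution (A' : R -> 'M[R]_n) (v0' i0' : 'I_N -> R -> R) :
  {ae mu, forall t, 0 <= t -> A t = A' t} ->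
  {ae mu, forall t, 0 <= t -> loewner_le (alpha%:M) (A t + (A t)^T)} ->
  (forall k, {ae mu, forall x, 0 < x < 1 -> v0 k x = v0' k x}) ->
  (forall k, {ae mu, forall x, 0 < x < 1 -> i0 k x = i0' k x}) ->
  telegrapher_solution L C p A' v0' i0' voltage current.
Proof.
move=> AA' co vv' ii'.
have lF k := outgoing_Lp_loc (lshift N k); have lG k := incoming_Lp_loc k.
have iF k := strip_integrable_wave (tau k) (Lp_loc_loc_int hp (lF k)).
have iG k := strip_integrable_wave (- tau k) (Lp_loc_loc_int hp (lG k)).
have hv k := two_waves_hats hp 1 1 (lF k) (lG k) (tn k) (tn' k).
have hi k := two_waves_hats hp (Z k)^-1 (- (Z k)^-1) (lF k) (lG k) (tn k) (tn' k).
have strips k a b := strip_integrable_two_waves hp (tau k) (- tau k) a b (lF k) (lG k).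
have weak k phi : test_function phi ->
   tau k * pair_with (wave (tau k) (outgoing (lshift N k))) (dt phi) +
     pair_with (wave (tau k) (outgoing (lshift N k))) (dx phi) = 0 /\
   - tau k * pair_with (wave (- tau k) (incoming k)) (dt phi) +
     pair_with (wave (- tau k) (incoming k)) (dx phi) = 0.
  move=> tphi; split.
    exact: (weak_transportE _ (iF k)).1 (weak_transport_wave _ (Lp_loc_loc_int hp (lF k))) _ tphi.
  exact: (weak_transportE _ (iG k)).1 (weak_transport_wave _ (Lp_loc_loc_int hp (lG k))) _ tphi.
have refl (h : R * R -> R) : ae_eq mu2 Omega h h by exact: ae_eq_refl.
split.
- by move=> k; split; exact: L1loc_Lp_two_waves.
- by move=> k; split; exact: (strict_extension_two_waves hp).
- move=> k; have [_ _ v3] := hv k; have [_ _ i3] := hi k.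
  apply: (ae_imply4 _ v3 i3 (vv' k) (ii' k)) => x e1 e2 e3 e4 x01.
  have x01' : 0 <= x <= 1 by move: x01 => /andP[/ltW -> /ltW ->].
  rewrite /voltage /current e1// e2// -e3// -e4//.
  have [-> ->] := outgoing_initial k x01'.
  have := impedance_gt0 k; move: (Z k) => c c0; have cn0 : c != 0 by rewrite gt_eqF.
  by split; field.
- move=> k phi tphi; rewrite (integral_pairing _ tphi (strips _ _ _) (strips _ _ _) (refl _) (refl _)).
  have Dt : dt phi = dt phi \/ dt phi = dx phi by left.
  have Dx : dx phi = dt phi \/ dx phi = dx phi by right.
  rewrite (pair_with_lin _ _ tphi Dt (iF k) (iG k)) (pair_with_lin _ _ tphi Dx (iF k) (iG k)).
  have [] := weak k phi tphi; rewrite inductanceE => h1 h2; congr EFin; move: h1 h2.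
  move: (pair_with _ _) (pair_with _ _) (pair_with _ _) (pair_with _ _) => q1 q2 q3 q4.
  have := impedance_gt0 k; move: (Z k) (tau k) => c t c0 h1 h2; have cn0 : c != 0 by rewrite gt_eqF.
  by rewrite -[RHS](addr0 0) -{1}h1 -h2; field.
- move=> k phi tphi; rewrite (integral_pairing _ tphi (strips _ _ _) (strips _ _ _) (refl _) (refl _)).
  have Dt : dt phi = dt phi \/ dt phi = dx phi by left.
  have Dx : dx phi = dt phi \/ dx phi = dx phi by right.
  rewrite (pair_with_lin _ _ tphi Dt (iF k) (iG k)) (pair_with_lin _ _ tphi Dx (iF k) (iG k)).
  have [] := weak k phi tphi; rewrite capacitanceE => h1 h2; congr EFin; move: h1 h2.
  move: (pair_with _ _) (pair_with _ _) (pair_with _ _) (pair_with _ _) => q1 q2 q3 q4.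
  have := impedance_gt0 k; move: (Z k) (tau k) => c t c0 h1 h2; have cn0 : c != 0 by rewrite gt_eqF.
  have : c^-1 * (t * q4 + q3) - c^-1 * (- t * q2 + q1) = 0 by rewrite h1 h2 !mulr0 subr0.
  by move=> <-; field.
- have hats : {ae mu, forall t, forall k, 0 < t ->
     [/\ hat_x0 (voltage k) t = outgoing (lshift N k) t + incoming k t,
         hat_x1 (voltage k) t = outgoing (lshift N k) (t - tau k) + incoming k (t + tau k),
         hat_x0 (current k) t = (Z k)^-1 * (outgoing (lshift N k) t - incoming k t) &
         hat_x1 (current k) t =
           (Z k)^-1 * (outgoing (lshift N k) (t - tau k) - incoming k (t + tau k))]}.
    apply: ae_forall_countable => k; have [v1 v2 _] := hv k; have [i1 i2 _] := hi k.
    apply: (ae_imply4 _ v1 v2 i1 i2) => t e1 e2 e3 e4 t0.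
    rewrite /voltage /current e1// e2// e3// e4// !mul1r !opprK.
    by split=> //; rewrite mulNr mulrBr.
  apply: (ae_imply3 _ hats AA' co) => t ht At ct t0.
  have -> : (\col_k hat_x0 (voltage k) t : 'cV_N) =
      \col_k (outgoing (lshift N k) t + incoming k t).
    by apply/matrixP => k q; rewrite !mxE; have [] := ht k t0.
  have -> : (\col_k hat_x1 (voltage k) t : 'cV_N) =
      \col_k (outgoing (lshift N k) (t - tau k) + incoming k (t + tau k)).
    by apply/matrixP => k q; rewrite !mxE; have [] := ht k t0.
  have -> : (\col_k - hat_x0 (current k) t : 'cV_N) =
      \col_k - ((Z k)^-1 * (outgoing (lshift N k) t - incoming k t)).
    by apply/matrixP => k q; rewrite !mxE; have [_ _ -> _] := ht k t0.
  have -> : (\col_k hat_x1 (current k) t : 'cV_N) =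
      \col_k ((Z k)^-1 * (outgoing (lshift N k) (t - tau k) - incoming k (t + tau k))).
    by apply/matrixP => k q; rewrite !mxE; have [_ _ _ ->] := ht k t0.
  by rewrite -At ?ltW//; apply: outgoing_boundary => //; apply: ct; exact: ltW.
Qed.

End regularity.
End construction.

(** * Data: continuity up to the boundary, integrability *)

Section clamping.
Context {R : realType}.
Local Notation mu := (@lebesgue_measure R).

Lemma continuous_retract (U : topologicalType) (S : set R) (r : R -> R) (f : R -> U) :
  continuous r -> (forall x, S (r x)) -> {within S, continuous f} ->
  continuous (f \o r).
Proof.
move=> cr Sr /subspace_continuousP cf x.
apply: (@cvg_comp _ _ _ r f _ (within S (nbhs (r x)))); last exact: cf.
move=> P; rewrite /within/= => hP.
have h : \forall y \near x, S (r y) -> P (r y) := cr x _ hP.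
apply: (@filterS _ (nbhs x) _ (fun y => S (r y) -> P (r y)) (fun y => P (r y)) _ h).
by move=> y; apply; exact: Sr.
Qed.

(** A negative value would persist on an interval, which is not null. *)
Lemma continuous_ae_ge0 (f : R -> R) : continuous f ->
  {ae mu, forall t, 0 <= t -> 0 <= f t} -> forall t, 0 <= t -> 0 <= f t.
Proof.
move=> cf [M [mM M0 sub]] t t0; rewrite leNgt; apply/negP => ft.
have : \forall s \near t, f s < 0 by exact: (cvgr_lt (f t) (cf t) 0 ft).
move=> [d /= d0 hd].
have dM : `]t, t + d[ `<=` M.
  move=> s /=; rewrite in_itv/= => /andP[ts st]; apply: sub => /= h.
  have s0 : 0 <= s by rewrite (le_trans t0)// ltW.
  have : f s < 0.
    by apply: hd => /=; rewrite ltr_distlC; apply/andP; split; lra.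
  by rewrite ltNge h.
have : (mu `]t, (t + d)%R[ <= mu M)%E by apply: le_measure; rewrite ?inE.
rewrite M0 lebesgue_measure_itv/= lte_fin ltrDl d0 -EFinD lee_fin.
by rewrite addrAC subrr add0r leNgt d0.
Qed.

Definition clamp01 (x : R) := Num.max 0 (Num.min 1 x).

Lemma continuous_max0 : continuous (fun t : R => Num.max t 0).
Proof. by move=> t; apply: continuous_max; [exact: cvg_id|exact: cvg_cst]. Qed.

Lemma continuous_clamp01 : continuous clamp01.
Proof.
move=> t; apply: continuous_max; first exact: cvg_cst.
by apply: continuous_min; [exact: cvg_cst|exact: cvg_id].
Qed.

Lemma clamp01_in x : 0 <= clamp01 x <= 1.
Proof. by rewrite /clamp01 le_max lexx/= ge_max ler01 ge_min lexx. Qed.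

Lemma clamp01_id x : 0 <= x <= 1 -> clamp01 x = x.
Proof. by move=> /andP[x0 x1]; rewrite /clamp01 min_r// max_r. Qed.

End clamping.

Section data.
Context {R : realType}.
Local Notation mu := (@lebesgue_measure R).
Variables (p : \bar R) (hp : (1 <= p)%E).

Lemma Lp_loc_Lp (F : R -> R) : measurable_fun setT F ->
  (Lnorm mu p (EFin \o F) < +oo)%E -> Lp_loc p F.
Proof.
move=> mF iF; split=> // T.
have [K K0 hK] := Lnorm_affine_dominated hp (oner_neq0 R) ler01.
apply: (@le_lt_trans _ _ (K%:E * Lnorm mu p (EFin \o F))%E).
  apply: (hK 0) => // r; rewrite /cut patchE !mul1r addr0.
  by case: ifPn => // _; rewrite normr0.
by apply: lte_mul_pinfty => //; rewrite lee_fin.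
Qed.

Lemma Lp_loc_cst (c : R) : Lp_loc p (cst c).
Proof.
have l1 : Lp_loc p (cst 1).
  split=> // T.
  pose J : set R := `[- T, T]%classic.
  have b (x : R) : (`|(EFin \o cut T (cst 1%R)) x| = (\1_J x)%:E)%E.
    by rewrite /= /cut patchE indicE; case: (_ \in _); rewrite /= ?normr1 ?normr0.
  have fin : (mu J < +oo)%E.
    by rewrite lebesgue_measure_itv/=; case: ifPn => _; rewrite ?ltry// -EFinD ltry.
  rewrite unlock; case: p hp => [r r1|_|//].
    have r0 : r != 0 by rewrite gt_eqF// (lt_le_trans ltr01)// -lee_fin.
    apply: poweR_lty; apply: le_lt_trans fin.
    have mJ : measurable J by exact: measurable_itv.
    rewrite -[J]setIT -(@integral_indic _ _ _ mu setT measurableT J mJ).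
    under eq_integral do rewrite b.
    apply: ae_ge0_le_integral_nomeas => //.
      by move=> x _; exact: poweR_ge0.
    apply: aeW => x _; rewrite indicE; case: (_ \in _); rewrite ?poweR1r//.
    by rewrite poweR0r.
  rewrite lebesgue_setT_gt0; apply: (@le_lt_trans _ _ 1%E); last exact: ltry.
  apply/ess_supP; apply: aeW => x; rewrite /comp [leLHS]b lee_fin indicE.
  by case: (_ \in _).
have := Lp_loc_mul hp (measurable_cst c) _ l1; rewrite /cst.
have E : (fun t : R => c * 1) = cst c by apply/funext => t; rewrite mulr1.
by rewrite E; apply => T; exists `|c|.
Qed.

Lemma Lp_loc_bounded (F : R -> R) (M : R) : measurable_fun setT F ->
  (forall x, `|F x| <= M) -> Lp_loc p F.
Proof.
move=> mF FM; have l1 := Lp_loc_cst 1.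
have := Lp_loc_mul hp mF _ l1.
have E : (fun t => F t * cst 1 t) = F by apply/funext => t; rewrite /cst mulr1.
by rewrite E; apply => T; exists M.
Qed.

Lemma Lp01_Lp_loc (f : R -> R) : Lp01 p f -> exists2 g : R -> R, Lp_loc p g &
  {ae mu, forall x, 0 < x < 1 -> g x = f x}.
Proof.
move=> [[g mg fg] fp]; pose h : R -> R := g \_ `[0, 1].
have hf : {ae mu, forall x, 0 < x < 1 -> h x = f x}.
  apply: ae_imply fg => x hx /andP[x0 x1].
  rewrite /h patchE mem_set/=; last by rewrite in_itv/= !ltW.
  by apply/esym/hx; rewrite /= in_itv/= !ltW.
exists h => //; apply: Lp_loc_Lp.
  by apply: (@measurable_restrictT _ _ _ _ _ _ _).1; first exact: measurable_itv.
move: fp; rewrite -(ae_eq_Lp_norm01 p hf) /Lp_norm01.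
have -> : h \_ `[0, 1] = h; last by [].
by apply/funext => x; rewrite /h !patchE; case: (x \in _).
Qed.

(** Composing with the retraction onto [[0, 1]] extends continuous data to
continuous data on the line. *)
Lemma clamped_Lp_loc (f : R -> R) : {within `[0, 1], continuous f} ->
  continuous (f \o clamp01) /\ Lp_loc p (f \o clamp01).
Proof.
move=> cf; have cfc : continuous (f \o clamp01).
  apply: continuous_retract cf; first exact: continuous_clamp01.
  by move=> x; rewrite /= in_itv/=; exact: clamp01_in.
split=> //.
have K := @segment_compact R 0 1.
have [M [_ hM]] := compact_bounded (continuous_compact cf K).
apply: (@Lp_loc_bounded _ (M + 1)); first exact: continuous_measurable_fun.
move=> x; apply: (hM (M + 1)); first by rewrite ltrDl.
by exists (clamp01 x) => //; rewrite /= in_itv/=; exact: clamp01_in.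
Qed.

End data.

(** * Continuity of the constructed solution *)

(** Conversely to [scattering_boundary]: the difference of two pairs [(U, y)] with
the same [W] is excluded by [coercive_dissipation]. *)
Lemma scattering_unique (R : realType) n (z : 'I_n -> R) (alpha : R) (A : 'M[R]_n)
    (U W y : 'cV[R]_n) : (forall j, 0 < z j) -> 0 < alpha ->
  loewner_le (alpha%:M) (A + A^T) ->
  (forall j, z j * y j 0 = W j 0 - U j 0) -> U + W = A *m y ->
  U = scattering z alpha A *m W.
Proof.
move=> z0 a0 co yE UW; set U' := _ *m W.
pose y' : 'cV[R]_n := \col_j ((z j)^-1 * (W j 0 - U' j 0)).
have yE' j : z j * y' j 0 = W j 0 - U' j 0.
  by rewrite mxE mulrA divff ?mul1r// gt_eqF.
have UW' : U' + W = A *m y' := scattering_boundary z0 a0 co erefl yE'.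
have yy : y - y' = 0.
  apply: (coercive_dissipation a0 co z0) => j.
  have entryB (X Y : 'cV[R]_n) i : (X - Y) i 0 = X i 0 - Y i 0 by rewrite !mxE.
  have -> : A *m (y - y') = U - U'.
    by rewrite mulmxBr -UW -UW' opprD addrACA subrr addr0.
  by rewrite !entryB mulrBr yE yE' addrC opprB addrA subrK opprB.
apply/matrixP => j i; rewrite (ord1 i).
have := yE j; rewrite (subr0_eq yy) yE' => /(addrI _) /oppr_inj.
by [].
Qed.

Section continuity.
Context {R : realType} {N : nat}.
Variables (L C : 'I_N -> R).
Hypotheses (hL : forall k, 0 < L k) (hC : forall k, 0 < C k).
Variables (A : R -> 'M[R]_(N + N)) (alpha delta : R) (v0 i0 : 'I_N -> R -> R).
Hypotheses (alpha0 : 0 < alpha) (delta0 : 0 < delta).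
Hypothesis (delta_delay : forall k, delta <= delay L C k).
Hypothesis cA : forall j l, continuous (fun t => A t j l).
Hypothesis coA : forall t, loewner_le (alpha%:M) (A t + (A t)^T).
Hypothesis cv0 : forall k, continuous (v0 k).
Hypothesis ci0 : forall k, continuous (i0 k).
Hypothesis compat : col_mx (\col_k v0 k 0) (\col_k v0 k 1) =
     A 0 *m col_mx (\col_k - i0 k 0) (\col_k i0 k 1).

Let t0 k : 0 < delay L C k. Proof. exact: delay_gt0. Qed.

Let continuous_line (f : R -> R) (a b : R) : continuous f -> continuous (fun s => f (a * s + b)).
Proof.
move=> cf s; apply: (@continuous_comp _ _ _ (fun s : R => a * s + b) f); last exact: cf.
apply: cvgD; last exact: cvg_cst.
by apply: cvgM; [exact: cvg_cst|exact: cvg_id].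
Qed.

(** The compatibility condition is the boundary condition at time [0], which by
[scattering_unique] is the matching condition of the delay system. *)
Lemma outgoing_continuous j : continuous (outgoing L C A alpha delta v0 i0 j).
Proof.
apply: delay_sol_continuous => //.
- by move=> i; elim/(@on_endsP N): i => k; rewrite /end_delay ?on_ends_l ?on_ends_r.
- by move=> i l; apply: continuous_scattering => //; exact: end_impedance_gt0.
- move=> i; elim/(@on_endsP N): i => k; rewrite /initial_wave ?on_ends_l ?on_ends_r => s;
    by apply: cvgD; (apply: cvgM; first exact: cvg_cst); exact: continuous_line.
move=> {}j; set init := initial_wave L C v0 i0.
pose U : 'cV[R]_(N + N) := \col_j init j 0.
pose W : 'cV[R]_(N + N) := \col_j init (other_end j) (- end_delay L C j).
have bl k : init (lshift N k) 0 = 2^-1 * v0 k 0 + impedance L C k / 2 * i0 k 0.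
  by rewrite /init /initial_wave on_ends_l mulr0 addr0.
have br k : init (rshift N k) 0 = 2^-1 * v0 k 1 + - (impedance L C k / 2) * i0 k 1.
  by rewrite /init /initial_wave on_ends_r mulr0 add0r.
have wl k : init (lshift N k) (- delay L C k) = 2^-1 * v0 k 1 + impedance L C k / 2 * i0 k 1.
  rewrite /init /initial_wave on_ends_l addr0 mulrN mulNr opprK mulVf ?gt_eqF ?t0//.
have wr k : init (rshift N k) (- delay L C k) = 2^-1 * v0 k 0 + - (impedance L C k / 2) * i0 k 0.
  by rewrite /init /initial_wave on_ends_r mulrN mulVf ?gt_eqF ?t0// addNr.
have UE : U = scattering (end_impedance L C) alpha (A 0) *m W.
  apply: (@scattering_unique _ _ _ _ _ _ _ (col_mx (\col_k - i0 k 0) (\col_k i0 k 1))) => //.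
  - exact: end_impedance_gt0.
  - move=> i; rewrite [W _ _]mxE [U _ _]mxE; elim/(@on_endsP N): i => k;
      rewrite /end_impedance /other_end /end_delay.
      by rewrite !on_ends_l col_mxEu mxE bl wr; field.
    by rewrite !on_ends_r col_mxEd mxE br wl; field.
  - rewrite -compat; apply/matrixP => i q; rewrite (ord1 q) [LHS]mxE [W _ _]mxE [U _ _]mxE.
    elim/(@on_endsP N): i => k; rewrite /other_end /end_delay.
      by rewrite !on_ends_l col_mxEu [RHS]mxE bl wr; field.
    by rewrite !on_ends_r col_mxEd [RHS]mxE br wl; field.
have := congr1 (fun M : 'cV_(N + N) => M j 0) UE; rewrite [U _ _]mxE => ->.
by rewrite mxE; apply: eq_bigr => l _; rewrite [W _ _]mxE.
Qed.

Lemma continuous_two_waves (F G : R -> R) k k' a b : continuous F -> continuous G ->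
  continuous (two_waves F G k k' a b).
Proof.
move=> cF cG.
have cw (H : R -> R) q : continuous H -> continuous (wave q H).
  move=> cH z; apply: (@continuous_comp _ _ _ (fun z : R * R => z.1 - q * z.2) H); last exact: cH.
  apply: cvgB; first exact: cvg_fst.
  by apply: cvgM; [exact: cvg_cst|exact: cvg_snd].
by move=> z; apply: cvgD; (apply: cvgM; first exact: cvg_cst); exact: cw.
Qed.

Lemma voltage_current_continuous k :
  continuous (voltage L C A alpha delta v0 i0 k) /\
  continuous (current L C A alpha delta v0 i0 k).
Proof.
by split; apply: continuous_two_waves; do ?exact: outgoing_continuous;
  apply: continuous_line; exact: outgoing_continuous.
Qed.

Lemma voltage_current_initial k x : 0 <= x <= 1 ->
  voltage L C A alpha delta v0 i0 k (0, x) = v0 k x /\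
  current L C A alpha delta v0 i0 k (0, x) = i0 k x.
Proof.
move=> x01; rewrite /voltage /current /two_waves /wave /= !sub0r -!mulNr.
have [-> ->] := outgoing_initial hL hC A alpha delta v0 i0 k x01.
have := impedance_gt0 hL hC k; move: (impedance L C k) => c c0.
have cn0 : c != 0 by rewrite gt_eqF.
by split; field.
Qed.

End continuity.

(** * Well-posedness *)

Theorem theorem2p8 (R : realType) (N : nat) (hN : (0 < N)%N)
    (L C : 'I_N -> R) (hL : forall k, 0 < L k) (hC : forall k, 0 < C k)
    (p : \bar R) (hp : (1 <= p)%E)
    (A : R -> 'M[R]_(N + N))
    (A_meas : forall j l, ae_measurable lebesgue_measure [set t : R | 0 <= t]
                            (fun t => A t j l))
    (A_bounded : exists M : R, {ae @lebesgue_measure R, forall t, 0 <= t ->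
                   forall j l, `|A t j l| <= M})
    (A_coercive : exists2 alpha : R, 0 < alpha &
       {ae @lebesgue_measure R, forall t, 0 <= t ->
          loewner_le (alpha%:M) (A t + (A t)^T)}) :
  forall v0 i0 : 'I_N -> R -> R,
  (forall k, Lp01 p (v0 k) /\ Lp01 p (i0 k)) ->
  (* Part I *)
  ((exists v i, telegrapher_solution L C p A v0 i0 v i) /\
   (forall v i v' i',
      telegrapher_solution L C p A v0 i0 v i ->
      telegrapher_solution L C p A v0 i0 v' i' ->
      forall k, ae_eq lebesgue2 Omega (v k) (v' k) /\
                ae_eq lebesgue2 Omega (i k) (i' k)))
  /\
  (* Part II *)
  ({within [set t : R | 0 <= t], continuous A} ->
   (forall k, {within `[0, 1], continuous (v0 k)} /\
              {within `[0, 1], continuous (i0 k)}) ->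
   col_mx (\col_k v0 k 0) (\col_k v0 k 1) =
     A 0 *m col_mx (\col_k - i0 k 0) (\col_k i0 k 1) ->
   forall v i, telegrapher_solution L C p A v0 i0 v i ->
   exists vc ic : 'I_N -> R * R -> R, forall k,
     [/\ ae_eq lebesgue2 Omega (v k) (vc k) /\
           ae_eq lebesgue2 Omega (i k) (ic k),
         {within Omega_bar, continuous (vc k)} /\
           {within Omega_bar, continuous (ic k)} &
         forall x, 0 <= x <= 1 -> vc k (0, x) = v0 k x /\ ic k (0, x) = i0 k x]).
Proof.
have [alpha a0 co] := A_coercive.
have [delta d0 dd] := min_delay (delay_gt0 hL hC).
move=> v0 i0 lp; split; first split.
- have dataP (f : 'I_N -> R -> R) : (forall k, Lp01 p (f k)) ->
      exists g : 'I_N -> R -> R, forall k, Lp_loc p (g k) /\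
        {ae @lebesgue_measure R, forall x, 0 < x < 1 -> g k x = f k x}.
    move=> lf; have ex k : exists g : R -> R, Lp_loc p g /\
        {ae @lebesgue_measure R, forall x, 0 < x < 1 -> g x = f k x}.
      by have [g lg gf] := Lp01_Lp_loc hp (lf k); exists g.
    by have [g hg] := choice ex; exists g.
  have [w0 hw0] := dataP v0 (fun k => (lp k).1).
  have [j0 hj0] := dataP i0 (fun k => (lp k).2).
  (* Borel coefficients on the whole line, zero at negative times. *)
  have rep (jl : 'I_(N + N) * 'I_(N + N)) : exists g : R -> R, measurable_fun setT g /\
      {ae @lebesgue_measure R, forall t, 0 <= t -> g t = A t jl.1 jl.2}.
    have [g mg Ag] := A_meas jl.1 jl.2; pose S : set R := [set t : R | 0 <= t].
    have mS : measurable S.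
      by rewrite (_ : S = `[0, +oo[%classic)// /S; apply/seteqP; split => t /=; rewrite in_itv/= andbT.
    exists (g \_ S); split; first exact: ((@measurable_restrictT _ _ _ _ _ g mS).1 mg).
    apply: ae_imply Ag => t h t0.
    by rewrite patchE mem_set// h.
  have [g hg] := choice rep.
  pose B t : 'M[R]_(N + N) := \matrix_(j, l) g (j, l) t.
  have BA : {ae @lebesgue_measure R, forall t, 0 <= t -> B t = A t}.
    have h := ae_forall_countable (fun jl => (hg jl).2).
    apply: ae_imply h => t ht t0.
    by apply/matrixP => j l; rewrite mxE (ht (j, l)).
  exists (voltage L C B alpha delta w0 j0), (current L C B alpha delta w0 j0).
  apply: (constructed_solution hL hC a0 d0 dd hp) => //.
  + by move=> j l; under eq_fun do rewrite mxE; case: (hg (j, l)).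
  + by move=> k; case: (hw0 k).
  + by move=> k; case: (hj0 k).
  + apply: (ae_imply2 _ BA co) => t h1 h2 t0.
    by rewrite h1//; exact: h2.
  + by move=> k; case: (hw0 k).
  + by move=> k; case: (hj0 k).
- move=> v i v' i' sol sol' k.
  exact: (telegrapher_solution_unique hL hC hp A_coercive sol sol').
move=> cA cdata compat v i sol.
(* Frozen at negative times, [A] is continuous on the line, and by continuity
   coercive everywhere. *)
pose B t := A (Num.max t 0).
have Bid t : 0 <= t -> B t = A t by move=> t0; rewrite /B max_l.
have cB : continuous (B : R -> 'M[R]_(N + N)).
  apply: continuous_retract cA; first exact: continuous_max0.
  by move=> t; rewrite /= le_max lexx orbT.
have cBjl j l : continuous (fun t => B t j l).
  move=> t; apply: (@continuous_comp _ _ _ B (fun M : 'M[R]_(N + N) => M j l)); first exact: cB.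
  exact: coord_continuous.
have coB t : loewner_le (alpha%:M) (B t + (B t)^T).
  have nonneg s : 0 <= s -> loewner_le (alpha%:M) (B s + (B s)^T).
    move=> s0 y.
    pose q u := \sum_i (\sum_j y j 0 * (B u j i + B u i j - alpha *+ (j == i))) * y i 0.
    have qE u : ((y^T *m (B u + (B u)^T - alpha%:M)) *m y) 0 0 = q u.
      rewrite mxE; apply: eq_bigr => i1 _; congr (_ * _).
      by rewrite mxE; apply: eq_bigr => j1 _; rewrite !mxE.
    rewrite qE; apply: continuous_ae_ge0 s s0.
      apply: continuous_sum => i1 u; apply: cvgM; last exact: cvg_cst.
      apply: continuous_sum => j1 {}u; apply: cvgM; first exact: cvg_cst.
      by apply: cvgB; [apply: cvgD; exact: cBjl|exact: cvg_cst].
    apply: ae_imply co => u hu u0.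
    by rewrite -qE Bid//; exact: hu.
  have [t0|t0] := leP 0 t; first exact: nonneg.
  have -> : B t = B 0 by rewrite /B max_r ?(ltW t0)// max_l.
  exact: nonneg.
pose w0 k := v0 k \o clamp01; pose j0 k := i0 k \o clamp01.
have [cw0 lw0] : (forall k, continuous (w0 k)) /\ (forall k, Lp_loc p (w0 k)).
  by split=> k; have [] := clamped_Lp_loc hp (cdata k).1.
have [cj0 lj0] : (forall k, continuous (j0 k)) /\ (forall k, Lp_loc p (j0 k)).
  by split=> k; have [] := clamped_Lp_loc hp (cdata k).2.
have w0E k x : 0 <= x <= 1 -> w0 k x = v0 k x by move=> h; rewrite /w0 /= clamp01_id.
have j0E k x : 0 <= x <= 1 -> j0 k x = i0 k x by move=> h; rewrite /j0 /= clamp01_id.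
have oo x : 0 < x < 1 -> 0 <= x <= 1 by move=> /andP[/ltW -> /ltW ->].
have sol' : telegrapher_solution L C p A v0 i0
    (voltage L C B alpha delta w0 j0) (current L C B alpha delta w0 j0).
  apply: (constructed_solution hL hC a0 d0 dd hp) => //.
  + by move=> j l; exact: continuous_measurable_fun.
  + by apply: aeW => t; exact: Bid.
  + by apply: aeW => t _; exact: coB.
  + by move=> k; apply: aeW => x /oo; exact: w0E.
  + by move=> k; apply: aeW => x /oo; exact: j0E.
have compat' : col_mx (\col_k w0 k 0) (\col_k w0 k 1) =
    B 0 *m col_mx (\col_k - j0 k 0) (\col_k j0 k 1).
  have z01 : 0 <= (0 : R) <= 1 by rewrite lexx ler01.
  have o01 : 0 <= (1 : R) <= 1 by rewrite lexx ler01.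
  have vE x : 0 <= x <= 1 -> \col_k w0 k x = \col_k v0 k x :> 'cV_N.
    by move=> x01; apply/matrixP => k q; rewrite !mxE w0E.
  have iE x : 0 <= x <= 1 -> \col_k j0 k x = \col_k i0 k x :> 'cV_N.
    by move=> x01; apply/matrixP => k q; rewrite !mxE j0E.
  have iNE : \col_k - j0 k 0 = \col_k - i0 k 0 :> 'cV_N.
    by apply/matrixP => k q; rewrite !mxE j0E.
  by rewrite Bid// !vE// iE// iNE.
exists (voltage L C B alpha delta w0 j0), (current L C B alpha delta w0 j0) => k.
have [cv ci] := voltage_current_continuous hL hC a0 d0 dd cBjl coB cw0 cj0 compat' k.
split.
- exact: (telegrapher_solution_unique hL hC hp A_coercive sol sol').
- by split; exact: continuous_subspaceT.
- move=> x x01; rewrite -(w0E k)// -(j0E k)//.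
  exact: voltage_current_initial.
Qed.
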